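(* Let $\mu$ be a finite positive Borel measure on $[0,1)$ and let $0<\alpha<1$. If $\mathcal{H}_\mu$ is bounded from $\mathcal{B}^\alpha$ to $\mathcal{B}$, then $$\|\mathcal{H}_\mu\|_e^{\mathcal{B}^\alpha\to\mathcal{B}}=\|\mathcal{H}_\mu\|_e^{\mathcal{B}^\alpha\to BMOA}=0.$$
   Context: $\mathbb{D}=\{z\in\mathbb{C}:|z|<1\}$ and $H(\mathbb{D})$ is the space of analytic functions on $\mathbb{D}$. For $0<\alpha<\infty$, the Bloch type space $\mathcal{B}^\alpha$ consists of all $f\in H(\mathbb{D})$ with $\|f\|_{\mathcal{B}^\alpha}=\sup_{z\in\mathbb{D}}|f'(z)|(1-|z|^2)^\alpha<\infty$; it is a Banach space with the norm $|f(0)|+\|f\|_{\mathcal{B}^\alpha}$. The Bloch space is $\mathcal{B}=\mathcal{B}^1$. $BMOA$ is the Banach space of all $f\in H(\mathbb{D})$ with $\|f\|_{BMOA}=|f(0)|+\sup_{a\in\mathbb{D}}\|f\circ\varphi_a-f(a)\|_{H^2}<\infty$, where $\varphi_a(z)=\frac{a-z}{1-\bar a z}$ and $H^2$ is the Hardy space. For a finite positive Borel measure $\mu$ on $[0,1)$ put $\mu_n=\int_{[0,1)}t^n\,d\mu(t)$, $n\ge 0$. The operator $\mathcal{H}_\mu$ acts on $f(z)=\sum_{k=0}^\infty a_kz^k\in H(\mathbb{D})$ by $$\mathcal{H}_\mu(f)(z)=\sum_{n=0}^\infty\Big(\sum_{k=0}^\infty\mu_{n+k}a_k\Big)z^n,$$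 whenever the right-hand side makes sense (the inner series converge) and defines an analytic function in $\mathbb{D}$. Saying that $\mathcal{H}_\mu$ is bounded from $X$ into $Y$ means that $\mathcal{H}_\mu(f)$ is well defined and belongs to $Y$ for every $f\in X$, and the resulting linear operator $X\to Y$ is bounded. The essential norm of a continuous linear operator $T:X\to Y$ between Banach spaces is $\|T\|_e^{X\to Y}=\inf\{\|T-K\|: K:X\to Y \text{ compact linear}\}$, where $\|\cdot\|$ is the operator norm. (Part of the assertion is that $\mathcal{H}_\mu$ is also bounded from $\mathcal{B}^\alpha$ to $BMOA$, so that the second essential norm is defined.) *)

(* Defs.v *)
From HB Require Import structures.
From mathcomp Require Import all_boot all_order all_algebra.
From mathcomp Require Import complex ring lra.
From mathcomp Require Import all_classical all_reals all_analysis.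
From mathcomp Require Import measurable_realfun.

Set Implicit Arguments.
Unset Strict Implicit.
Unset Printing Implicit Defensive.

Import Order.TTheory GRing.Theory Num.Theory numFieldNormedType.Exports.
Local Open Scope classical_set_scope.
Local Open Scope ring_scope.
Local Open Scope complex_scope.

(* R[i] with the topology of its modulus, as a normed space over itself, so
   that [derivable f z 1] and [derive1 f z] are complex differentiability and
   the complex derivative. *)
HB.instance Definition _ (R : realType) := NormedModule.copy R[i] (R[i])^o.

(* The real-valued modulus; [`|z|] is [(normc z)%:C], an element of R[i]. *)
Notation normc := (@Normc.normc _).

Section Modulus.
Context {R : realType}.
Implicit Types z w : R[i].

Lemma normcE z : `|z| = (normc z)%:C. Proof. by []. Qed.

Lemma normc_ge0 z : 0 <= normc z.
Proof. by have := normr_ge0 z; rewrite normcE lecE /= => /andP[]. Qed.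

Lemma normcC0 : normc (0 : R[i]) = 0.
Proof. exact: Normc.normc0. Qed.

Lemma normcD_le z w : normc (z + w) <= normc z + normc w.
Proof. exact: le_normcD. Qed.

Lemma normcM z w : normc (z * w) = normc z * normc w.
Proof. exact: Normc.normcM. Qed.

Lemma normcV z : normc z^-1 = (normc z)^-1.
Proof. exact: Normc.normcV. Qed.

Lemma normc_sub z w : normc (z - w) = normc (w - z).
Proof. by rewrite -opprB; exact: normcN. Qed.

Lemma normc_real (x : R) : normc x%:C = `|x|.
Proof. by rewrite /= expr0n/= addr0 sqrtr_sqr. Qed.

Local Arguments Normc.normc : simpl never.

Lemma normc_dist_dist z w : `|normc z - normc w| <= normc (z - w).
Proof.
rewrite ler_norml; apply/andP; split.
  rewrite lerNl opprB lerBlDr -{1}(subrK z w) normc_sub.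
  exact: normcD_le.
by rewrite lerBlDr -{1}(subrK w z); exact: normcD_le.
Qed.

Lemma normc_Re_le z : `|complex.Re z| <= normc z.
Proof. by have := normc_ge_Re z; rewrite normcE lecR. Qed.

Lemma normc_Im_le z : `|complex.Im z| <= normc z.
Proof.
case: z => a b /=; rewrite /Normc.normc -sqrtr_sqr ler_sqrt ?addr_ge0 ?sqr_ge0//.
by rewrite lerDr sqr_ge0.
Qed.

Lemma gt0_complexE (e : R[i]) : 0 < e -> e = (complex.Re e)%:C /\ 0 < complex.Re e.
Proof. by case: e => a b; rewrite ltcE /= => /andP[/eqP -> ->]. Qed.

Lemma cvgC_normcP (T : Type) (F : set_system T) {FF : Filter F}
    (f : T -> R[i]) l :
  f @ F --> l <-> forall e : R, 0 < e -> \forall x \near F, normc (f x - l) < e.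
Proof.
split=> [/cvgrPdist_lt fl e e0|fl].
  have e0' : 0 < e%:C by rewrite ltcR.
  apply: filterS (fl _ e0') => x; rewrite normcE ltcR normc_sub; exact.
apply/cvgrPdist_lt => e /gt0_complexE[-> e0].
by apply: filterS (fl _ e0) => x; rewrite normcE ltcR normc_sub.
Qed.

Lemma continuous_normc (h : R -> R[i]) :
  continuous h -> continuous (normc \o h).
Proof.
move=> ch t; apply/cvgrPdist_lt => e e0.
have /cvgC_normcP/(_ e e0) := ch t.
apply: filterS => x /=; apply: le_lt_trans.
by rewrite distrC normc_dist_dist.
Qed.

End Modulus.

Local Arguments Normc.normc : simpl never.

Section Disc.
Variable R : realType.
Local Notation C := R[i].

Definition disc : set C := [set z | normc z < 1].

Definition holomorphic (f : C -> C) :=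
  forall z : C, disc z -> derivable f z 1.

(* A function on the disc is represented by its extension by 0 to R[i], so
   that equality of functions is equality on the disc. *)
Definition zero_off_disc (f : C -> C) := forall z : C, ~ disc z -> f z = 0.

Definition bloch_norm (alpha : R) (f : C -> C) : \bar R :=
  ((normc (f 0))%:E +
   ereal_sup [set (normc (derive1 f z) * (1 - normc z ^+ 2) `^ alpha)%:E
             | z in disc])%E.

Definition circle_pt (r t : R) : C := r%:C * (cos t +i* sin t).

(* (1/(2 pi) int_0^{2 pi} |g (r e^{it})|^2 dt)^{1/2} *)
Definition circle_mean2 (g : C -> C) (r : R) : \bar R :=
  ((((2 * pi)^-1)%:E * \int[lebesgue_measure]_(t in `[0%R, (2 * pi)%R])
     (normc (g (circle_pt r t)) ^+ 2)%:E) `^ 2^-1)%E.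

Definition hardy2_norm (g : C -> C) : \bar R :=
  ereal_sup [set circle_mean2 g r | r in `[0, 1[].

Definition mobius (a z : C) : C := (a - z) / (1 - a^* * z).

Definition bmoa_norm (f : C -> C) : \bar R :=
  ((normc (f 0))%:E +
   ereal_sup [set hardy2_norm (fun z => (f (mobius a z) - f a)%R) | a in disc])%E.

(* What is needed of an extended-real functional for it to be a norm on the
   space of holomorphic functions where it is finite; instances are
   [bloch_dnorm] and [bmoa_dnorm] below. *)
Record disc_norm := DiscNorm {
  dnorm :> (C -> C) -> \bar R;
  dnorm_ge0 : forall f, (0 <= dnorm f)%E;
  dnormD : forall f g, holomorphic f -> holomorphic g ->
    (dnorm (f + g)%R <= dnorm f + dnorm g)%E;
  dnormZ : forall (c : C) f, holomorphic f ->
    (dnorm (c *: f)%R <= (normc c)%:E * dnorm f)%E;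
  dnorm_eq0 : forall f, holomorphic f -> dnorm f = 0%E ->
    forall z, disc z -> f z = 0 }.

Lemma disc0 : disc 0. Proof. by rewrite /disc/= normcC0 ltr01. Qed.

Lemma holomorphicD f g : holomorphic f -> holomorphic g -> holomorphic (f + g).
Proof. by move=> hf hg z Dz; apply: derivableD; [exact: hf|exact: hg]. Qed.

Lemma holomorphicZ c f : holomorphic f -> holomorphic (c *: f).
Proof. by move=> hf z Dz; apply: derivableZ; exact: hf. Qed.

Lemma derivative_estimate (f : C -> C) (w : C) : derivable f w 1 ->
  derive1 f w = 0 -> forall e : R, 0 < e ->
  exists2 d : R, 0 < d &
    forall u, normc u < d -> normc (f (w + u) - f w) <= e * normc u.
Proof.
move=> df dw0 e e0.
have : h^-1 *: ((f \o shift w) (h *: 1) - f w) @[h --> 0^'] --> derive1 f w.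
  by rewrite derive1E; exact: df.
rewrite dw0 => /cvgC_normcP/(_ e e0).
move=> /nbhs_ballP[d /= /gt0_complexE[dE d0]]; rewrite dE => H.
exists (complex.Re d) => // u ud.
have [->|u0] := eqVneq u 0.
  by rewrite addr0 subrr normcC0 mulr0.
have := H u; rewrite -ball_normE /ball_/= sub0r normrN normcE ltcR.
move=> /(_ ud u0).
rewrite subr0 /shift/= scaler1 normcM (addrC u) => /ltW K.
have un0 : 0 < normc u.
  rewrite lt_def normc_ge0 andbT; apply: contra_neq u0; exact: Normc.eq0_normc.
by move: K; rewrite normcV mulrC ler_pdivrMr.
Qed.

Lemma derive1_eq0_cst (f : C -> C) : holomorphic f ->
  (forall z, disc z -> derive1 f z = 0) -> forall z, disc z -> f z = f 0.
Proof.
move=> hf df0 z Dz.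
have [->//|z0] := eqVneq z 0.
have nz0 : 0 < normc z.
  rewrite lt_def normc_ge0 andbT; apply: contra_neq z0; exact: Normc.eq0_normc.
have Dtz (t : R) : t \in `[0, 1] -> disc (t%:C * z).
  rewrite in_itv/= => /andP[t0 t1]; rewrite /disc/= normcM normc_real.
  rewrite ger0_norm//; apply: le_lt_trans Dz.
  by rewrite ler_piMl// normc_ge0.
suff key (p : C -> R) : (forall w, `|p w| <= normc w) ->
    (forall w w', p (w - w') = p w - p w') -> p (f z) = p (f 0).
  have := key (@complex.Re R) (@normc_Re_le R).
  have := key (@complex.Im R) (@normc_Im_le R).
  case: (f z) => a b; case: (f 0) => c d /= -> => [->|[? ?] [? ?]] => //.
  by case=> ? ? [].
move=> ple pB.
pose g (t : R) : R := p (f (t%:C * z)).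
have gest (t : R) : t \in `[0, 1] -> forall e : R, 0 < e ->
    \forall h \near (0 : R), `|g (h + t) - g t| <= e * `|h|.
  move=> t01 e e0.
  have [d d0 H] := derivative_estimate (hf _ (Dtz _ t01)) (df0 _ (Dtz _ t01))
    (divr_gt0 e0 nz0).
  exists (d / normc z) => /=; first exact: divr_gt0.
  move=> h /=; rewrite sub0r normrN => hd.
  rewrite /g -pB; apply: (le_trans (ple _)).
  have -> : (h + t)%:C * z = t%:C * z + h%:C * z.
    by rewrite addrC rmorphD/= mulrDl.
  apply: (le_trans (H _ _)).
    by rewrite normcM normc_real -ltr_pdivlMr.
  rewrite normcM normc_real (mulrC `|h|) mulrA divfK//.
  by rewrite gt_eqF.
have gder (t : R) : t \in `[0, 1] -> is_derive t 1 g 0.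
  move=> t01.
  have G : h^-1 *: ((g \o shift t) (h *: 1) - g t) @[h --> (0:R)^'] --> (0:R).
    apply/cvgrPdist_le => e e0.
    have := gest _ t01 _ e0 => G; near=> h.
    have h0 : h != 0 by near: h; exact: nbhs_dnbhs_neq.
    rewrite sub0r normrN /= normrM normfV mulrC ler_pdivrMr ?normr_gt0//.
    rewrite [h *: 1]mulr1; near: h; exact: (nbhs_dnbhs G).
  by split; [apply/cvg_ex; exists 0|exact/cvg_lim].
have gder' (t : R) : t \in `]0, 1[ -> is_derive t 1 g ((fun=> 0 : R) t).
  by move=> t01; apply: gder; exact: subset_itv_oo_cc.
have gcont : {within `[0, 1], continuous g}.
  apply: continuous_in_subspaceT => t; rewrite inE/= => t01.
  by apply/differentiable_continuous/derivable1_diffP; case: (gder _ t01).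
have [c _] := MVT ltr01 gder' gcont.
rewrite mul0r /g => /eqP; rewrite subr_eq0 => /eqP.
by rewrite mul1r mul0r.
Unshelve. all: by end_near. Qed.

Lemma bloch_sup_ge0 (alpha : R) f :
  (0 <= ereal_sup [set (normc (derive1 f z) *
                        (1 - normc z ^+ 2) `^ alpha)%:E | z in disc])%E.
Proof.
apply: (@le_trans _ _
  (normc (derive1 f 0) * (1 - normc 0 ^+ 2) `^ alpha)%:E).
  by rewrite lee_fin mulr_ge0 ?normc_ge0 ?powR_ge0.
by apply: ereal_sup_ubound; exists 0 => //; exact: disc0.
Qed.

Lemma bloch_norm_ge0 alpha f : (0 <= bloch_norm alpha f)%E.
Proof.
by rewrite adde_ge0 ?bloch_sup_ge0// lee_fin normc_ge0.
Qed.

Lemma bloch_normD alpha f g : holomorphic f -> holomorphic g ->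
  (bloch_norm alpha (f + g)%R <= bloch_norm alpha f + bloch_norm alpha g)%E.
Proof.
move=> hf hg; rewrite /bloch_norm addeACA ?fin_num_adde_defl//.
rewrite leeD//; first by rewrite -EFinD lee_fin normcD_le.
apply: ub_ereal_sup => _ [z Dz <-].
apply: (@le_trans _ _ ((normc (derive1 f z) * (1 - normc z ^+ 2) `^ alpha)%:E +
  (normc (derive1 g z) * (1 - normc z ^+ 2) `^ alpha)%:E)%E); last first.
  by apply: leeD; apply: ereal_sup_ubound; exists z.
rewrite -EFinD lee_fin -mulrDl ler_wpM2r ?powR_ge0//.
rewrite !derive1E deriveD; [exact: normcD_le|exact: hf|exact: hg].
Qed.

Lemma bloch_normZ alpha (c : C) f : holomorphic f ->
  (bloch_norm alpha (c *: f)%R <= (normc c)%:E * bloch_norm alpha f)%E.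
Proof.
move=> hf; rewrite /bloch_norm ge0_muleDr ?bloch_sup_ge0 ?lee_fin ?normc_ge0//.
rewrite leeD//; first by rewrite -EFinM lee_fin -normcM.
apply: ub_ereal_sup => _ [z Dz <-].
apply: (@le_trans _ _ ((normc c)%:E *
    (normc (derive1 f z) * (1 - normc z ^+ 2) `^ alpha)%:E)%E); last first.
  by rewrite lee_wpmul2l ?lee_fin ?normc_ge0//; apply: ereal_sup_ubound; exists z.
rewrite -EFinM lee_fin !derive1E deriveZ; last exact: hf.
by rewrite mulrA -normcM.
Qed.

Lemma bloch_norm_eq0 alpha f : holomorphic f -> bloch_norm alpha f = 0%E ->
  forall z, disc z -> f z = 0.
Proof.
move=> hf; rewrite /bloch_norm; set S := ereal_sup _ => /eqP.
have S0 : (0 <= S)%E by exact: bloch_sup_ge0.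
rewrite padde_eq0 ?lee_fin ?normc_ge0// => /andP[/eqP[f00] /eqP S00] z Dz.
rewrite (derive1_eq0_cst hf)//; first exact: Normc.eq0_normc.
move=> w Dw; apply: Normc.eq0_normc; apply/eqP; rewrite eq_le normc_ge0 andbT.
have : ((normc (derive1 f w) * (1 - normc w ^+ 2) `^ alpha)%:E <= S)%E.
  by apply: ereal_sup_ubound; exists w.
rewrite S00 lee_fin pmulr_lle0// powR_gt0// subr_gt0.
by rewrite expr_lt1// normc_ge0.
Qed.

Definition bloch_dnorm alpha := DiscNorm (@bloch_norm_ge0 alpha)
  (@bloch_normD alpha) (@bloch_normZ alpha) (@bloch_norm_eq0 alpha).


Lemma normc_sqr (z : C) : normc z ^+ 2 = complex.Re z ^+ 2 + complex.Im z ^+ 2.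
Proof. by case: z => x y; rewrite /Normc.normc sqr_sqrtr// addr_ge0// sqr_ge0. Qed.

Lemma disc_sqr (z : C) : disc z <-> complex.Re z ^+ 2 + complex.Im z ^+ 2 < 1.
Proof. by rewrite -normc_sqr expr_lt1// normc_ge0. Qed.

Lemma mobius_identity (a z : C) :
  normc (1 - a^* * z) ^+ 2 - normc (a - z) ^+ 2 =
  (1 - normc a ^+ 2) * (1 - normc z ^+ 2).
Proof. by rewrite !normc_sqr; case: a => a b; case: z => c d /=; ring. Qed.

Lemma mobius_den (a z : C) : disc a -> disc z ->
  normc (a - z) < normc (1 - a^* * z).
Proof.
move=> Da Dz; rewrite -(@ltr_pXn2r _ 2)// ?nnegrE ?normc_ge0//.
by rewrite -subr_gt0 mobius_identity mulr_gt0// subr_gt0 expr_lt1// normc_ge0.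
Qed.

Lemma mobius_den_neq0 (a z : C) : disc a -> disc z -> 1 - a^* * z != 0.
Proof.
move=> Da Dz; apply/eqP => E; have := mobius_den Da Dz.
by rewrite E normcC0 ltNge normc_ge0.
Qed.

Lemma mobius_disc (a z : C) : disc a -> disc z -> disc (mobius a z).
Proof.
move=> Da Dz; have H := mobius_den Da Dz.
rewrite /disc/= /mobius normcM normcV ltr_pdivrMr ?mul1r//.
by apply: le_lt_trans H; exact: normc_ge0.
Qed.

Lemma circle_pt_normc (r t : R) : 0 <= r -> normc (circle_pt r t) = r.
Proof.
move=> r0; rewrite /circle_pt normcM normc_real ger0_norm//.
by rewrite {1}/Normc.normc cos2Dsin2 sqrtr1 mulr1.
Qed.

Lemma circle_pt_disc (r t : R) : r \in `[0, 1[ -> disc (circle_pt r t).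
Proof. by rewrite in_itv/= => /andP[r0 r1]; rewrite /disc/= circle_pt_normc. Qed.

Lemma circle_pt_continuous (r : R) : continuous (circle_pt r).
Proof.
move=> t; apply/cvgC_normcP => e e0.
have e20 : 0 < e / (2 * (`|r| + 1)) by rewrite divr_gt0// mulr_gt0// ltr_wpDl.
have /cvgrPdist_lt/(_ _ e20) Hc := @continuous_cos R t.
have /cvgrPdist_lt/(_ _ e20) Hs := @continuous_sin R t.
near=> x.
rewrite /circle_pt -mulrBr normcM normc_real.
have E : (cos x +i* sin x) - (cos t +i* sin t) =
    (cos x - cos t)%:C + (0 +i* 1) * (sin x - sin t)%:C.
  by apply/eqP; rewrite eq_complex/= !mul0r !mul1r subr0 !add0r !addr0 !eqxx.
rewrite E; apply: (@le_lt_trans _ _ (`|r| * (`|cos x - cos t| + `|sin x - sin t|))).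
  rewrite ler_wpM2l// (le_trans (normcD_le _ _))// normcM !normc_real.
  by rewrite (_ : normc (0 +i* 1) = 1) ?mul1r// /Normc.normc expr0n/= add0r expr1n sqrtr1.
have Hx : `|cos x - cos t| < e / (2 * (`|r| + 1)).
  by rewrite distrC; near: x; exact: Hc.
have Hy : `|sin x - sin t| < e / (2 * (`|r| + 1)).
  by rewrite distrC; near: x; exact: Hs.
have r1 : 0 < `|r| + 1 by rewrite ltr_wpDl.
apply: (@le_lt_trans _ _ (`|r| * (e / (`|r| + 1)))).
  rewrite ler_wpM2l// (le_trans (ltW (ltrD Hx Hy)))//.
  by rewrite le_eqVlt; apply/orP; left; apply/eqP; field; rewrite gt_eqF.
by rewrite mulrCA gtr_pMr// ltr_pdivrMr// mul1r ltrDl.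
Unshelve. all: by end_near. Qed.

Lemma holomorphic_continuous f z : holomorphic f -> disc z ->
  {for z, continuous f}.
Proof.
by move=> hf Dz; apply/differentiable_continuous/derivable1_diffP; exact: hf.
Qed.

Lemma mobius_circle_continuous (a : C) (r : R) : disc a -> r \in `[0, 1[ ->
  continuous (fun t => mobius a (circle_pt r t)).
Proof.
move=> Da r01.
have cc := @circle_pt_continuous r.
have cst (b : C) (t : R) : {for t, continuous (fun=> b : C)} by exact: cvg_cst.
have cn : continuous (fun t => a - circle_pt r t).
  by move=> t; apply: (continuousB (cst a t) (cc t)).
have cm : continuous (fun t => a^* * circle_pt r t).
  by move=> t; apply: (continuousM (cst a^* t) (cc t)).
have cd : continuous (fun t => 1 - a^* * circle_pt r t).
  by move=> t; apply: (continuousB (cst 1 t) (cm t)).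
have cv : continuous (fun t => (1 - a^* * circle_pt r t)^-1).
  move=> t; apply: (continuousV _ (cd t)).
  exact: mobius_den_neq0 (circle_pt_disc _ _).
by move=> t; apply: (continuousM (cn t) (cv t)).
Qed.

Lemma bmoa_circle_continuous f (a : C) (r : R) : holomorphic f -> disc a ->
  r \in `[0, 1[ ->
  continuous (fun t => normc (f (mobius a (circle_pt r t)) - f a)).
Proof.
move=> hf Da r01.
apply: (@continuous_normc R (fun t => f (mobius a (circle_pt r t)) - f a)) => t.
apply: cvgB; last exact: cvg_cst.
apply: (@continuous_comp _ _ _ (fun t => mobius a (circle_pt r t)) f).
  exact: mobius_circle_continuous.
by apply: holomorphic_continuous => //; exact/mobius_disc/circle_pt_disc.
Qed.

Definition mean2 (h : R -> R) : \bar R :=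
  ((((2 * pi)^-1)%:E * \int[lebesgue_measure]_(t in `[0%R, (2 * pi)%R])
     (h t ^+ 2)%:E) `^ 2^-1)%E.

Lemma pi2_ge0 : 0 <= (2 * pi : R)^-1.
Proof. by rewrite invr_ge0 mulr_ge0// pi_ge0. Qed.

Lemma int_sqr_ge0 (h : R -> R) (D : set R) :
  (0 <= \int[lebesgue_measure]_(t in D) (h t ^+ 2)%:E)%E.
Proof. by apply: integral_ge0 => t _; rewrite lee_fin sqr_ge0. Qed.

Lemma mean2_Lnorm (h : R -> R) :
  (mean2 h = ((2 * pi)^-1)%:E `^ 2^-1 *
    'N[lebesgue_measure]_2%:E[EFin \o (h \_ `[0%R, (2 * pi)%R])%R])%E.
Proof.
rewrite /mean2 poweRM ?lee_fin ?pi2_ge0 ?int_sqr_ge0//; congr (_ * _)%E.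
rewrite unlock /= integral_mkcond; congr (_ `^ _)%E; apply: eq_integral => t _.
rewrite /patch; case: ifP => _ /=; last by rewrite normr0 powR0.
by rewrite -[2]/(2%:R) powR_mulrn// real_normK// num_real.
Qed.

Lemma mean2D (h1 h2 : R -> R) : continuous h1 -> continuous h2 ->
  (mean2 (h1 \+ h2)%R <= mean2 h1 + mean2 h2)%E.
Proof.
move=> c1 c2; have mD : measurable (`[0, 2 * pi] : set R) by [].
have m (h : R -> R) : continuous h ->
    measurable_fun setT (h \_ `[0, 2 * pi]).
  move=> ch; apply/(measurable_restrictT _ _).1 => //.
  apply: measurable_funTS; exact: continuous_measurable_fun.
rewrite !mean2_Lnorm -ge0_muleDr ?Lnorm_ge0// lee_wpmul2l ?poweR_ge0//.
have -> : (h1 \+ h2) \_ `[0, 2 * pi] = h1 \_ `[0, 2 * pi] \+ h2 \_ `[0, 2 * pi].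
  by apply/funext => t; rewrite /patch/=; case: ifP => // _; rewrite addr0.
apply: minkowski => //; [exact: m|exact: m|by rewrite ler1n].
Qed.

Lemma mean2_le (h1 h2 : R -> R) : continuous h1 -> continuous h2 ->
  (forall t, 0 <= h1 t <= h2 t) -> (mean2 h1 <= mean2 h2)%E.
Proof.
move=> c1 c2 h12; apply: gt0_ler_poweR => //.
- by rewrite in_itv/= leey andbT mule_ge0 ?lee_fin ?pi2_ge0 ?int_sqr_ge0.
- by rewrite in_itv/= leey andbT mule_ge0 ?lee_fin ?pi2_ge0 ?int_sqr_ge0.
rewrite lee_wpmul2l ?lee_fin ?pi2_ge0//; apply: ge0_le_integral => //.
- by move=> t _; rewrite lee_fin sqr_ge0.
- apply/measurable_EFinP/measurable_funTS/measurable_funX.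
  exact: continuous_measurable_fun.
- apply/measurable_EFinP/measurable_funTS/measurable_funX.
  exact: continuous_measurable_fun.
- move=> t _; have /andP[h0 hle] := h12 t.
  by rewrite lee_fin ler_sqr// nnegrE// (le_trans h0).
Qed.

Lemma mean2Z (k : R) (h : R -> R) : continuous h -> 0 <= k ->
  mean2 (fun t => k * h t) = (k%:E * mean2 h)%E.
Proof.
move=> ch k0; rewrite /mean2.
under eq_integral do rewrite exprMn EFinM.
rewrite ge0_integralZl_EFin ?sqr_ge0//; last 2 first.
- by move=> t _; rewrite lee_fin sqr_ge0.
- apply/measurable_EFinP/measurable_funTS/measurable_funX.
  exact: continuous_measurable_fun.
rewrite muleCA (@poweRM _ (k ^+ 2)%:E) ?lee_fin ?sqr_ge0//; last first.
  by rewrite mule_ge0 ?lee_fin ?pi2_ge0 ?int_sqr_ge0.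
by rewrite poweR_EFin powR12_sqrt ?sqr_ge0// sqrtr_sqr ger0_norm.
Qed.

Lemma int_sqr_eq0 (b : R) (h : R -> R) : 0 < b -> continuous h ->
  (\int[lebesgue_measure]_(t in `[0%R, b]) (h t ^+ 2)%:E = 0)%E ->
  forall t, t \in `[0, b] -> h t = 0.
Proof.
move=> b0 ch int0 t0; rewrite in_itv/= => /andP[t00 t0b].
apply/eqP; apply: contraT => ht0.
have c0 : 0 < h t0 ^+ 2 / 2 by rewrite divr_gt0// exprn_even_gt0.
have ch2 : continuous (fun t => h t ^+ 2).
  by move=> t; apply: (continuousM (ch t) (ch t)).
have /cvgrPdist_lt/(_ _ c0)[d /= d0 H] := ch2 t0.
have Hge (t : R) : `|t0 - t| < d -> h t0 ^+ 2 / 2 <= h t ^+ 2.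
  move=> /H /=; rewrite ltr_norml => /andP[_ ?]; lra.
pose l := Num.max 0 (t0 - d / 2); pose u := Num.min b (t0 + d / 2).
have lu : l < u.
  by rewrite lt_min !gt_max; apply/andP; split; apply/andP; split; lra.
have sub : `[l, u] `<=` (`[0, b] : set R).
  move=> t /=; rewrite !in_itv/= ge_max le_min.
  by move=> /andP[/andP[-> _] /andP[-> _]].
have mh : measurable_fun (`[0%R, b] : set R) (fun t => (h t ^+ 2)%:E).
  apply/measurable_EFinP/measurable_funTS.
  exact: continuous_measurable_fun.
suff : (0 < \int[lebesgue_measure]_(t in `[0%R, b]) (h t ^+ 2)%:E)%E.
  by rewrite int0 ltxx.
apply: (@lt_le_trans _ _
  (\int[lebesgue_measure]_(t in `[l, u]) (h t0 ^+ 2 / 2)%:E)%E).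
  rewrite integral_cst//= lebesgue_measure_itv/= lte_fin lu -EFinD -EFinM lte_fin.
  by rewrite mulr_gt0// subr_gt0.
apply: (@le_trans _ _ (\int[lebesgue_measure]_(t in `[l, u]) (h t ^+ 2)%:E)%E).
  apply: ge0_le_integral => //.
  - by move=> t _; rewrite lee_fin ltW.
  - exact: measurable_funS mh.
  - move=> t /=; rewrite in_itv/= ge_max le_min.
    move=> /andP[/andP[_ lt] /andP[_ tu]]; rewrite lee_fin; apply: Hge.
    by rewrite ltr_norml; apply/andP; split; lra.
by apply: ge0_subset_integral => // t _; rewrite lee_fin sqr_ge0.
Qed.

Lemma polar (z : C) : z != 0 ->
  exists2 t, t \in `[0, 2 * pi] & z = circle_pt (normc z) t.
Proof.
move=> z0; set r := normc z.
have r0 : 0 < r.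
  rewrite lt_def normc_ge0 andbT; apply: contra_neq z0; exact: Normc.eq0_normc.
pose x := complex.Re z / r.
have x1 : -1 <= x <= 1.
  by rewrite -ler_norml normrM normfV (gtr0_norm r0) ler_pdivrMr// mul1r normc_Re_le.
have s0 : 0 <= 1 - x ^+ 2.
  by rewrite subr_ge0 -real_normK ?num_real// expr_le1// ler_norml.
have sE : r * Num.sqrt (1 - x ^+ 2) = `|complex.Im z|.
  rewrite -[LHS]ger0_norm ?mulr_ge0 ?sqrtr_ge0 1?ltW//.
  apply/eqP; rewrite -(@eqrXn2 _ 2)//; apply/eqP.
  rewrite !real_normK ?num_real// exprMn sqr_sqrtr// mulrBr mulr1.
  rewrite /x expr_div_n mulrC divfK ?expf_neq0 ?gt_eqF//.
  by rewrite /r normc_sqr addrC addKr.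
have rx : r * x = complex.Re z by rewrite /x mulrC divfK// gt_eqF.
have xb : x \in `[-1, 1] by rewrite in_itv.
have a0 := acos_ge0 x1; have api := acos_lepi x1.
have [y0|y0] := leP 0 (complex.Im z).
  exists (acos x).
    by rewrite in_itv/= a0/= (le_trans api)// ler_peMl ?pi_ge0// ler1n.
  rewrite /circle_pt acosK// sin_acos//; apply/eqP.
  rewrite eq_complex/= !mul0r subr0 addr0 rx sE ger0_norm// !eqxx//.
exists (2 * pi - acos x).
  rewrite in_itv/= subr_ge0 gerBl a0 andbT (le_trans api)// ler_peMl ?pi_ge0//.
  by rewrite ler1n.
have -> : circle_pt r (2 * pi - acos x) = circle_pt r (- acos x).
  rewrite /circle_pt mulr_natl addrC.
  by rewrite cosD2pi sinD2pi.
rewrite /circle_pt cosN sinN acosK// sin_acos//; apply/eqP.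
by rewrite eq_complex/= !mul0r subr0 addr0 rx mulrN sE ltr0_norm// opprK !eqxx.
Qed.

Lemma hardy2_norm_ge0 g : (0 <= hardy2_norm g)%E.
Proof.
apply: (@le_trans _ _ (circle_mean2 g 0)); first exact: poweR_ge0.
by apply: ereal_sup_ubound; exists 0 => //=; rewrite in_itv/= lexx ltr01.
Qed.

Lemma bmoa_sup_ge0 f : (0 <= ereal_sup
  [set hardy2_norm (fun z => (f (mobius a z) - f a)%R) | a in disc])%E.
Proof.
apply: (@le_trans _ _ (hardy2_norm (fun z => (f (mobius 0 z) - f 0)%R))).
  exact: hardy2_norm_ge0.
by apply: ereal_sup_ubound; exists 0 => //; exact: disc0.
Qed.

Lemma bmoa_norm_ge0 f : (0 <= bmoa_norm f)%E.
Proof. by rewrite adde_ge0 ?bmoa_sup_ge0// lee_fin normc_ge0. Qed.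

Lemma bmoa_normD f g : holomorphic f -> holomorphic g ->
  (bmoa_norm (f + g)%R <= bmoa_norm f + bmoa_norm g)%E.
Proof.
move=> hf hg; rewrite /bmoa_norm addeACA ?fin_num_adde_defl//.
rewrite leeD//; first by rewrite -EFinD lee_fin normcD_le.
apply: ub_ereal_sup => _ [a Da <-]; apply: ub_ereal_sup => _ [r r01 <-].
pose F (f : C -> C) (t : R) : R := normc (f (mobius a (circle_pt r t)) - f a).
have cF k : holomorphic k -> continuous (F k).
  by move=> hk; exact: bmoa_circle_continuous.
apply: (@le_trans _ _ (mean2 (F f \+ F g)%R)).
  apply: (@mean2_le (F (f + g))); first exact/cF/holomorphicD.
    by move=> t; apply: cvgD; exact: cF.
  move=> t; rewrite normc_ge0/= /F.
  have -> : (f + g) (mobius a (circle_pt r t)) - (f + g) a =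
    (f (mobius a (circle_pt r t)) - f a) + (g (mobius a (circle_pt r t)) - g a).
    by rewrite addrACA -opprD.
  exact: normcD_le.
apply: (le_trans (mean2D (cF _ hf) (cF _ hg))); apply: leeD.
  apply: (@le_trans _ _ (hardy2_norm (fun z => (f (mobius a z) - f a)%R))).
    by apply: ereal_sup_ubound; exists r.
  by apply: ereal_sup_ubound; exists a.
apply: (@le_trans _ _ (hardy2_norm (fun z => (g (mobius a z) - g a)%R))).
  by apply: ereal_sup_ubound; exists r.
by apply: ereal_sup_ubound; exists a.
Qed.

Lemma bmoa_normZ (c : C) f : holomorphic f ->
  (bmoa_norm (c *: f)%R <= (normc c)%:E * bmoa_norm f)%E.
Proof.
move=> hf; rewrite /bmoa_norm ge0_muleDr ?bmoa_sup_ge0 ?lee_fin ?normc_ge0//.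
rewrite leeD//; first by rewrite -EFinM lee_fin -normcM.
apply: ub_ereal_sup => _ [a Da <-]; apply: ub_ereal_sup => _ [r r01 <-].
pose F (f : C -> C) (t : R) : R := normc (f (mobius a (circle_pt r t)) - f a).
have cF k : holomorphic k -> continuous (F k).
  by move=> hk; exact: bmoa_circle_continuous.
have -> : circle_mean2 (fun z => ((c *: f) (mobius a z) - (c *: f) a)%R) r =
    mean2 (fun t => normc c * F f t).
  by congr mean2; apply/funext => t; rewrite /F -normcM mulrBr.
rewrite mean2Z ?normc_ge0//; last exact: cF.
rewrite lee_wpmul2l ?lee_fin ?normc_ge0//.
apply: (@le_trans _ _ (hardy2_norm (fun z => (f (mobius a z) - f a)%R))).
  by apply: ereal_sup_ubound; exists r.
by apply: ereal_sup_ubound; exists a.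
Qed.

Lemma bmoa_norm_eq0 f : holomorphic f -> bmoa_norm f = 0%E ->
  forall z, disc z -> f z = 0.
Proof.
move=> hf; rewrite /bmoa_norm; set S := ereal_sup _ => /eqP.
rewrite padde_eq0 ?lee_fin ?normc_ge0 ?bmoa_sup_ge0//.
move=> /andP[/eqP[f00] /eqP S00] z Dz.
have {}f00 : f 0 = 0 by exact: Normc.eq0_normc.
have [->//|z0] := eqVneq z 0.
have nz0 : - z != 0 by rewrite oppr_eq0.
have [t t01 zE] := polar nz0.
pose r := normc (- z).
have r01 : r \in `[0, 1[.
  by rewrite in_itv/= normc_ge0/= /r -sub0r normc_sub subr0.
have cF := bmoa_circle_continuous hf disc0 r01.
have : circle_mean2 (fun z => f (mobius 0 z) - f 0) r = 0%E.
  apply/eqP; rewrite eq_le poweR_ge0 andbT -S00.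
  apply: (@le_trans _ _ (hardy2_norm (fun z => (f (mobius 0 z) - f 0)%R))).
    by apply: ereal_sup_ubound; exists r.
  by apply: ereal_sup_ubound; exists 0 => //; exact: disc0.
rewrite /circle_mean2 => /poweR_eq0_eq0.
rewrite mule_ge0 ?lee_fin ?pi2_ge0 ?int_sqr_ge0// => /(_ erefl) /eqP.
have pi2 : 0 < 2 * pi :> R by rewrite mulr_gt0// pi_gt0.
rewrite mule_eq0 eqe invr_eq0 gt_eqF//= => /eqP.
move=> /(int_sqr_eq0 pi2 cF) /(_ t t01) /Normc.eq0_normc.
by rewrite -zE /mobius f00 subr0 sub0r opprK rmorph0 mul0r subr0 divr1.
Qed.

Definition bmoa_dnorm := DiscNorm bmoa_norm_ge0 bmoa_normD bmoa_normZ
  bmoa_norm_eq0.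

End Disc.

Section FunctionSpace.
Context {R : realType} (N : disc_norm R).
Local Notation C := R[i].

Definition fspace_pred : {pred C -> C} :=
  fun f => `[< [/\ zero_off_disc f, holomorphic f & (N f < +oo)%E] >].

(* The space of holomorphic functions on the disc with finite norm N; for
   N = [bloch_dnorm alpha] and [bmoa_dnorm] these are the spaces B^alpha and
   BMOA. It is made a normedModType over R[i] below. *)
Record fspace := Fspace { fspace_val :> C -> C; _ : fspace_val \in fspace_pred }.

HB.instance Definition _ := [isSub for fspace_val].
HB.instance Definition _ := [Choice of fspace by <:].

Lemma fspaceP (f : fspace) :
  [/\ zero_off_disc f, holomorphic f & (N f < +oo)%E].
Proof. by case: f => f /= /asboolP. Qed.

Lemma fspace_pred_submod : submod_closed fspace_pred.
Proof.
split=> [|c f g /asboolP[f0 hf Nf] /asboolP[g0 hg Ng]]; apply/asboolP.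
  have h0 : holomorphic (0 : C -> C) by move=> z _; exact: derivable_cst.
  split=> //; apply: (@le_lt_trans _ _ 0%E) => //.
  by have := dnormZ N (0 : C) h0; rewrite scale0r normcC0 mul0e.
have hcf : holomorphic (c *: f) by exact: holomorphicZ.
split.
- by move=> z Dz; rewrite /= !fctE f0// g0// scaler0 addr0.
- exact: holomorphicD.
- apply: (le_lt_trans (dnormD N hcf hg)); rewrite lte_add_pinfty//.
  apply: (le_lt_trans (dnormZ N c hf)).
  by rewrite lte_mul_pinfty// lee_fin normc_ge0.
Qed.

HB.instance Definition _ :=
  GRing.isSubmodClosed.Build C (C -> C) fspace_pred fspace_pred_submod.
HB.instance Definition _ := [SubChoice_isSubLmodule of fspace by <:].

Lemma fspace_valD (f g : fspace) :
  fspace_val (f + g) = fspace_val f + fspace_val g.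
Proof. exact: (raddfD (\val : fspace -> (C -> C))). Qed.

Lemma fspace_valZ (c : C) (f : fspace) :
  fspace_val (c *: f) = c *: fspace_val f.
Proof. by []. Qed.

Definition fspace_norm (f : fspace) : C := (fine (N f))%:C.

Lemma fspace_fin (f : fspace) : N f \is a fin_num.
Proof. by have [_ _ Nf] := fspaceP f; rewrite ge0_fin_numE// dnorm_ge0. Qed.

Lemma fspace_normD (f g : fspace) :
  fspace_norm (f + g) <= fspace_norm f + fspace_norm g.
Proof.
have [_ hf _] := fspaceP f; have [_ hg _] := fspaceP g.
rewrite /fspace_norm -rmorphD lecR -lee_fin EFinD !fineK ?fspace_fin//.
by rewrite fspace_valD; exact: dnormD.
Qed.

Lemma fspace_normZ (c : C) (f : fspace) :
  fspace_norm (c *: f) = `|c| * fspace_norm f.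
Proof.
have le (b : C) (g : fspace) :
    fine (N (b *: g : fspace)) <= normc b * fine (N g).
  have [_ hg _] := fspaceP g.
  rewrite -lee_fin EFinM !fineK ?fspace_fin//.
  by rewrite fspace_valZ; exact: dnormZ.
rewrite /fspace_norm normcE -rmorphM; congr (_%:C).
apply/eqP; rewrite eq_le le/=.
have [->|c0] := eqVneq c 0.
  by rewrite normcC0 mul0r fine_ge0// dnorm_ge0.
have nc0 : 0 < normc c.
  rewrite lt_def normc_ge0 andbT; apply: contra_neq c0; exact: Normc.eq0_normc.
have := le c^-1 (c *: f); rewrite scalerA mulVf// scale1r normcV.
by rewrite ler_pdivlMl.
Qed.

Lemma fspace_norm_eq0 (f : fspace) : fspace_norm f = 0 -> f = 0.
Proof.
move=> /complexI; have [f0 hf _] := fspaceP f => Nf0.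
apply: val_inj; apply/funext => z /=.
have [Dz|nDz] := pselect (disc z); last exact: f0.
apply: (@dnorm_eq0 _ N _ hf _ z Dz).
by rewrite -(fineK (fspace_fin f)); congr (_%:E).
Qed.

HB.instance Definition _ := Lmodule_isNormed.Build C fspace
  fspace_normD fspace_normZ fspace_norm_eq0.

Lemma fspace_normE (f : fspace) : `|f| = (fine (N f))%:C.
Proof. by []. Qed.

End FunctionSpace.

Notation bloch alpha := (fspace (bloch_dnorm alpha)).
Notation bmoa R := (fspace (bmoa_dnorm R)).

Section Operators.
Context {R : realType} {U V : normedModType R[i]}.

Definition bounded_op (T : U -> V) :=
  exists M : R, forall x, `|T x| <= M%:C * `|x|.

(* The norm of a normedModType over R[i] takes its values in R[i]; they are
   real, and [complex.Re] maps them back to R. *)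
Definition opnorm (T : U -> V) : \bar R :=
  ereal_sup [set (complex.Re `|T x|)%:E | x in [set x : U | `|x| <= 1]].

Definition compact_op (K : U -> V) :=
  compact (closure (K @` [set x : U | `|x| <= 1])).

Definition essential_norm (T : U -> V) : \bar R :=
  ereal_inf [set opnorm (fun x => T x - K x) |
             K in [set K : {linear U -> V} | compact_op K]].

End Operators.

Section Hankel.
Context {R : realType}.
Local Notation C := R[i].
Variable mu : {finite_measure set (measurableTypeR R) -> \bar R}.

(* A finite Borel measure on [0, 1[ is represented by any finite Borel measure
   on R extending it: mu is used only through integrals over [0, 1[. *)
Definition moment (n : nat) : R := \int[mu]_(t in `[0, 1[) (t ^+ n).

Definition power_series_on_disc (a : nat -> C) (f : C -> C) :=
  forall z : C, disc z -> series (fun k => a k * z ^+ k) @ \oo --> f z.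

(* g = H_mu f. The sequences a and b are the Taylor coefficients of f and g at
   0, hence unique, so that this relation is functional on the disc. *)
Definition hankel_image (f g : C -> C) :=
  exists a b : nat -> C,
    [/\ power_series_on_disc a f,
        forall n, series (fun k => (moment (n + k))%:C * a k) @ \oo --> b n
      & power_series_on_disc b g].

Definition is_hankel_op (N1 N2 : disc_norm R) (T : fspace N1 -> fspace N2) :=
  forall f : fspace N1, hankel_image f (T f).

End Hankel.

(* Main.v *)
Require Import Defs.
From HB Require Import structures.
From mathcomp Require Import all_boot all_order all_algebra.
From mathcomp Require Import complex ring lra.
From mathcomp Require Import all_classical all_reals all_analysis.
From mathcomp Require Import measurable_realfun.
Set Implicit Arguments.
Unset Strict Implicit.
Unset Printing Implicit Defensive.
Import Order.TTheory GRing.Theory Num.Theory numFieldNormedType.Exports.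
Local Open Scope classical_set_scope.
Local Open Scope ring_scope.
Local Open Scope complex_scope.
Local Arguments Normc.normc : simpl never.

(** The operator is given by the integral
    [H f (z) = int f (t) / (1 - t z) dmu (t)], and only the values of [f] on
    [0, 1[ matter. Testing on [f = 1], the Bloch bound for [H 1] forces [mu] to
    be a Carleson measure: [mu [1 - d, 1[ <= A d]. Conversely, for a Carleson
    measure and any bounded measurable [h] on [0, 1[, the function
    [int h (t) / (1 - t z) dmu (t)] has Bloch and BMOA norms at most
    [K sup |h|]. For BMOA this comes from the identity
    [k (phi_a z) - k (a) = - t (1 - |a|^2) z / ((1 - t a)^2 (1 - c z))] for
    [k (z) = 1 / (1 - t z)] and [c = (conj a - t) / (1 - t a)], the
    Cauchy-Schwarz inequality with the weight
    [w (t) = ((1 - t |a|) sqrt (1 - t))^-1], Tonelli, and the Poisson integral;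
    the Carleson condition gives [int w dmu <= 48 A / sqrt (1 - |a|)].

    As [0 < alpha < 1], the unit ball of [B^alpha] is equicontinuous up to the
    endpoint 1 of [0, 1[: the oscillation of [f] on [s, t[ is controlled by
    [(1 - s)^(1 - alpha) - (1 - t)^(1 - alpha)]. Replacing [f] by a step
    function with values [f (t_j)] thus approximates [H] in operator norm by
    operators of finite rank, so that its essential norm is 0. That the given
    operator is the integral one rests on Abel's theorem, which identifies the
    possibly only conditionally convergent sums
    [sum_k mu_(n + k) a_k] with [int t^n f (t) dmu (t)]. *)

(** * Complex-valued integrals over [0, 1[ *)

(** The weight is chosen to balance the two factors of the Cauchy-Schwarz inequality. Since
    [w^2 = 1 / ((1 - t |a|)^2 (1 - t))], the circle integral of the squared kernel difference
    divided by [w] is at most [2 pi (1 - |a|^2) w], so the same integral of [w] controls both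
    factors. Its bound of order [(1 - |a|)^(-1/2)] appears squared and is absorbed by
    [1 - |a|^2 <= 2 (1 - |a|)], uniformly in [a].

    The norm estimates ask only that [h] be bounded and measurable. This is essential: they are
    applied to the difference between [f] and a step function, which is not the trace of a
    holomorphic function.

    In the integral representation the obstacle is the endpoint 1, where the Taylor series of [f]
    need not converge. For the dilation [f (r t)] with [r < 1] everything converges geometrically;
    Abel's theorem takes [r] to 1 on the side of the series, and a bound of order
    [(1 - r)^(1 - alpha)], uniform in [t], does so on the side of the integral. *)

Section RealMeasurability.
Context d (T : measurableType d) (R : realType).

(** Zeros of [f] are allowed: [0^-1] and the power [-1] of 0 are both 0. *)
Lemma measurable_funV_ge0 (D : set T) (f : T -> R) : measurable_fun D f ->
  (forall x, D x -> 0 <= f x) -> measurable_fun D (fun x => (f x)^-1).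
Proof.
move=> mf f0.
have : measurable_fun D ((fun y : R => y `^ (-1)) \o f).
  by apply: measurableT_comp mf; exact: measurable_powR.
by apply: eq_measurable_fun => x /set_mem Dx /=; rewrite powR_inv1 ?f0.
Qed.

Lemma measurable_fun_sqrt (D : set T) (f : T -> R) : measurable_fun D f ->
  measurable_fun D (fun x => Num.sqrt (f x)).
Proof.
move=> mf; apply: measurableT_comp mf.
by apply: continuous_measurable_fun; exact: sqrt_continuous.
Qed.

End RealMeasurability.

Section ComplexMeasurability.
Context d (T : measurableType d) (R : realType).
Local Notation C := R[i].
Implicit Types (D : set T) (f g : T -> C).

(** Componentwise, to match [cint], which integrates the real and imaginary parts separately. *)
Definition cmeasurable D f :=
  measurable_fun D (fun x => complex.Re (f x)) /\
  measurable_fun D (fun x => complex.Im (f x)).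

Lemma eq_cmeasurable D f g : {in D, f =1 g} ->
  cmeasurable D f -> cmeasurable D g.
Proof.
move=> fg [mr mi]; split.
  by apply: eq_measurable_fun mr => x Dx /=; rewrite fg.
by apply: eq_measurable_fun mi => x Dx /=; rewrite fg.
Qed.

Lemma cmeasurable_cst D c : cmeasurable D (fun=> c).
Proof. by split; exact: measurable_cst. Qed.

Lemma cmeasurable_real D (f : T -> R) : measurable_fun D f ->
  cmeasurable D (fun x => (f x)%:C).
Proof. by move=> mf; split => //=; exact: measurable_cst. Qed.

Lemma cmeasurableD D f g : cmeasurable D f -> cmeasurable D g ->
  cmeasurable D (fun x => f x + g x).
Proof.
move=> [fr fi] [gr gi]; split.
  apply: (eq_measurable_fun (fun x => complex.Re (f x) + complex.Re (g x))).
    by move=> x _; case: (f x) => a b; case: (g x).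
  exact: measurable_funD.
apply: (eq_measurable_fun (fun x => complex.Im (f x) + complex.Im (g x))).
  by move=> x _; case: (f x) => a b; case: (g x).
exact: measurable_funD.
Qed.

Lemma cmeasurableM D f g : cmeasurable D f -> cmeasurable D g ->
  cmeasurable D (fun x => f x * g x).
Proof.
move=> [fr fi] [gr gi]; split.
  apply: (eq_measurable_fun (fun x => complex.Re (f x) * complex.Re (g x) -
    complex.Im (f x) * complex.Im (g x))).
    by move=> x _; case: (f x) => a b; case: (g x).
  by apply: measurable_funB; exact: measurable_funM.
apply: (eq_measurable_fun (fun x => complex.Re (f x) * complex.Im (g x) +
    complex.Im (f x) * complex.Re (g x))).
  by move=> x _; case: (f x) => a b; case: (g x).
by apply: measurable_funD; exact: measurable_funM.
Qed.

Lemma cmeasurableN D f : cmeasurable D f -> cmeasurable D (fun x => - f x).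
Proof.
move=> mf; apply: (@eq_cmeasurable _ (fun x => -1 * f x)).
  by move=> x _; rewrite mulN1r.
by apply: cmeasurableM => //; exact: cmeasurable_cst.
Qed.

Lemma cmeasurableB D f g : cmeasurable D f -> cmeasurable D g ->
  cmeasurable D (fun x => f x - g x).
Proof. by move=> mf mg; apply/cmeasurableD/cmeasurableN. Qed.

Lemma measurable_normc D f : cmeasurable D f ->
  measurable_fun D (fun x => normc (f x)).
Proof.
move=> [fr fi].
apply: (eq_measurable_fun (fun x =>
  Num.sqrt (complex.Re (f x) ^+ 2 + complex.Im (f x) ^+ 2))).
  by move=> x _; rewrite /Normc.normc; case: (f x).
by apply/measurable_fun_sqrt/measurable_funD; exact: measurable_funX.
Qed.

Lemma cmeasurableV D f : cmeasurable D f -> cmeasurable D (fun x => (f x)^-1).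
Proof.
move=> mf; have mn := measurable_normc mf; move: (mf) => [fr fi].
have mV : measurable_fun D (fun x => (normc (f x) ^+ 2)^-1).
  by apply: measurable_funV_ge0 => [|x _]; [exact: measurable_funX|exact:
    sqr_ge0].
split.
  apply: (eq_measurable_fun (fun x => complex.Re (f x) * (normc (f x) ^+
    2)^-1)).
    by move=> x _; rewrite normc_sqr; case: (f x).
  exact: measurable_funM.
apply: (eq_measurable_fun (fun x => - (complex.Im (f x) * (normc (f x) ^+
  2)^-1))).
  by move=> x _; rewrite normc_sqr; case: (f x).
exact/measurable_funN/measurable_funM.
Qed.

End ComplexMeasurability.

Lemma normc_real_ge0 (R : realType) (x : R) : 0 <= x -> normc x%:C = x.
Proof. by move=> x0; rewrite normc_real ger0_norm. Qed.

Lemma normcX (R : realType) (z : R[i]) n : normc (z ^+ n) = normc z ^+ n.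
Proof.
elim: n => [|n IH]; last by rewrite !exprS normcM IH.
by rewrite !expr0 normc_real_ge0.
Qed.

Lemma normc_Re_Im_le (R : realType) (z : R[i]) :
  normc z <= `|complex.Re z| + `|complex.Im z|.
Proof.
rewrite -(@ler_pXn2r _ 2)// ?nnegrE ?normc_ge0 ?addr_ge0// normc_sqr sqrrD.
rewrite !real_normK ?num_real//; have := normr_ge0 (complex.Re z).
by have := normr_ge0 (complex.Im z); nra.
Qed.

Lemma normc_gt0 (R : realType) (z : R[i]) : (0 < normc z) = (z != 0).
Proof.
rewrite lt_def normc_ge0 andbT; congr (~~ _).
by apply/eqP/eqP => [/Normc.eq0_normc//|->]; rewrite normcC0.
Qed.

Lemma normc1 (R : realType) : normc (1 : R[i]) = 1.
Proof. by rewrite (normc_real_ge0 (@ler01 R)). Qed.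

Section ComplexIntegral.
Context (R : realType).
Variable mu : {finite_measure set (measurableTypeR R) -> \bar R}.
Local Notation C := R[i].
Local Notation I := (`[0%R, 1%R[%classic : set (measurableTypeR R)).
Implicit Types g : R -> C.

Definition cint g : C :=
  (\int[mu]_(t in I) complex.Re (g t)) +i* (\int[mu]_(t in I) complex.Im (g t)).

(** Boundedness implies integrability because [mu] is finite and, unlike integrability, it is stable
    under products, so functions and kernels can be multiplied freely. *)
Definition bmeasurable g :=
  cmeasurable I g /\ exists M : R, forall t, I t -> normc (g t) <= M.

Lemma measurable_unit_itv : measurable I. Proof. exact: measurable_itv. Qed.

Lemma bounded_integrable (u : R -> R) (M : R) : measurable_fun I u ->
  (forall t, I t -> `|u t| <= M) -> mu.-integrable I (EFin \o u).
Proof.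
move=> mu_ uM; apply: measurable_bounded_integrable => //.
  by rewrite ltey_eq fin_num_measure.
exists M; split; first exact: num_real.
by move=> x Mx y Iy /=; rewrite (le_trans (uM _ Iy))// ltW.
Qed.

Lemma bmeasurable_integrable g : bmeasurable g ->
  mu.-integrable I (EFin \o (fun t => complex.Re (g t))) /\
  mu.-integrable I (EFin \o (fun t => complex.Im (g t))).
Proof.
move=> [[mr mi] [M gM]]; split; apply: (@bounded_integrable _ M) => // t It.
  exact: le_trans (normc_Re_le _) (gM _ It).
exact: le_trans (normc_Im_le _) (gM _ It).
Qed.

Lemma eq_bmeasurable g1 g2 : (forall t, I t -> g1 t = g2 t) ->
  bmeasurable g1 -> bmeasurable g2.
Proof.
move=> g12 [m1 [M gM]]; split.
  by apply: eq_cmeasurable m1 => t /set_mem /g12.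
by exists M => t It; rewrite -g12// gM.
Qed.

Lemma bmeasurable_cst c : bmeasurable (fun=> c).
Proof. by split; [exact: cmeasurable_cst|exists (normc c)]. Qed.

Lemma bmeasurableD g1 g2 : bmeasurable g1 -> bmeasurable g2 ->
  bmeasurable (fun t => g1 t + g2 t).
Proof.
move=> [m1 [M1 H1]] [m2 [M2 H2]]; split; first exact: cmeasurableD.
exists (M1 + M2) => t It; apply: (le_trans (normcD_le _ _)).
by rewrite lerD ?H1 ?H2.
Qed.

Lemma bmeasurableM g1 g2 : bmeasurable g1 -> bmeasurable g2 ->
  bmeasurable (fun t => g1 t * g2 t).
Proof.
move=> [m1 [M1 H1]] [m2 [M2 H2]]; split; first exact: cmeasurableM.
exists (M1 * M2) => t It.
by rewrite normcM ler_pM ?normc_ge0 ?H1 ?H2.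
Qed.

Lemma bmeasurableN g : bmeasurable g -> bmeasurable (fun t => - g t).
Proof.
move=> [m [M H]]; split; first exact: cmeasurableN.
by exists M => t It; rewrite normcN H.
Qed.

Lemma bmeasurableB g1 g2 : bmeasurable g1 -> bmeasurable g2 ->
  bmeasurable (fun t => g1 t - g2 t).
Proof. by move=> m1 m2; apply/bmeasurableD/bmeasurableN. Qed.

Lemma bmeasurable_sum (J : Type) (s : seq J) (g : J -> R -> C) :
  (forall i, bmeasurable (g i)) -> bmeasurable (fun t => \sum_(i <- s) g i t).
Proof.
move=> mg; elim: s => [|i s IH].
  apply: (@eq_bmeasurable (fun=> 0)); last exact: bmeasurable_cst.
  by move=> t _; rewrite big_nil.
apply: (@eq_bmeasurable (fun t => g i t + \sum_(j <- s) g j t)).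
  by move=> t _; rewrite big_cons.
exact: bmeasurableD.
Qed.

Lemma eq_cint g1 g2 : (forall t, I t -> g1 t = g2 t) -> cint g1 = cint g2.
Proof.
by move=> g12; congr (_ +i* _); apply: eq_Rintegral => t /set_mem It;
  rewrite g12.
Qed.

Lemma cintD g1 g2 : bmeasurable g1 -> bmeasurable g2 ->
  cint (fun t => g1 t + g2 t) = cint g1 + cint g2.
Proof.
move=> /bmeasurable_integrable[r1 i1] /bmeasurable_integrable[r2 i2].
rewrite /cint; apply/eqP; rewrite eq_complex /=; apply/andP; split; apply/eqP.
  rewrite -RintegralD//; apply: eq_Rintegral => t _.
  by case: (g1 t) => a b; case: (g2 t).
rewrite -RintegralD//; apply: eq_Rintegral => t _.
by case: (g1 t) => a b; case: (g2 t).
Qed.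

Lemma cintZ c g : bmeasurable g -> cint (fun t => c * g t) = c * cint g.
Proof.
move=> mg; have [ir ii] := bmeasurable_integrable mg.
have iZ (k : R) (u : R -> R) : mu.-integrable I (EFin \o u) ->
    mu.-integrable I (EFin \o (fun t => k * u t)).
  move=> iu; have := integrableZl measurable_unit_itv k iu.
  by apply: eq_integrable => //= t _; rewrite EFinM.
case: c => a b; rewrite /cint; apply/eqP.
rewrite eq_complex /=; apply/andP; split; apply/eqP.
  rewrite -!RintegralZl// -RintegralB//; [|exact: iZ|exact: iZ].
  by apply: eq_Rintegral => t _; case: (g t).
rewrite -!RintegralZl// -RintegralD//; [|exact: iZ|exact: iZ].
by apply: eq_Rintegral => t _; case: (g t).
Qed.

Lemma cintB g1 g2 : bmeasurable g1 -> bmeasurable g2 ->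
  cint (fun t => g1 t - g2 t) = cint g1 - cint g2.
Proof.
move=> m1 m2; rewrite cintD//; last exact: bmeasurableN.
congr (_ + _); rewrite -mulN1r -cintZ//.
by apply: eq_cint => t _; rewrite mulN1r.
Qed.

Lemma cint0 : cint (fun=> 0) = 0.
Proof.
have -> : cint (fun=> 0) = cint (fun=> 0 * 0).
  by apply: eq_cint => t _; rewrite mul0r.
by rewrite cintZ ?mul0r//; exact: bmeasurable_cst.
Qed.

Lemma cint_sum (J : Type) (s : seq J) (g : J -> R -> C) :
  (forall i, bmeasurable (g i)) ->
  cint (fun t => \sum_(i <- s) g i t) = \sum_(i <- s) cint (g i).
Proof.
move=> mg; elim: s => [|i s IH].
  rewrite big_nil -[RHS]cint0; apply: eq_cint => t _; by rewrite big_nil.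
rewrite big_cons -IH -cintD//; last exact: bmeasurable_sum.
by apply: eq_cint => t _; rewrite big_cons.
Qed.

(* Bounding the real and imaginary parts separately costs the factor 2. *)
Lemma cint_le g (u : R -> R) : bmeasurable g -> measurable_fun I u ->
  (forall t, I t -> normc (g t) <= u t) ->
  ((normc (cint g))%:E <= 2%:E * \int[mu]_(t in I) (u t)%:E)%E.
Proof.
move=> mg mu_ gu; have [ir ii] := bmeasurable_integrable mg.
have H (v : R -> R) : mu.-integrable I (EFin \o v) ->
    (forall t, I t -> `|v t| <= u t) ->
    (`|\int[mu]_(t in I) v t|%:E <= \int[mu]_(t in I) (u t)%:E)%E.
  move=> iv vu; have mv := measurable_int mu iv.
  apply: (@le_trans _ _ (\int[mu]_(t in I) `|v t|)%:E).
    by rewrite lee_fin; apply: le_normr_Rintegral.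
  rewrite /Rintegral fineK; last first.
    have := integrable_fin_num measurable_unit_itv (integrable_norm iv).
    by apply.
  apply: ge0_le_integral => //.
  - apply/measurable_EFinP/measurableT_comp => //.
    exact/measurable_EFinP.
  - exact/measurable_EFinP.
apply: (@le_trans _ _ (`|complex.Re (cint g)| + `|complex.Im (cint g)|)%:E).
  by rewrite lee_fin normc_Re_Im_le.
rewrite EFinD (_ : 2%:E = 1%:E + 1%:E)%E; last by rewrite -EFinD.
rewrite ge0_muleDl// !mul1e; apply: leeD; apply: H => // t It.
  exact: le_trans (normc_Re_le _) (gu _ It).
exact: le_trans (normc_Im_le _) (gu _ It).
Qed.

Definition mass : R := fine (mu I).

Lemma massE : (mass%:E = mu I)%E.
Proof. by rewrite /mass fineK// fin_num_measure. Qed.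

Lemma mass_ge0 : 0 <= mass.
Proof. exact: fine_ge0. Qed.

Lemma cint_bound g (M : R) : bmeasurable g ->
  (forall t, I t -> normc (g t) <= M) -> normc (cint g) <= 2 * (M * mass).
Proof.
move=> mg gM; rewrite -lee_fin; apply: (le_trans (@cint_le _ (cst M) mg _ gM)).
  exact: measurable_cst.
rewrite (@integral_cst _ _ _ mu _ measurable_unit_itv M%:E).
by rewrite [leRHS]EFinM [(M * _)%:E]EFinM massE.
Qed.

End ComplexIntegral.

(** * The Poisson integral *)

Section PoissonIntegral.
Context {R : realType}.
Local Notation C := R[i].

(** The left-hand side is what the rules of differentiation return for the arctangent antiderivative
    below when [X' = - Y] and [Y' = X]. *)
Lemma poisson_identity (x y : R) : 0 < 1 - x -> 1 - (x ^+ 2 + y ^+ 2) != 0 ->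
  (1 - (x ^+ 2 + y ^+ 2))^-1 *
    (1 + 2 * ((y * (- (1 - x) ^- 2 * y) + (1 - x)^-1 * x) *
              (1 + (y * (1 - x)^-1) ^+ 2)^-1)) =
  (1 - x *+ 2 + (x ^+ 2 + y ^+ 2))^-1.
Proof.
move=> x1 u0.
have Q0 : 0 < (1 - x) ^+ 2 + y ^+ 2 by rewrite ltr_wpDr ?sqr_ge0// exprn_gt0.
have x0 : 1 - x != 0 by rewrite gt_eqF.
have -> : 1 - x *+ 2 + (x ^+ 2 + y ^+ 2) = (1 - x) ^+ 2 + y ^+ 2 by ring.
have -> : 1 + (y * (1 - x)^-1) ^+ 2 = ((1 - x) ^+ 2 + y ^+ 2) / (1 - x) ^+ 2.
  by field.
by field; rewrite x0 u0 gt_eqF.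
Qed.

(** The prefactor is frozen at [t]: when [X + iY] runs over a circle centred at 0, its modulus does
    not depend on [s]. *)
Lemma is_derive_poisson (X Y : R -> R) (t : R) :
  is_derive t 1 X (- Y t) -> is_derive t 1 Y (X t) -> 0 < 1 - X t ->
  1 - (X t ^+ 2 + Y t ^+ 2) != 0 ->
  is_derive t 1 (fun s => (1 - (X t ^+ 2 + Y t ^+ 2))^-1 *
                          (s + 2 * atan (Y s * (1 - X s)^-1)))
    ((1 - X t *+ 2 + (X t ^+ 2 + Y t ^+ 2))^-1).
Proof.
move=> dX dY X1 u0; have X0 : 1 - X t != 0 by rewrite gt_eqF.
rewrite -poisson_identity//; set k := (1 - (X t ^+ 2 + Y t ^+ 2))^-1.
have d1 : is_derive t 1 (fun s => 1 - X s) (Y t).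
  have := @is_deriveB _ _ _ (cst (1 : R)) X t 1 _ _ (is_derive_cst (1 : R) t 1)
    dX.
  by move=> D; apply: (is_derive_eq D); rewrite sub0r opprK.
have d2 := @is_deriveV _ (fun s => 1 - X s) t _ 1 X0 d1.
have d3 := @is_deriveM _ _ Y (fun s => (1 - X s)^-1) t 1 _ _ dY d2.
have d4 := @is_derive1_comp _ atan (Y * (fun s => (1 - X s)^-1)) t _ _
  (is_derive1_atan _) d3.
have d5 := @is_deriveZ _ _ _ _ 2 _ _ _ d4.
have d6 := @is_deriveD _ _ _ _ _ _ _ _ _ (is_derive_id t 1) d5.
have d7 := @is_deriveZ _ _ _ _ k _ _ _ d6.
by apply: (is_derive_eq d7); rewrite /GRing.scale /= [RHS]mulrC; ring.
Qed.

(* The antiderivative of [1 / |1 - c z|^2] in the angle of [z = r e^{it}] is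
   [(t + 2 arctan (Y / (1 - X))) / (1 - |c z|^2)] with [X + iY = c z]. *)
Lemma circle_kernel_integral (c : C) (r : R) : 0 <= r -> normc c * r < 1 ->
  (\int[lebesgue_measure]_(t in `[0%R, (2 * pi)%R])
     ((normc (1 - c * circle_pt r t) ^+ 2)^-1)%:E =
   (2 * pi / (1 - (normc c * r) ^+ 2))%:E)%E.
Proof.
move=> r0 cr1.
pose p := complex.Re c; pose q := complex.Im c.
pose X (t : R) : R := r * (p * cos t - q * sin t).
pose Y (t : R) : R := r * (p * sin t + q * cos t).
have XY (t : R) : X t ^+ 2 + Y t ^+ 2 = (normc c * r) ^+ 2.
  rewrite [RHS]exprMn normc_sqr -/p -/q /X /Y.
  have := cos2Dsin2 t; set k := cos t; set s := sin t => ks.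
  have -> : (r * (p * k - q * s)) ^+ 2 + (r * (p * s + q * k)) ^+ 2 =
    (p ^+ 2 + q ^+ 2) * r ^+ 2 * (k ^+ 2 + s ^+ 2) by ring.
  by rewrite ks mulr1.
have u1 : 0 < 1 - (normc c * r) ^+ 2.
  by rewrite subr_gt0 expr_lt1// mulr_ge0// normc_ge0.
set u2 := (normc c * r) ^+ 2 in XY u1 *.
have X1 (t : R) : 0 < 1 - X t.
  rewrite subr_gt0 ltNge; apply/negP => h; have X2 : 1 <= X t ^+ 2.
    exact: exprn_ege1.
  have := XY t; have := sqr_ge0 (Y t); move: X2 u1; clear.
  by move: (X t ^+ 2) (Y t ^+ 2) => x y; lra.
have kE (t : R) : normc (1 - c * circle_pt r t) ^+ 2 = 1 - X t *+ 2 + u2.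
  rewrite -(XY t) normc_sqr /circle_pt /X /Y /p /q.
  by case: (c) => a b /=; ring.
have dX (t : R) : is_derive t 1 X (- Y t).
  have D := @is_deriveZ _ _ _ _ r _ _ _ (@is_deriveB _ _ _ _ _ _ _ _ _
    (@is_deriveZ _ _ _ _ p _ _ _ (is_derive_cos t))
    (@is_deriveZ _ _ _ _ q _ _ _ (is_derive_sin t))).
  by apply: (is_derive_eq D); rewrite /Y /GRing.scale /=; ring.
have dY (t : R) : is_derive t 1 Y (X t).
  have D := @is_deriveZ _ _ _ _ r _ _ _ (@is_deriveD _ _ _ _ _ _ _ _ _
    (@is_deriveZ _ _ _ _ p _ _ _ (is_derive_sin t))
    (@is_deriveZ _ _ _ _ q _ _ _ (is_derive_cos t))).
  by apply: (is_derive_eq D); rewrite /X /GRing.scale /=; ring.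
pose F (t : R) : R := (1 - u2)^-1 * (t + 2 * atan (Y t * (1 - X t)^-1)).
have dF (t : R) : is_derive t 1 F ((normc (1 - c * circle_pt r t) ^+ 2)^-1).
  by rewrite kE -(XY t) /F -(XY t); apply: is_derive_poisson;
    rewrite // XY gt_eqF.
have derF t : derivable F t 1 by case: (dF t).
have cF : continuous F.
  by move=> t; apply/differentiable_continuous/derivable1_diffP.
rewrite (@continuous_FTC2 _ (fun t => (normc (1 - c * circle_pt r t) ^+ 2)^-1)
  F 0 (2 * pi)).
(* By periodicity the arctangent takes the same value at both ends, so only the linear term
   contributes. *)
- rewrite -EFinB; congr (_%:E).
  rewrite /F /Y /X mulr_natl cos2pi sin2pi cos0 sin0 !(mulr0, mulr1, subr0,
    add0r).
  by field; rewrite gt_eqF.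
- by rewrite mulr_gt0// pi_gt0.
- have cn : continuous (fun t => normc (1 - c * circle_pt r t)).
    apply: (@continuous_normc R (fun t => 1 - c * circle_pt r t)) => t.
    apply: cvgB; first exact: cvg_cst.
    by apply: cvgM; [exact: cvg_cst|exact: circle_pt_continuous].
  apply: continuous_subspaceT => t; apply: cvgV.
    by rewrite kE -(XY t) (_ : _ + _ = (1 - X t) ^+ 2 + Y t ^+ 2);
      [rewrite gt_eqF// ltr_wpDr ?sqr_ge0// exprn_gt0|ring].
  by apply: cvgM; exact: cn.
- split => //.
  + exact/cvg_at_right_filter/cF.
  + exact/cvg_at_left_filter/cF.
- by move=> t _; rewrite derive1E; case: (dF t) => _ ->.
Qed.

End PoissonIntegral.

(** * Carleson measures *)

Section CarlesonWeight.
Context (R : realType).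
Variables (mu : {finite_measure set (measurableTypeR R) -> \bar R}) (A : R).
Local Notation I := (`[0%R, 1%R[%classic : set (measurableTypeR R)).

Definition carleson := forall d : R, 0 < d <= 1 ->
  (mu (`[(1 - d)%R, 1%R[%classic : set (measurableTypeR R)) <= (A * d)%:E)%E.

Definition weight (r t : R) : R := ((1 - t * r) * Num.sqrt (1 - t))^-1.

Lemma one_sub_mul_gt0 (r t : R) : 0 <= r < 1 -> 0 <= t < 1 -> 0 < 1 - t * r.
Proof. by move=> /andP[? ?] /andP[? ?]; nra. Qed.

Lemma weight_gt0 (r t : R) : 0 <= r < 1 -> 0 <= t < 1 -> 0 < weight r t.
Proof.
move=> r01 t01; rewrite invr_gt0 mulr_gt0 ?one_sub_mul_gt0// sqrtr_gt0 subr_gt0.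
by case/andP: t01.
Qed.

Lemma measurable_weight (r : R) : 0 <= r < 1 -> measurable_fun I (weight r).
Proof.
move=> r01; have m1 : measurable_fun I (fun t : R => 1 - t * r).
  by apply: measurable_funB; [exact: measurable_cst|exact: measurable_funM].
apply: measurable_funV_ge0.
  apply: measurable_funM => //; apply: measurable_fun_sqrt.
  by apply: measurable_funB; [exact: measurable_cst|].
move=> t /=; rewrite in_itv/= => t01.
by rewrite mulr_ge0 ?sqrtr_ge0// ltW// one_sub_mul_gt0.
Qed.

(** Base 4 makes [Num.sqrt (1 - t)] comparable to [2 ^ j] inverted, and [2 ^ j] is the argument
    along which [bump] telescopes. *)
Lemma dyadic_scale (t : R) : 0 <= t < 1 -> exists j : nat,
  (4 ^+ j.+1)^-1 < 1 - t <= (4 ^+ j)^-1.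
Proof.
move=> /andP[t0 t1]; have t1' : 0 < 1 - t by rewrite subr_gt0.
have ex : exists n, (4 ^+ n)^-1 < 1 - t.
  have [n nt] : exists n : nat, (1 - t)^-1 < n%:R.
    exists (Num.truncn (1 - t)^-1).+1.
    by rewrite truncnS_gt.
  exists n; rewrite -[ltRHS]invrK ltf_pV2 ?posrE ?exprn_gt0 ?invr_gt0//.
  apply: (lt_trans nt); rewrite -natrX ltr_nat.
  by rewrite ltn_expl.
case: (ex_minnP ex) => -[|m] hm mmin.
  by move: hm; rewrite expr0 invr1; move: t0; lra.
exists m; rewrite hm/= leNgt; apply/negP => /mmin.
by rewrite ltnn.
Qed.

(* Dominates [min (x, b^2 / x)] up to a factor 6 and telescopes along
   [x = 2 ^ j], since [b^2 x / ((b + x) (b + 2 x)) = g (2 x) - g x] for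
   [g x = b x / (b + x)]. *)
Definition bump (b x : R) : R := b ^+ 2 * x / ((b + x) * (b + 2 * x)).

Lemma bump_ge0 (b x : R) : 0 <= b -> 0 <= x -> 0 <= bump b x.
Proof. by move=> b0 x0; rewrite divr_ge0 ?mulr_ge0 ?addr_ge0 ?mulr_ge0//
  sqr_ge0. Qed.

Lemma bump_sum (b : R) n : 0 < b -> \sum_(0 <= j < n) bump b (2 ^+ j) <= b.
Proof.
move=> b0; pose g (x : R) : R := b * x / (b + x).
have E j : bump b (2 ^+ j) = g (2 ^+ j.+1) - g (2 ^+ j).
  have x0 : 0 < 2 ^+ j :> R by rewrite exprn_gt0.
  rewrite /bump /g [2 ^+ j.+1]exprS; move: (2 ^+ j : R) x0 => x x0; field.
  by rewrite !gt_eqF ?addr_gt0 ?mulr_gt0.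
rewrite (eq_bigr (fun j => g (2 ^+ j.+1) - g (2 ^+ j))); last by move=> j _.
rewrite (telescope_sumr (fun j => g (2 ^+ j)))//.
have g0 j : 0 <= g (2 ^+ j) <= b.
  have x0 : 0 < 2 ^+ j :> R by rewrite exprn_gt0.
  rewrite /g; move: (2 ^+ j) x0 => x x0; apply/andP; split.
    by rewrite divr_ge0 ?mulr_ge0 ?addr_ge0// ltW.
  rewrite ler_pdivrMr ?addr_gt0// ler_pM2l// lerDr ltW//.
have /andP[h0 _] := g0 0%N; have /andP[_ h1] := g0 n.
by rewrite lerBlDr (le_trans h1)// lerDl.
Qed.

(** With [x = 2 ^ j] and [b = (1 - r)^(-1/2)], the factor [(1 - t)^(-1/2)] is at most [2 x], while
    [(1 - t r)^-1] is at most both [4 x^2] and [b^2]. The denominator of [bump] is at most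
    [6 max (b, x)^2]. The case [x <= b] gives the constant [4 * 2 * 6 = 48], the other one only
    [2 * 6 = 12]. *)
Lemma weight_dyadic (r t : R) (j : nat) : 0 <= r < 1 -> 0 <= t < 1 ->
  (4 ^+ j.+1)^-1 < 1 - t ->
  weight r t <= 48 * 4 ^+ j * bump (Num.sqrt (1 - r))^-1 (2 ^+ j).
Proof.
move=> r01 t01 h.
have d0 : 0 < 1 - r by case/andP: r01 => *; rewrite subr_gt0.
have t0 : 0 < 1 - t by case/andP: t01 => *; rewrite subr_gt0.
set s : R := Num.sqrt (1 - r); have s0 : 0 < s by rewrite sqrtr_gt0.
have sE : s ^+ 2 = 1 - r by rewrite sqr_sqrtr// ltW.
set y : R := Num.sqrt (1 - t); have y0 : 0 < y by rewrite sqrtr_gt0.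
have yE : y ^+ 2 = 1 - t by rewrite sqr_sqrtr// ltW.
set b : R := s^-1; have b0 : 0 < b by rewrite invr_gt0.
set x : R := 2 ^+ j; have x0 : 0 < x by rewrite exprn_gt0.
have xE : 4 ^+ j = x ^+ 2 :> R.
  by rewrite -exprM mulnC exprM; congr (_ ^+ _); ring.
have y2 : (2 * x)^-1 < y.
  rewrite -(@ltr_pXn2r _ 2) ?nnegrE ?ltW ?invr_gt0 ?mulr_gt0// yE.
  apply: le_lt_trans h; rewrite exprVn exprMn -xE [4 ^+ j.+1]exprS.
  by rewrite (_ : 2 ^+ 2 = 4 :> R)//; ring.
have w1 : 1 - t <= 1 - t * r by case/andP: t01 => *; case/andP: r01 => *; nra.
have w2 : 1 - r <= 1 - t * r by case/andP: t01 => *; case/andP: r01 => *; nra.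
have q0 : 0 < (b + x) * (b + 2 * x) by rewrite mulr_gt0 ?addr_gt0 ?mulr_gt0.
have wE : weight r t = ((1 - t * r) * y)^-1 by [].
have yi : y^-1 <= 2 * x.
  by rewrite -[leRHS]invrK lef_pV2 ?posrE ?invr_gt0 ?mulr_gt0// ltW.
have p0 : 0 < 1 - t * r by rewrite one_sub_mul_gt0.
have i1 : (1 - t * r)^-1 <= (y^-1) ^+ 2.
  by rewrite exprVn lef_pV2 ?posrE ?exprn_gt0// yE.
have i2 : (1 - t * r)^-1 <= b ^+ 2.
  by rewrite exprVn lef_pV2 ?posrE ?exprn_gt0// sE.
rewrite wE invfM xE /bump mulrA ler_pdivlMr//.
have yi0 : 0 < y^-1 by rewrite invr_gt0.
have pi0 : 0 < (1 - t * r)^-1 by rewrite invr_gt0.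
move: (y^-1) ((1 - t * r)^-1) yi0 pi0 yi i1 i2 => u v u0 v0 yi i1 i2.
have v4 : v <= 4 * x ^+ 2.
  by apply: (le_trans i1); rewrite (_ : 4 * x ^+ 2 = (2 * x) ^+ 2);
    [rewrite ler_sqr ?nnegrE// ltW ?mulr_gt0|ring].
have pM (p q p' q' : R) : 0 <= p -> 0 <= q -> p <= p' -> q <= q' -> p * q <= p'
  * q'.
  exact: ler_pM.
have x2 : 0 <= x ^+ 2 by rewrite sqr_ge0.
have b2 : 0 <= b ^+ 2 by rewrite sqr_ge0.
have [xb|/ltW bx] := leP x b.
  have q : (b + x) * (b + 2 * x) <= 6 * b ^+ 2.
    have h1 : 0 <= b * (b - x) by rewrite mulr_ge0 ?subr_ge0// ltW.
    have h2 : 0 <= x * (b - x) by rewrite mulr_ge0 ?subr_ge0// ltW.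
    lra.
  apply: (@le_trans _ _ (4 * x ^+ 2 * (2 * x) * (6 * b ^+ 2))).
    by apply: (pM _ _ _ _ _ (ltW q0) _ q); [rewrite mulr_ge0 ?ltW|apply: pM =>
      //; rewrite ltW].
  by rewrite le_eqVlt; apply/orP; left; apply/eqP; ring.
have q : (b + x) * (b + 2 * x) <= 6 * x ^+ 2.
  have h1 : 0 <= b * (x - b) by rewrite mulr_ge0 ?subr_ge0// ltW.
  have h2 : 0 <= x * (x - b) by rewrite mulr_ge0 ?subr_ge0// ltW.
  lra.
apply: (@le_trans _ _ (b ^+ 2 * (2 * x) * (6 * x ^+ 2))).
  by apply: (pM _ _ _ _ _ (ltW q0) _ q); [rewrite mulr_ge0 ?ltW|apply: pM =>
    //; rewrite ltW].
rewrite -subr_ge0 (_ : _ - _ = 36 * (b ^+ 2 * (x ^+ 2 * x))); last ring.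
by rewrite !mulr_ge0// ltW.
Qed.

(** If [1 - t] lies between [4^-(j+1)] and [4^-j], the term [f j t] alone dominates the weight, so
    the whole series does. The Carleson bound [A 4^-j] on [mu (E j)] cancels the factor [4^j] of
    [e j] and leaves [48 A] times the telescoping sum of [bump]. *)
Lemma carleson_weight (r : R) : carleson -> 0 <= r < 1 ->
  (\int[mu]_(t in I) (weight r t)%:E <=
   (48 * A * (Num.sqrt (1 - r))^-1)%:E)%E.
Proof.
move=> hA r01; set b : R := (Num.sqrt (1 - r))^-1.
have b0 : 0 < b.
  by rewrite invr_gt0 sqrtr_gt0 subr_gt0; case/andP: r01.
have A0 : 0 <= A.
  have := hA 1; rewrite ltr01 lexx => /(_ isT); rewrite mulr1 -lee_fin.
  exact: le_trans.
pose e (j : nat) : R := 48 * 4 ^+ j * bump b (2 ^+ j).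
have e0 j : 0 <= e j.
  by apply: mulr_ge0; [rewrite mulr_ge0 ?exprn_ge0|rewrite bump_ge0 ?ltW//
    exprn_gt0].
pose E (j : nat) : set (measurableTypeR R) := `[1 - (4 ^+ j)^-1, 1[%classic.
have mE j : measurable (E j) by exact: measurable_itv.
pose f (j : nat) (t : R) : \bar R := (e j * \1_(E j) t)%:E.
have f0 j t : (0 <= f j t)%E by rewrite lee_fin mulr_ge0.
have mf j : measurable_fun I (f j).
  by apply/measurable_EFinP/measurable_funM => //; exact: measurable_indic.
apply: (@le_trans _ _ (\int[mu]_(t in I) (\sum_(j <oo) f j t))%E).
  apply: ge0_le_integral => //.
  - by move=> t /=; rewrite in_itv/= => t01; rewrite lee_fin ltW// weight_gt0.
  - by apply/measurable_EFinP; exact: measurable_weight.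
  - exact: ge0_emeasurable_sum.
  - move=> t /=; rewrite in_itv/= => t01.
    have [j /andP[h1 h2]] := dyadic_scale t01.
    apply: (@le_trans _ _ (f j t)).
      rewrite /f lee_fin indicE mem_set ?mulr1 ?weight_dyadic//.
      by rewrite /E/= in_itv/=; case/andP: t01 => _ ->; rewrite andbT; lra.
    apply: (@le_trans _ _ (\sum_(0 <= i < j.+1) f i t)%E).
      by rewrite big_nat_recr//= leeDr// sume_ge0.
    exact: nneseries_lim_ge.
rewrite integral_nneseries//.
apply: lime_le; first by apply: is_cvg_nneseries => j _ _; exact: integral_ge0.
apply: nearW => n.
have fE j : (\int[mu]_(t in I) f j t <= (48 * A * bump b (2 ^+ j))%:E)%E.
  rewrite /f; under eq_integral do rewrite EFinM.
  rewrite ge0_integralZl_EFin//; last first.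
    by apply/measurable_EFinP; exact: measurable_indic.
  rewrite integral_indic//.
  apply: (@le_trans _ _ ((e j)%:E * (A * (4 ^+ j)^-1)%:E)%E).
    apply: lee_wpmul2l; rewrite ?lee_fin//.
    apply: (@le_trans _ _ (mu (E j))); first by apply: le_measure;
      rewrite ?inE//; exact: measurableI.
    by apply: hA; rewrite invr_gt0 exprn_gt0//= invf_le1 ?exprn_gt0//
      exprn_ege1// ler1n.
  rewrite -EFinM lee_fin /e le_eqVlt; apply/orP; left; apply/eqP; field.
  by rewrite expf_neq0// pnatr_eq0.
apply: (@le_trans _ _ (\sum_(0 <= j < n) (48 * A * bump b (2 ^+ j))%:E)%E).
  by apply: lee_sum.
by rewrite sumEFin lee_fin -mulr_sumr ler_wpM2l ?mulr_ge0// bump_sum.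
Qed.

End CarlesonWeight.

(** * Hankel integrals *)

Section HankelIntegral.
Context (R : realType).
Variable mu : {finite_measure set (measurableTypeR R) -> \bar R}.
Local Notation C := R[i].
Local Notation I := (`[0%R, 1%R[%classic : set (measurableTypeR R)).
Implicit Types (h : R -> C) (z : C) (t : R).

Definition hker (z : C) (t : R) : C := (1 - t%:C * z)^-1.

(** The value 0 off the disc follows the convention [zero_off_disc], so that identities with members
    of [fspace] hold as equalities of functions. *)
Definition hankel_integral h (z : C) : C :=
  if normc z < 1 then cint mu (fun t => h t * hker z t) else 0.

Lemma unit_itv01 t : I t -> 0 <= t < 1.
Proof. by rewrite /= in_itv. Qed.

Lemma normc_hker_den z t : I t -> 1 - t * normc z <= normc (1 - t%:C * z).
Proof.
move=> /unit_itv01/andP[t0 t1]; rewrite lerBlDr.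
have := normcD_le (1 - t%:C * z) (t%:C * z).
by rewrite subrK normc1 normcM normc_real_ge0.
Qed.

Lemma disc_sub_gt0 z t : disc z -> I t -> 0 < 1 - t * normc z.
Proof.
by move=> Dz /unit_itv01 t01; rewrite one_sub_mul_gt0// normc_ge0.
Qed.

Lemma disc_sub_ge z t : I t -> 1 - normc z <= 1 - t * normc z.
Proof.
move=> /unit_itv01/andP[t0 t1]; rewrite lerD2l lerN2 ler_piMl ?normc_ge0//;
  exact: ltW.
Qed.

Lemma hker_den_neq0 z t : disc z -> I t -> 1 - t%:C * z != 0.
Proof.
move=> Dz It; rewrite -normc_gt0.
exact: lt_le_trans (disc_sub_gt0 Dz It) (normc_hker_den _ It).
Qed.

Lemma normc_hker z t : disc z -> I t ->
  normc (hker z t) <= (1 - t * normc z)^-1.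
Proof.
move=> Dz It; have h0 := disc_sub_gt0 Dz It; have h1 := normc_hker_den z It.
by rewrite normcV lef_pV2// posrE// (lt_le_trans h0 h1).
Qed.

Lemma normc_hker_le z t : disc z -> I t -> normc (hker z t) <= (1 - normc z)^-1.
Proof.
move=> Dz It; apply: (le_trans (normc_hker Dz It)).
by rewrite lef_pV2 ?posrE ?disc_sub_gt0// ?disc_sub_ge// subr_gt0.
Qed.

Lemma bmeasurable_id : bmeasurable (fun t => t%:C).
Proof.
split; first by apply: cmeasurable_real; exact: measurable_id.
by exists 1 => t /unit_itv01/andP[t0 t1]; rewrite normc_real_ge0// ltW.
Qed.

Lemma bmeasurable_hker z : disc z -> bmeasurable (hker z).
Proof.
move=> Dz; split.
  have [m _] := bmeasurableB (bmeasurable_cst 1)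
    (bmeasurableM bmeasurable_id (bmeasurable_cst z)).
  exact: cmeasurableV m.
by exists (1 - normc z)^-1 => t It; exact: normc_hker_le.
Qed.

Lemma hankel_integralE h z : disc z ->
  hankel_integral h z = cint mu (fun t => h t * hker z t).
Proof. by rewrite /hankel_integral /disc/= => ->. Qed.

Lemma hankel_integral_off h : zero_off_disc (hankel_integral h).
Proof. by move=> z; rewrite /disc/= /hankel_integral => /negP/negbTE ->. Qed.

Lemma hankel_integralB h1 h2 z : bmeasurable h1 -> bmeasurable h2 ->
  hankel_integral (fun t => h1 t - h2 t) z =
  hankel_integral h1 z - hankel_integral h2 z.
Proof.
move=> m1 m2; have [Dz|nDz] := pselect (disc z); last first.
  by rewrite !hankel_integral_off// subr0.
have mk := bmeasurable_hker Dz.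
rewrite !hankel_integralE// -cintB; [|exact: bmeasurableM..].
by apply: eq_cint => t _; rewrite mulrBl.
Qed.

Lemma hankel_integral_sum (J : Type) (s : seq J) (c : J -> C) (h : J -> R -> C)
  z :
  (forall j, bmeasurable (h j)) ->
  hankel_integral (fun t => \sum_(j <- s) c j * h j t) z =
  \sum_(j <- s) c j * hankel_integral (h j) z.
Proof.
move=> mh; have [Dz|nDz] := pselect (disc z); last first.
  rewrite hankel_integral_off// big1// => j _.
  by rewrite hankel_integral_off// mulr0.
have mk := bmeasurable_hker Dz.
rewrite hankel_integralE//.
rewrite (@eq_cint _ mu _ (fun t => \sum_(j <- s) c j * (h j t * hker z t))).
  rewrite cint_sum.
    by apply: eq_bigr => j _; rewrite cintZ ?hankel_integralE//;
      exact: bmeasurableM.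
  by move=> j; apply: bmeasurableM; [exact: bmeasurable_cst|exact:
    bmeasurableM].
by move=> t _; rewrite mulr_suml; apply: eq_bigr => j _; rewrite mulrA.
Qed.

Definition hankel_derivative h z : C :=
  cint mu (fun t => h t * (t%:C * hker z t ^+ 2)).

Lemma bmeasurable_hker_deriv z : disc z ->
  bmeasurable (fun t => t%:C * hker z t ^+ 2).
Proof.
move=> Dz; have mk := bmeasurable_hker Dz.
by apply: bmeasurableM; [exact: bmeasurable_id|rewrite /=; exact: bmeasurableM].
Qed.

Lemma hker_taylor z u t : 1 - t%:C * z != 0 -> 1 - t%:C * (z + u) != 0 ->
  hker (z + u) t - hker z t - u * (t%:C * hker z t ^+ 2) =
  u ^+ 2 * (t%:C ^+ 2 * hker z t ^+ 2 * hker (z + u) t).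
Proof. by move=> h1 h2; rewrite /hker; field; rewrite h1 h2. Qed.

(** Integrating the exact remainder of [hker_taylor], which is bounded uniformly in [t], justifies
    differentiation under the integral without a limit theorem. The restriction on [u] keeps [z + u]
    in the disc and makes the kernel there at most [2 d]. *)
Lemma hankel_integral_taylor h M z : bmeasurable h ->
  (forall t, I t -> normc (h t) <= M) -> disc z ->
  exists2 K : R, 0 <= K & forall u : C, normc u <= (1 - normc z) / 2 ->
    normc (hankel_integral h (z + u) - hankel_integral h z -
           u * hankel_derivative h z) <= K * normc u ^+ 2.
Proof.
move=> mh hM Dz; have d0 : 0 < 1 - normc z by rewrite subr_gt0.
set d := (1 - normc z)^-1; have dp : 0 < d by rewrite invr_gt0.
have M0 : 0 <= M.
  by apply: le_trans (hM 0 _); [exact: normc_ge0|rewrite /= in_itv/= lexx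
    ltr01].
have K0 : 0 <= 2 * (M * (d ^+ 2 * (2 * d)) * mass mu).
  by rewrite !mulr_ge0 ?mass_ge0// ?sqr_ge0// ltW.
exists (2 * (M * (d ^+ 2 * (2 * d)) * mass mu)) => // u ud.
have nzu : normc (z + u) <= (1 + normc z) / 2.
  by apply: (le_trans (normcD_le _ _)); lra.
have Dzu : disc (z + u) by rewrite /disc/=; lra.
have mk := bmeasurable_hker Dz; have mku := bmeasurable_hker Dzu.
have mkd := bmeasurable_hker_deriv Dz.
rewrite !hankel_integralE// /hankel_derivative -cintZ; last exact: bmeasurableM.
rewrite -cintB; [|exact: bmeasurableM..].
rewrite -cintB; last 2 first.
- by apply: bmeasurableB; exact: bmeasurableM.
- by apply: bmeasurableM; [exact: bmeasurable_cst|exact: bmeasurableM].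
set g := (X in cint mu X).
have mg : bmeasurable g.
  apply: bmeasurableB; first by apply: bmeasurableB; exact: bmeasurableM.
  by apply: bmeasurableM; [exact: bmeasurable_cst|exact: bmeasurableM].
have -> : 2 * (M * (d ^+ 2 * (2 * d)) * mass mu) * normc u ^+ 2 =
    2 * ((normc u ^+ 2 * (M * (d ^+ 2 * (2 * d)))) * mass mu) by ring.
apply: cint_bound => // t It.
have -> : g t = h t * (u ^+ 2 * (t%:C ^+ 2 * hker z t ^+ 2 * hker (z + u) t)).
  by rewrite -hker_taylor ?hker_den_neq0// /g; ring.
have kz := normc_hker_le Dz It.
have kzu : normc (hker (z + u) t) <= 2 * d.
  apply: (le_trans (normc_hker_le Dzu It)).
  rewrite -[leRHS]invrK lef_pV2 ?posrE ?invr_gt0 ?mulr_gt0// ?subr_gt0//.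
  by rewrite invfM invrK; lra.
have t1 : normc t%:C ^+ 2 <= 1.
  have /andP[t0 /ltW t1] := unit_itv01 It.
  by rewrite normc_real_ge0// exprn_ile1.
rewrite normcM [normc (u ^+ 2 * _)]normcM [normc (t%:C ^+ 2 * _ * _)]normcM.
rewrite [normc (t%:C ^+ 2 * _)]normcM !normcX (mulrCA (normc (h t))).
apply: ler_wpM2l; first exact: sqr_ge0.
apply: ler_pM; rewrite ?normc_ge0 ?mulr_ge0 ?exprn_ge0 ?normc_ge0 ?hM//.
apply: ler_pM; rewrite ?normc_ge0 ?mulr_ge0 ?exprn_ge0 ?normc_ge0//.
rewrite -[leRHS]mul1r; apply: ler_pM; rewrite ?normc_ge0 ?exprn_ge0
  ?normc_ge0//.
by rewrite ler_sqr ?nnegrE ?normc_ge0// ltW.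
Qed.

Lemma derivable_of_taylor (f : C -> C) (z l : C) (d K : R) : 0 < d -> 0 <= K ->
  (forall u, normc u <= d -> normc (f (z + u) - f z - u * l) <= K * normc u ^+
    2) ->
  derivable f z 1 /\ derive1 f z = l.
Proof.
move=> d0 K0 H.
have L : h^-1 *: ((f \o shift z) (h *: 1) - f z) @[h --> 0^'] --> l.
  apply/cvgC_normcP => e e0.
  (* Dividing by [K + 1] also covers [K = 0]. *)
  have e1 : 0 < e / (K + 1) by rewrite divr_gt0// ltr_wpDl.
  pose r := Num.min d (e / (K + 1)).
  have r0 : 0 < r by rewrite lt_min d0.
  apply/nbhs_ballP; exists r%:C => /=; first by rewrite ltcR.
  move=> u ub u0; have ur : normc u < r.
    by move: ub; rewrite -ball_normE /ball_/= sub0r normrN Defs.normcE ltcR.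
  have {ub ur}[ud ue] : normc u < d /\ normc u < e / (K + 1).
    by apply/andP; rewrite -lt_min.
  have nu : 0 < normc u by rewrite normc_gt0.
  have := H u (ltW ud) => Hu.
  rewrite /shift/= (_ : u *: 1 + z = z + u); last by rewrite addrC [u *:
    1]mulr1.
  have -> : u^-1 *: (f (z + u) - f z) - l = u^-1 * (f (z + u) - f z - u * l).
    by rewrite mulrBr mulrA mulVf// mul1r.
  rewrite normcM normcV mulrC ltr_pdivrMr//; apply: (le_lt_trans Hu).
  rewrite expr2 mulrA ltr_pM2r//.
  apply: (@le_lt_trans _ _ (K * (e / (K + 1)))).
    by rewrite ler_wpM2l// ltW.
  by rewrite mulrCA gtr_pMr// ltr_pdivrMr ?mul1r ?ltrDl// ltr_wpDl.
split; first by apply/cvg_ex; exists l.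
by rewrite derive1E; exact/cvg_lim.
Qed.

Lemma hankel_integral_derivable h M z : bmeasurable h ->
  (forall t, I t -> normc (h t) <= M) -> disc z ->
  derivable (hankel_integral h) z 1 /\
  derive1 (hankel_integral h) z = hankel_derivative h z.
Proof.
move=> mh hM Dz; have [K K0 HK] := hankel_integral_taylor mh hM Dz.
apply: (derivable_of_taylor _ K0 HK).
by rewrite divr_gt0// subr_gt0.
Qed.

Lemma hankel_integral_holomorphic h M : bmeasurable h ->
  (forall t, I t -> normc (h t) <= M) -> holomorphic (hankel_integral h).
Proof. by move=> mh hM z Dz; have [] := hankel_integral_derivable mh hM Dz. Qed.

(** [1 - t r] is at least [1 - t] and at least [1 - r], hence at least their geometric mean. Thus
    the weight estimate designed for BMOA also yields the Bloch bound. *)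
Lemma weight_sqr_le (r t : R) : 0 <= r < 1 -> 0 <= t < 1 ->
  (1 - t * r)^-1 ^+ 2 <= (Num.sqrt (1 - r))^-1 * weight r t.
Proof.
move=> r01 t01; have p0 := one_sub_mul_gt0 r01 t01.
have r1 : 0 < 1 - r by rewrite subr_gt0; case/andP: r01.
have t1 : 0 < 1 - t by rewrite subr_gt0; case/andP: t01.
have a0 : 0 < Num.sqrt (1 - r) by rewrite sqrtr_gt0.
have b0 : 0 < Num.sqrt (1 - t) by rewrite sqrtr_gt0.
rewrite /weight -invfM exprVn lef_pV2 ?posrE ?exprn_gt0 ?mulr_gt0//.
rewrite mulrCA expr2 ler_pM2l//.
rewrite -(@ler_pXn2r _ 2) ?nnegrE ?mulr_ge0 ?(ltW a0) ?(ltW b0) ?(ltW p0)//.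
rewrite exprMn !sqr_sqrtr ?(ltW r1) ?(ltW t1)//.
have w1 : 1 - t <= 1 - t * r by case/andP: t01 => *; case/andP: r01 => *; nra.
have w2 : 1 - r <= 1 - t * r by case/andP: t01 => *; case/andP: r01 => *; nra.
by rewrite expr2; apply: ler_pM; rewrite // ltW.
Qed.

(** The constant is [192 = 2 * 48 * 2]: from [cint_le], from [carleson_weight], and from
    [1 - r^2 <= 2 (1 - r)]. *)
Lemma hankel_derivative_bound (A : R) h (M : R) z : carleson mu A ->
  bmeasurable h -> (forall t, I t -> normc (h t) <= M) -> disc z ->
  normc (hankel_derivative h z) * (1 - normc z ^+ 2) <= 192 * A * M.
Proof.
move=> hA mh hM Dz; set r := normc z.
have r01 : 0 <= r < 1 by rewrite normc_ge0/= /r.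
have d0 : 0 < 1 - r by rewrite subr_gt0; case/andP: r01.
set s := Num.sqrt (1 - r); have s0 : 0 < s by rewrite sqrtr_gt0.
have sE : s ^+ 2 = 1 - r by rewrite sqr_sqrtr// ltW.
have M0 : 0 <= M.
  by apply: le_trans (hM 0 _); [exact: normc_ge0|rewrite /= in_itv/= lexx
    ltr01].
have mw := measurable_weight r01.
have B : ((normc (hankel_derivative h z))%:E <= (2 * (M * s^-1 * (48 * A *
  s^-1)))%:E)%E.
  apply: (le_trans (@cint_le _ mu _ (fun t => M * s^-1 * weight r t) _ _ _)).
  - by apply: bmeasurableM => //; exact: bmeasurable_hker_deriv.
  - by apply: measurable_funM => //; exact: measurable_cst.
  - move=> t It; rewrite normcM [normc (t%:C * _)]normcM normcX -mulrA;
      apply: ler_pM => //.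
    + exact: normc_ge0.
    + by rewrite mulr_ge0 ?exprn_ge0 ?normc_ge0.
    + exact: hM.
    have /andP[t0 t1] := unit_itv01 It.
    apply: le_trans (weight_sqr_le r01 (unit_itv01 It)).
    rewrite normc_real_ge0// -[leRHS]mul1r; apply: ler_pM => //.
    + by rewrite exprn_ge0// normc_ge0.
    + exact: ltW.
    + rewrite ler_sqr ?nnegrE ?normc_ge0 ?normc_hker// invr_ge0 ltW//.
      exact: disc_sub_gt0.
  under eq_integral do rewrite EFinM.
  rewrite ge0_integralZl_EFin//; last 3 first.
  - by move=> t It; rewrite lee_fin ltW// weight_gt0// unit_itv01.
  - exact/measurable_EFinP.
  - by rewrite mulr_ge0// invr_ge0 ltW.
  rewrite [leRHS]EFinM; apply: lee_wpmul2l; first by rewrite lee_fin.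
  rewrite [leRHS]EFinM; apply: lee_wpmul2l.
    by rewrite lee_fin mulr_ge0// invr_ge0 ltW.
  exact: carleson_weight.
rewrite lee_fin in B.
have r2 : 0 <= 1 - r ^+ 2 <= 2 * s ^+ 2.
  by rewrite sE; case/andP: r01 => r0 r1; apply/andP; split; nra.
have A0 : 0 <= A.
  have := hA 1; rewrite ltr01 lexx => /(_ isT); rewrite mulr1 -lee_fin.
  exact: le_trans.
case/andP: r2 => r20 r2.
apply: (le_trans (ler_pM _ _ B r2)); rewrite ?normc_ge0//.
rewrite le_eqVlt; apply/orP; left; apply/eqP; field.
by rewrite gt_eqF.
Qed.

Lemma hankel_integral0 h (M : R) : bmeasurable h ->
  (forall t, I t -> normc (h t) <= M) ->
  normc (hankel_integral h 0) <= 2 * (M * mass mu).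
Proof.
move=> mh hM; rewrite hankel_integralE; last exact: disc0.
apply: cint_bound.
  by apply: bmeasurableM => //; apply: bmeasurable_hker; exact: disc0.
by move=> t It; rewrite /hker mulr0 subr0 invr1 mulr1 hM.
Qed.

Lemma hankel_integral_bloch (A : R) h (M : R) : carleson mu A ->
  bmeasurable h -> (forall t, I t -> normc (h t) <= M) ->
  (bloch_norm 1 (hankel_integral h) <= ((2 * mass mu + 192 * A) * M)%:E)%E.
Proof.
move=> hA mh hM; rewrite mulrDl EFinD; apply: leeD.
  by rewrite lee_fin -mulrA (mulrC _ M) hankel_integral0.
apply: ub_ereal_sup => _ [z Dz <-].
have [_ ->] := hankel_integral_derivable mh hM Dz.
rewrite lee_fin powRr1 ?hankel_derivative_bound//.
by rewrite subr_ge0 expr_le1// ?normc_ge0// ltW.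
Qed.

End HankelIntegral.

(** * BMOA bound *)

Section HankelMobius.
Context (R : realType).
Variable mu : {finite_measure set (measurableTypeR R) -> \bar R}.
Local Notation C := R[i].
Local Notation I := (`[0%R, 1%R[%classic : set (measurableTypeR R)).

Lemma cmeasurable_comp d1 d2 (T1 : measurableType d1) (T2 : measurableType d2)
    (f : T2 -> C) (g : T1 -> T2) : cmeasurable setT f -> measurable_fun setT g
      ->
  cmeasurable setT (f \o g).
Proof.
move=> [fr fi] mg; split.
  exact: (measurableT_comp fr mg).
exact: (measurableT_comp fi mg).
Qed.

Lemma cmeasurable_circle_pt (rho : R) :
  cmeasurable (setT : set (measurableTypeR R)) (circle_pt rho).
Proof.
rewrite /circle_pt; apply: cmeasurableM; first exact: cmeasurable_cst.
by split => /=; apply: continuous_measurable_fun;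
  [exact: continuous_cos|exact: continuous_sin].
Qed.

Lemma normc_conj (z : C) : normc (z^*)%R = normc z.
Proof. by case: z => x y; rewrite /Normc.normc /= sqrrN. Qed.

(* [hker (mobius a z) t - hker a t] is, up to a factor of modulus at most 1,
   [(1 - |a|^2) / ((1 - t a)^2 (1 - c z))] for [c = mobius_slope a t]. *)
Definition mobius_slope (a : C) (t : R) : C := (a^* - t%:C) / (1 - t%:C * a).

(** The slope is the value at [t] of the Möbius map with parameter [conj a], so this is
    [mobius_identity] with the denominator cleared. *)
Lemma mobius_slope_sqr (a : C) t : disc a -> I t ->
  (1 - normc (mobius_slope a t) ^+ 2) * normc (1 - t%:C * a) ^+ 2 =
  (1 - normc a ^+ 2) * (1 - t ^+ 2).
Proof.
move=> Da It; have D0 := hker_den_neq0 Da It.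
have n0 : normc (1 - t%:C * a) != 0 by rewrite gt_eqF// normc_gt0.
have := mobius_identity (a^*)%R t%:C.
have /andP[t0 _] := unit_itv01 It.
rewrite normc_conj (normc_real_ge0 t0) (_ : ((a^*)^*)%R = a);
  last exact: conjCK.
rewrite (mulrC a) => <-.
by rewrite /mobius_slope normcM normcV; field.
Qed.

Lemma mobius_slope_lt1 (a : C) t : disc a -> I t -> normc (mobius_slope a t) <
  1.
Proof.
move=> Da It; have D0 := hker_den_neq0 Da It.
have n0 : 0 < normc (1 - t%:C * a) by rewrite normc_gt0.
have := mobius_slope_sqr Da It.
have /andP[t0 t1] := unit_itv01 It.
have a1 : 0 < 1 - normc a ^+ 2 by rewrite subr_gt0 expr_lt1// normc_ge0.
have t2 : 0 < 1 - t ^+ 2 by rewrite subr_gt0 expr_lt1.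
move=> E; have : 0 < (1 - normc (mobius_slope a t) ^+ 2) * normc (1 - t%:C * a)
  ^+ 2.
  by rewrite E mulr_gt0.
by rewrite pmulr_lgt0 ?exprn_gt0// subr_gt0 expr_lt1// normc_ge0.
Qed.

Lemma hker_mobius (a z : C) t : disc a -> disc z -> I t ->
  hker (mobius a z) t - hker a t =
  - (t%:C * (1 - a^* * a) * z) /
    ((1 - t%:C * a) ^+ 2 * (1 - mobius_slope a t * z)).
Proof.
move=> Da Dz It; have D1 := hker_den_neq0 Da It.
have D2 := mobius_den_neq0 Da Dz.
have D3 := hker_den_neq0 (mobius_disc Da Dz) It.
(* Both sides equal [1 - t a - conj a z + t z]: composing the kernel with a Möbius map gives a
   linear fractional function again, with its pole governed by the slope. *)
have E : (1 - t%:C * a) * (1 - mobius_slope a t * z) =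
    (1 - a^* * z) * (1 - t%:C * mobius a z).
  by rewrite /mobius_slope /mobius; field; rewrite D1 D2.
have D4 : 1 - mobius_slope a t * z != 0.
  by have : (1 - t%:C * a) * (1 - mobius_slope a t * z) != 0;
    [rewrite E mulf_neq0|rewrite mulf_eq0 negb_or => /andP[]].
have -> : hker (mobius a z) t =
    (1 - a^* * z) / ((1 - t%:C * a) * (1 - mobius_slope a t * z)).
  by rewrite E /hker; field; rewrite D2 D3.
rewrite /hker; move: D4; rewrite /mobius_slope => D4.
have D5 : (1 - t%:C * a) - (a^* - t%:C) * z != 0.
  by rewrite (_ : _ - _ = (1 - t%:C * a) * (1 - (a^* - t%:C) / (1 - t%:C * a) *
    z));
    [rewrite mulf_neq0|field].
by field; rewrite D1 D5.
Qed.

Lemma normc_hker_mobius (a z : C) t : disc a -> disc z -> I t ->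
  normc (hker (mobius a z) t - hker a t) ^+ 2 <=
  (1 - normc a ^+ 2) ^+ 2 / normc (1 - t%:C * a) ^+ 4 *
    (normc (1 - mobius_slope a t * z) ^+ 2)^-1.
Proof.
move=> Da Dz It; rewrite hker_mobius// -[leRHS]mulrA -[in leRHS]invfM.
have /andP[t0 t1] := unit_itv01 It.
have a1 : 0 < 1 - normc a ^+ 2 by rewrite subr_gt0 expr_lt1// normc_ge0.
have aE : normc (1 - a^* * a) = 1 - normc a ^+ 2.
  rewrite (_ : 1 - a^* * a = (1 - normc a ^+ 2)%:C) ?normc_real_ge0 ?ltW//.
  by rewrite normc_sqr; case: (a) => x y; apply/eqP; rewrite eq_complex /=;
    apply/andP; split; apply/eqP; ring.
rewrite normcM normcN normcV exprMn exprVn.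
rewrite [normc ((1 - _) ^+ 2 * _)]normcM normcX exprMn -exprM.
apply: ler_wpM2r.
  by rewrite invr_ge0 mulr_ge0// exprn_ge0// normc_ge0.
rewrite normcM normcM aE ler_sqr ?nnegrE ?mulr_ge0 ?normc_ge0 ?(ltW a1)//.
rewrite normc_real_ge0// mulrAC -[leRHS]mul1r ler_pM2r//.
rewrite -[leRHS]mul1r; apply: ler_pM => //; first exact: normc_ge0.
  exact: ltW.
exact: ltW.
Qed.

(** The bound of [normc_hker_mobius] on the circle of radius [rho], divided by [weight (normc a) t]:
    the second factor of the Cauchy-Schwarz inequality. *)
Definition circle_majorant (a : C) (rho : R) (t s : R) : R :=
  (1 - normc a ^+ 2) ^+ 2 * ((1 - t * normc a) * Num.sqrt (1 - t)) *
  (normc (1 - t%:C * a) ^+ 4)^-1 *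
  (normc (1 - mobius_slope a t * circle_pt rho s) ^+ 2)^-1.

Lemma measurable_circle_majorant (a : C) (rho : R) :
  measurable_fun setT (fun ts : measurableTypeR R * measurableTypeR R =>
    circle_majorant a rho ts.1 ts.2).
Proof.
pose T := (measurableTypeR R * measurableTypeR R)%type.
have m1 : measurable_fun setT (fst : T -> measurableTypeR R) by exact:
  measurable_fst.
have m2 : measurable_fun setT (snd : T -> measurableTypeR R) by exact:
  measurable_snd.
have mt : cmeasurable (setT : set T) (fun ts => ts.1%:C : C).
  by apply: (@cmeasurable_real _ _ _ _ (fst : T -> R)).
have c (k : C) : cmeasurable (setT : set T) (fun=> k) by exact: cmeasurable_cst.
have mden : cmeasurable (setT : set T) (fun ts => 1 - ts.1%:C * a).
  by apply: cmeasurableB => //; exact: cmeasurableM.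
have mr (k : R) : measurable_fun (setT : set T) (fun=> k) by exact:
  measurable_cst.
have mcirc : cmeasurable (setT : set T) (fun ts => circle_pt rho ts.2).
  exact: (cmeasurable_comp (cmeasurable_circle_pt rho) m2).
have mslope : cmeasurable (setT : set T) (fun ts => mobius_slope a ts.1).
  apply: cmeasurableM; last exact: cmeasurableV.
  exact: cmeasurableB.
rewrite /circle_majorant; apply: measurable_funM; last first.
  apply: measurable_funV_ge0 => [|x _]; last exact: sqr_ge0.
  apply/measurable_funX/measurable_normc/cmeasurableB => //.
  exact: cmeasurableM.
apply: measurable_funM; last first.
  apply: measurable_funV_ge0 => [|x _]; last by rewrite exprn_ge0// normc_ge0.
  by apply/measurable_funX/measurable_normc.
apply: measurable_funM => //; apply: measurable_funM.
  by apply: measurable_funB => //; exact: measurable_funM.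
by apply: measurable_fun_sqrt; exact: measurable_funB.
Qed.

Lemma circle_majorant_ge0 (a : C) (rho t s : R) : disc a -> I t ->
  0 <= circle_majorant a rho t s.
Proof.
move=> Da It; apply: mulr_ge0; last by rewrite invr_ge0 sqr_ge0.
apply: mulr_ge0; last by rewrite invr_ge0 exprn_ge0 ?normc_ge0.
apply: mulr_ge0; first exact: sqr_ge0.
by rewrite mulr_ge0 ?sqrtr_ge0//; exact: ltW (disc_sub_gt0 Da It).
Qed.

Lemma circle_majorant_hker (a : C) (rho t s : R) : disc a -> rho \in `[0,
  1[ -> I t ->
  normc (hker (mobius a (circle_pt rho s)) t - hker a t) ^+ 2 <=
  weight (normc a) t * circle_majorant a rho t s.
Proof.
move=> Da r01 It.
apply: (le_trans (normc_hker_mobius Da (circle_pt_disc s r01) It)).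
rewrite /circle_majorant /weight; set p := (1 - t * normc a) * _.
have p0 : 0 < p.
  rewrite mulr_gt0 ?disc_sub_gt0// sqrtr_gt0 subr_gt0.
  by case/andP: (unit_itv01 It).
set u := (_ - _) ^+ 2; set v := (_ ^+ 2)^-1; set w := _ ^+ 4.
have w0 : 0 < w by rewrite exprn_gt0// normc_gt0 hker_den_neq0.
by rewrite (_ : p^-1 * _ = u / w * v)//; field; rewrite !gt_eqF.
Qed.

(** The Poisson integral produces [2 pi / (1 - c^2 rho^2)], at most [2 pi / (1 - c^2)] for [c] the
    modulus of the slope. By [mobius_slope_sqr], [1 / (1 - c^2)] is
    [|1 - t a|^2 / ((1 - |a|^2) (1 - t^2))]. The bounds [|1 - t a| >= 1 - t |a|] and
    [1 - t^2 >= 1 - t] then bring back the weight itself. *)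
Lemma circle_majorant_integral (a : C) (rho t : R) : disc a -> rho \in `[0,
  1[ ->
  I t ->
  (\int[lebesgue_measure]_(s in `[0%R, (2 * pi)%R])
     (circle_majorant a rho t s)%:E <=
   (2 * pi * (1 - normc a ^+ 2) * weight (normc a) t)%:E)%E.
Proof.
move=> Da; rewrite in_itv/= => /andP[r0 r1] It.
have c1 := mobius_slope_lt1 Da It; have c0 := normc_ge0 (mobius_slope a t).
have cr : normc (mobius_slope a t) * rho < 1.
  by apply: le_lt_trans c1; rewrite ler_piMr// ltW.
have /andP[t0 t1] := unit_itv01 It.
have p0 := disc_sub_gt0 Da It.
have q0 : 0 < Num.sqrt (1 - t) by rewrite sqrtr_gt0 subr_gt0.
have n0 : 0 < normc (1 - t%:C * a) by rewrite normc_gt0 hker_den_neq0.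
have a1 : 0 < 1 - normc a ^+ 2 by rewrite subr_gt0 expr_lt1// normc_ge0.
pose k := (1 - normc a ^+ 2) ^+ 2 * ((1 - t * normc a) * Num.sqrt (1 - t)) *
  (normc (1 - t%:C * a) ^+ 4)^-1.
have kE s : circle_majorant a rho t s =
  k * (normc (1 - mobius_slope a t * circle_pt rho s) ^+ 2)^-1 by [].
have k0 : 0 <= k.
  by rewrite /k !mulr_ge0 ?invr_ge0 ?exprn_ge0 ?normc_ge0// ltW.
under eq_integral do rewrite kE EFinM.
rewrite ge0_integralZl_EFin//; last 2 first.
- by move=> s _; rewrite lee_fin invr_ge0 sqr_ge0.
- apply/measurable_EFinP/measurable_funTS.
  apply: (measurable_funV_ge0 (f := fun s => normc (1 - mobius_slope a t *
    circle_pt rho s) ^+ 2)) => [|x _]; last exact: sqr_ge0.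
  apply/measurable_funX/measurable_normc/cmeasurableB;
    first exact: cmeasurable_cst.
  by apply: cmeasurableM; [exact: cmeasurable_cst|exact: cmeasurable_circle_pt].
rewrite circle_kernel_integral// -EFinM lee_fin.
set c := normc (mobius_slope a t) in c0 c1 cr *.
have S := mobius_slope_sqr Da It; rewrite -/c in S.
have d1 : 0 < 1 - c ^+ 2 by rewrite subr_gt0 expr_lt1.
have d2 : 1 - c ^+ 2 <= 1 - (c * rho) ^+ 2.
  by rewrite lerD2l lerN2 exprMn ler_piMr ?sqr_ge0// exprn_ile1// ltW.
have pi0 : 0 <= 2 * pi :> R by rewrite mulr_ge0// pi_ge0.
apply: (@le_trans _ _ (k * (2 * pi / (1 - c ^+ 2)))).
  apply: ler_wpM2l => //; apply: ler_wpM2l => //.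
  by rewrite lef_pV2 ?posrE// (lt_le_trans d1 d2).
have t2 : 0 < 1 - t ^+ 2 by rewrite subr_gt0 expr_lt1.
have -> : (1 - c ^+ 2)^-1 = normc (1 - t%:C * a) ^+ 2 / ((1 - normc a ^+ 2) *
  (1 - t ^+ 2)).
  by rewrite -S; field; rewrite !gt_eqF.
set n := normc (1 - t%:C * a) in n0 *.
set p := 1 - t * normc a in p0 *; set q := Num.sqrt (1 - t) in q0 *.
have pn : p <= n by exact: normc_hker_den.
have qE : q ^+ 2 = 1 - t by rewrite sqr_sqrtr// subr_ge0 ltW.
rewrite /k /weight -/p -/q -/n (_ : _ * (_ * _) = (2 * pi * (1 - normc a ^+ 2))
  * (p * q / (n ^+ 2 * (1 - t ^+ 2)))); last first.
  by field; rewrite !gt_eqF.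
apply: ler_wpM2l; first by rewrite mulr_ge0// ltW.
rewrite ler_pdivrMr ?mulr_gt0 ?exprn_gt0// ler_pdivlMl ?mulr_gt0//.
rewrite -expr2 exprMn qE; apply: ler_pM; rewrite ?sqr_ge0 ?subr_ge0 ?(ltW t1)//.
  by rewrite ler_sqr ?nnegrE ?(ltW p0) ?(ltW n0).
by rewrite lerD2l lerN2 expr2 ler_piMl// ltW.
Qed.

End HankelMobius.

Section HankelBMOA.
Context (R : realType).
Variables (mu : {finite_measure set (measurableTypeR R) -> \bar R}).
Local Notation C := R[i].
Local Notation I := (`[0%R, 1%R[%classic : set (measurableTypeR R)).
Local Notation J := (`[0%R, (2 * pi)%R]%classic : set (measurableTypeR R)).

(* The inequality between the arithmetic and geometric means
   [2 sqrt (w U) <= l w + U / l], optimised over [l], plays the role of the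
   Cauchy-Schwarz inequality. *)
Lemma cint_weighted_sqr (g : R -> C) (w U : R -> R) (W M : R) :
  bmeasurable g -> measurable_fun I w -> measurable_fun I U ->
  0 < W -> 0 < M ->
  (forall t, I t -> 0 <= w t) -> (forall t, I t -> 0 <= U t) ->
  (\int[mu]_(t in I) (w t)%:E <= W%:E)%E ->
  (forall t, I t -> normc (g t) ^+ 2 <= M ^+ 2 * (w t * U t)) ->
  ((normc (cint mu g) ^+ 2)%:E <=
   (4 * M ^+ 2 * W)%:E * \int[mu]_(t in I) (U t)%:E)%E.
Proof.
move=> mg mw mU W0 M0 w0 U0 wW gle.
have k0 : 0 < 4 * M ^+ 2 * W by rewrite !mulr_gt0// exprn_gt0.
have X0 : (0 <= \int[mu]_(t in I) (U t)%:E)%E.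
  by apply: integral_ge0 => t It; rewrite lee_fin U0.
have [->|Xfin] := eqVneq (\int[mu]_(t in I) (U t)%:E)%E +oo%E.
  by rewrite gt0_muley ?lte_fin// leey.
have {Xfin} : (\int[mu]_(t in I) (U t)%:E)%E \is a fin_num.
  by rewrite ge0_fin_numE// ltey.
move=> /fineK; set x := fine _ => xE.
have x0 : 0 <= x by rewrite -lee_fin xE.
have H (l : R) : 0 < l -> normc (cint mu g) <= M * (l * W + l^-1 * x).
  move=> l0.
  have gl t : I t -> normc (g t) <= M * 2^-1 * (l * w t + l^-1 * U t).
    move=> It; have := gle t It; have := w0 t It; have := U0 t It.
    have li : 0 < l^-1 by rewrite invr_gt0.
    move=> u0 v0 h.
    have s0 : 0 <= l * w t + l^-1 * U t by rewrite addr_ge0// mulr_ge0// ltW.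
    rewrite -(@ler_pXn2r _ 2) ?nnegrE ?normc_ge0//; last first.
      by rewrite !mulr_ge0 ?invr_ge0// ltW.
    apply: (le_trans h); rewrite !exprMn -mulrA ler_pM2l ?exprn_gt0//.
    rewrite exprVn -ler_pdivrMl ?invr_gt0 ?exprn_gt0// invrK -subr_ge0.
    rewrite (_ : _ - _ = (l * w t - l^-1 * U t) ^+ 2) ?sqr_ge0//.
    by field; rewrite gt_eqF.
  rewrite -lee_fin; apply: (le_trans (@cint_le _ mu _ _ mg _ gl)).
    apply: measurable_funM; first exact: measurable_cst.
    by apply: measurable_funD; apply: measurable_funM => //;
      exact: measurable_cst.
  have mlw : measurable_fun I (fun t => (l * w t)%:E).
    by apply/measurable_EFinP/measurable_funM => //; exact: measurable_cst.
  have mlU : measurable_fun I (fun t => (l^-1 * U t)%:E).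
    by apply/measurable_EFinP/measurable_funM => //; exact: measurable_cst.
  have li : 0 < l^-1 by rewrite invr_gt0.
  under eq_integral do rewrite EFinM EFinD.
  rewrite ge0_integralZl_EFin//; last 3 first.
  - by move=> t It; rewrite -EFinD lee_fin addr_ge0// mulr_ge0 ?w0 ?U0// ltW.
  - exact: emeasurable_funD.
  - by rewrite mulr_ge0 ?invr_ge0// ltW.
  rewrite ge0_integralD//; last 2 first.
  - by move=> t It; rewrite lee_fin mulr_ge0 ?w0// ltW.
  - by move=> t It; rewrite lee_fin mulr_ge0 ?U0// ltW.
  under eq_integral do rewrite EFinM.
  under [X in (_ + X)%E]eq_integral do rewrite EFinM.
  rewrite ge0_integralZl_EFin//; [|exact/measurable_EFinP|exact: ltW].
  rewrite ge0_integralZl_EFin//; [|exact/measurable_EFinP|exact: ltW].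
  rewrite -xE muleA -EFinM (_ : 2 * (M * 2^-1) = M); last by field.
  rewrite [leRHS]EFinM; apply: lee_wpmul2l; first by rewrite lee_fin ltW.
  rewrite [leRHS]EFinD -EFinM; apply: leeD => //.
  by rewrite EFinM; apply: lee_wpmul2l => //; rewrite lee_fin ltW.
rewrite -xE -EFinM lee_fin.
have := normc_ge0 (cint mu g); rewrite le_eqVlt => /predU1P[<-|y0].
  by rewrite expr0n/= mulr_ge0// ltW.
set y := normc _ in y0 H *.
(* This [l] turns [M l W] into [y / 2], which is absorbed by the left-hand side. *)
have := H (y / (2 * M * W)); rewrite divr_gt0 ?mulr_gt0// => /(_ isT).
rewrite (_ : M * _ = y / 2 + 2 * M ^+ 2 * W * x / y); last first.
  by field; rewrite !gt_eqF.
rewrite -lerBlDl (_ : y - y / 2 = y / 2); last by field.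
rewrite ler_pdivlMr// mulrAC ler_pdivrMr// -expr2.
by move=> /le_trans; apply; rewrite le_eqVlt; apply/orP; left; apply/eqP; ring.
Qed.

Section Circle.
Variables (A M rho : R) (h : R -> C) (a : C).
Hypotheses (A0 : 0 < A) (M0 : 0 < M) (hA : carleson mu A).
Hypotheses (mh : bmeasurable h) (hM : forall t, I t -> normc (h t) <= M).
Hypotheses (Da : disc a) (r01 : rho \in `[0, 1[).

Let osc (s : R) : R := normc (hankel_integral mu h (mobius a (circle_pt rho s))
  -
  hankel_integral mu h a).
Let W : R := 48 * A * (Num.sqrt (1 - normc a))^-1.
Let U (t s : R) := circle_majorant a rho t s.

Let a01 : 0 <= normc a < 1. Proof. by rewrite normc_ge0/=. Qed.

Let W0 : 0 < W.
Proof. by rewrite !mulr_gt0// invr_gt0 sqrtr_gt0 subr_gt0. Qed.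

Let mU1 (s : R) : measurable_fun setT (fun t : measurableTypeR R => U t s).
Proof.
exact: (measurableT_comp (measurable_circle_majorant a rho)
  (@pair2_measurable _ _ (measurableTypeR R) (measurableTypeR R) s)).
Qed.

Lemma hankel_oscillation_sqr (s : R) :
  ((osc s ^+ 2)%:E <=
   (4 * M ^+ 2 * W)%:E * \int[mu]_(t in I) (U t s)%:E)%E.
Proof.
have Dm : disc (mobius a (circle_pt rho s)) by exact/mobius_disc/circle_pt_disc.
have mk1 := bmeasurable_hker Dm; have mk2 := bmeasurable_hker Da.
rewrite /osc !hankel_integralE// -cintB; [|exact: bmeasurableM..].
apply: (cint_weighted_sqr (w := weight (normc a))) => //.
- by apply: bmeasurableB; exact: bmeasurableM.
- exact: measurable_weight.
- by apply: measurable_funTS; exact: mU1.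
- by move=> t It; rewrite ltW// weight_gt0// unit_itv01.
- by move=> t It; exact: circle_majorant_ge0.
- exact: carleson_weight.
- move=> t It; rewrite -mulrBr normcM exprMn.
  apply: ler_pM; rewrite ?sqr_ge0//.
    by rewrite ler_sqr ?nnegrE ?normc_ge0 ?hM// ltW.
  exact: circle_majorant_hker.
Qed.

(** Tonelli's theorem is applied on the whole plane to [U] cut off by the two indicators. The
    measurability of the partial integrals comes from the same construction and serves to compare
    the iterated integrals in [circle_mean2_hankel]. *)
Lemma circle_majorant_tonelli :
  [/\ measurable_fun J (fun s => \int[mu]_(t in I) (U t s)%:E)%E,
      measurable_fun I (fun t => \int[lebesgue_measure]_(s in J) (U t s)%:E)%E &
  (\int[lebesgue_measure]_(s in J) \int[mu]_(t in I) (U t s)%:E =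
   \int[mu]_(t in I) \int[lebesgue_measure]_(s in J) (U t s)%:E)%E].
Proof.
pose g (ts : measurableTypeR R * measurableTypeR R) : \bar R :=
  (U ts.1 ts.2 * (\1_I ts.1 * \1_J ts.2))%:E.
have mg : measurable_fun setT g.
  apply/measurable_EFinP/measurable_funM; first exact:
    measurable_circle_majorant.
  have mi (K : set (measurableTypeR R)) : measurable K ->
      measurable_fun setT (\1_K : measurableTypeR R -> R).
    exact: measurable_indic.
  apply: measurable_funM.
    by apply: (measurableT_comp (mi _ _) measurable_fst); exact: measurable_itv.
  by apply: (measurableT_comp (mi _ _) measurable_snd); exact: measurable_itv.
have g0 ts : (0 <= g ts)%E.
  rewrite lee_fin /g; have [It|nIt] := pselect (I ts.1).
    by apply: mulr_ge0; [exact: circle_majorant_ge0|rewrite mulr_ge0].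
  by rewrite [\1_I _]indicE memNset// mul0r mulr0.
have E1 s : (\int[mu]_t g (t, s) = ((fun s => \int[mu]_(t in I) (U t s)%:E) \_
  J) s)%E.
  rewrite patchE; case: ifPn => Js.
    rewrite [RHS]integral_mkcond; apply: eq_integral => t _.
    rewrite patchE /g/= !indicE Js mulr1; case: ifPn => _;
      first by rewrite mulr1.
    by rewrite mulr0.
  by apply: integral0_eq => t _; rewrite /g/= [\1_J _]indicE (negbTE Js) !mulr0.
have E2 t : (\int[lebesgue_measure]_s g (t, s) =
    ((fun t => \int[lebesgue_measure]_(s in J) (U t s)%:E) \_ I) t)%E.
  rewrite patchE; case: ifPn => It.
    rewrite [RHS]integral_mkcond; apply: eq_integral => s _.
    rewrite patchE /g/= !indicE It mul1r; case: ifPn => _;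
      first by rewrite mulr1.
    by rewrite mulr0.
  by apply: integral0_eq => s _; rewrite /g/= [\1_I _]indicE (negbTE It) mul0r
    mulr0.
have mF := measurable_fun_fubini_tonelli_F (m2 := @lebesgue_measure R) g mg g0.
have mG := measurable_fun_fubini_tonelli_G (m1 := mu) g mg g0.
have mJ : measurable J by exact: measurable_itv.
have mI' : measurable I by exact: measurable_itv.
split.
- apply: (proj2 (measurable_restrictT _ mJ)).
  by apply: eq_measurable_fun mG => s _; exact: E1.
- apply: (proj2 (measurable_restrictT _ mI')).
  by apply: eq_measurable_fun mF => t _; exact: E2.
rewrite integral_mkcond [RHS]integral_mkcond.
under eq_integral do rewrite -E1.
under [RHS]eq_integral do rewrite -E2.
by have := @fubini_tonelli _ _ _ _ _ mu (@lebesgue_measure R) g mg g0 => ->.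
Qed.

Lemma circle_mean2_hankel :
  (circle_mean2 (fun z => (hankel_integral mu h (mobius a z) -
     hankel_integral mu h a)%R) rho <= (144 * A * M)%:E)%E.
Proof.
have hh := hankel_integral_holomorphic mh hM.
have cosc : continuous osc by exact: bmoa_circle_continuous.
have pi0 : 0 < 2 * pi :> R by rewrite mulr_gt0// pi_gt0.
have a1 : 0 < 1 - normc a by rewrite subr_gt0.
have a2 : 0 <= 1 - normc a ^+ 2 by rewrite subr_ge0 expr_le1 ?normc_ge0// ltW.
set s := Num.sqrt (1 - normc a); have s0 : 0 < s by rewrite sqrtr_gt0.
have sE : s ^+ 2 = 1 - normc a by rewrite sqr_sqrtr// ltW.
have [mG mF tonelli] := circle_majorant_tonelli.
have B : (\int[lebesgue_measure]_(s in J) (osc s ^+ 2)%:E <=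
    ((4 * M ^+ 2 * W) * (2 * pi * (1 - normc a ^+ 2) * W))%:E)%E.
  apply: (@le_trans _ _ (\int[lebesgue_measure]_(s in J)
      ((4 * M ^+ 2 * W)%:E * \int[mu]_(t in I) (U t s)%:E))%E).
    apply: ge0_le_integral => //.
    - by move=> t _; rewrite lee_fin sqr_ge0.
    - apply/measurable_EFinP/measurable_funX/measurable_funTS.
      exact: continuous_measurable_fun.
    - exact: measurable_funeM.
    - by move=> t _; exact: hankel_oscillation_sqr.
  have kk : 0 <= 4 * M ^+ 2 * W by rewrite !mulr_ge0// ?exprn_ge0// ltW.
  rewrite ge0_integralZl_EFin//; last first.
    by move=> t _; apply: integral_ge0 => u Iu;
      rewrite lee_fin circle_majorant_ge0.
  rewrite [leRHS]EFinM; apply: lee_wpmul2l; first by rewrite lee_fin.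
  rewrite tonelli.
  apply: (@le_trans _ _ (\int[mu]_(t in I)
      (2 * pi * (1 - normc a ^+ 2) * weight (normc a) t)%:E)%E).
    apply: ge0_le_integral => //.
    - move=> t It; apply: integral_ge0 => u Iu.
      by rewrite lee_fin circle_majorant_ge0.
    - apply/measurable_EFinP/measurable_funM; first exact: measurable_cst.
      exact: measurable_weight.
    - by move=> t It; exact: circle_majorant_integral.
  have pa : 0 <= 2 * pi * (1 - normc a ^+ 2) by rewrite mulr_ge0// ltW.
  under eq_integral do rewrite EFinM.
  rewrite ge0_integralZl_EFin//; last 2 first.
  - by move=> t It; rewrite lee_fin ltW// weight_gt0// unit_itv01.
  - by apply/measurable_EFinP; exact: measurable_weight.
  rewrite [leRHS]EFinM; apply: lee_wpmul2l; first by rewrite lee_fin.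
  exact: carleson_weight.
(* The left-hand side is [4 (48 A M)^2 (1 - |a|^2) / (1 - |a|)], at most [8 (48 A M)^2]; rounding 8
   up to 9 makes the bound a square, with root [3 * 48 = 144] times [A M]. *)
have key : (2 * pi)^-1 * ((4 * M ^+ 2 * W) * (2 * pi * (1 - normc a ^+ 2) * W))
  <=
    (144 * A * M) ^+ 2.
  rewrite /W -/s (_ : (2 * pi)^-1 * _ = 4 * (48 * A * M) ^+ 2 * (1 - normc a ^+
    2) / s ^+ 2); last first.
    have pi1 : pi != 0 :> R by rewrite gt_eqF// pi_gt0.
    have s1 : s != 0 by rewrite gt_eqF.
    move: pi1 s1; move: (pi : R) => k k0 s1.
    by field; rewrite k0 s1.
  rewrite sE ler_pdivrMr// (_ : (144 * A * M) ^+ 2 = 9 * (48 * A * M) ^+ 2);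
    last by ring.
  have : 0 <= (48 * A * M) ^+ 2 by exact: sqr_ge0.
  move: ((48 * A * M) ^+ 2) => Q Q0.
  have : 1 - normc a ^+ 2 <= 2 * (1 - normc a).
    by have := normc_ge0 a; nra.
  move: (1 - normc a ^+ 2) (1 - normc a) a1 a2 => u v u0 v0 uv; nra.
rewrite /circle_mean2.
have AM0 : 0 <= 144 * A * M by rewrite !mulr_ge0// ltW.
have -> : (144 * A * M)%:E = (((144 * A * M) ^+ 2)%:E `^ 2^-1)%E.
  by rewrite poweR_EFin powR12_sqrt ?sqr_ge0// sqrtr_sqr ger0_norm.
apply: gt0_ler_poweR; rewrite ?in_itv/= ?leey ?andbT ?lee_fin ?sqr_ge0
  ?invr_ge0//.
  by rewrite mule_ge0 ?lee_fin ?pi2_ge0 ?int_sqr_ge0.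
apply: (@le_trans _ _ (((2 * pi)^-1)%:E *
  ((4 * M ^+ 2 * W) * (2 * pi * (1 - normc a ^+ 2) * W))%:E)%E).
  by apply: lee_wpmul2l; rewrite ?lee_fin ?pi2_ge0.
by rewrite -EFinM lee_fin.
Qed.

End Circle.

Lemma hankel_integral_bmoa (A : R) (h : R -> C) (M : R) : 0 < A -> 0 < M ->
  carleson mu A -> bmeasurable h -> (forall t, I t -> normc (h t) <= M) ->
  (bmoa_norm (hankel_integral mu h) <= ((2 * mass mu + 144 * A) * M)%:E)%E.
Proof.
move=> A0 M0 hA mh hM; rewrite mulrDl EFinD; apply: leeD.
  by rewrite lee_fin -mulrA (mulrC _ M) hankel_integral0.
apply: ub_ereal_sup => _ [a Da <-]; apply: ub_ereal_sup => _ [r r01 <-].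
exact: circle_mean2_hankel.
Qed.

End HankelBMOA.

(** * Radial behaviour of Bloch functions *)

Section BlochRadial.
Context (R : realType).
Local Notation C := R[i].

(** [p] stands for the real or the imaginary part; this brings radial questions under real calculus,
    in particular the mean value theorem. *)
Lemma is_derive_radial (p : C -> R) (f : C -> C) (x : R) :
  (forall w, `|p w| <= normc w) -> (forall w w', p (w - w') = p w - p w') ->
  (forall (k : R) w, p (k%:C * w) = k * p w) ->
  derivable f x%:C 1 -> is_derive x 1 (fun t : R => p (f t%:C)) (p (derive1 f
    x%:C)).
Proof.
move=> ple pB pZ df; set l := derive1 f x%:C; set g := fun t : R => p (f t%:C).
have : h^-1 *: ((f \o shift x%:C) (h *: 1) - f x%:C) @[h --> 0^'] --> l.
  by rewrite /l derive1E; exact: df.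
move=> /cvgC_normcP H.
have G : h^-1 *: ((g \o shift x) (h *: 1) - g x) @[h --> (0:R)^'] --> p l.
  apply/cvgrPdist_lt => e e0.
  have /nbhs_ballP[d /= /gt0_complexE[dE d0] Hd] := H e e0.
  apply/nbhs_ballP; exists (complex.Re d) => //= u ub u0.
  have uC : u%:C != 0 by apply: contra_neq u0 => /complexI.
  have ud : ball (0 : C) d u%:C.
    move: ub; rewrite -!ball_normE /ball_/= !sub0r !normrN.
    by rewrite Defs.normcE dE ltcR normc_real.
  have := Hd _ ud uC; rewrite /= => K.
  have -> : u^-1 *: (g (u *: 1 + x) - g x) =
      p ((u%:C)^-1 * (f (u%:C + x%:C) - f x%:C)).
    rewrite -fmorphV/= pZ pB /g [u *: 1]mulr1 (_ : (u + x)%:C = u%:C + x%:C)//.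
    by rewrite rmorphD.
  rewrite -pB; apply: (le_lt_trans (ple _)).
  by rewrite normc_sub; move: K; rewrite [u%:C *: 1]mulr1.
by split; [apply/cvg_ex; exists (p l)|exact/cvg_lim].
Qed.

Variables (alpha N : R) (f : C -> C).
Hypotheses (halpha : 0 < alpha < 1) (hf : holomorphic f).
Hypothesis fN : (bloch_norm alpha f <= N%:E)%E.
Local Notation beta := (1 - alpha).

Let b0 : 0 < beta. Proof. by case/andP: halpha => *; rewrite subr_gt0. Qed.

Lemma bloch_norm0_le : normc (f 0) <= N.
Proof.
rewrite -lee_fin; apply: le_trans fN; rewrite /bloch_norm leeDl//.
exact: bloch_sup_ge0.
Qed.

Lemma bloch_bound_ge0 : 0 <= N.
Proof. exact: le_trans (normc_ge0 _) bloch_norm0_le. Qed.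

Lemma bloch_derivative_le z : disc z ->
  normc (derive1 f z) * (1 - normc z ^+ 2) `^ alpha <= N.
Proof.
move=> Dz; rewrite -lee_fin; apply: le_trans fN.
apply: (@le_trans _ _ (ereal_sup [set (normc (derive1 f z) *
  (1 - normc z ^+ 2) `^ alpha)%:E | z in @disc R])).
  by apply: ereal_sup_ubound; exists z.
by rewrite /bloch_norm leeDr// lee_fin normc_ge0.
Qed.

Let real_disc (x : R) : 0 <= x < 1 -> disc (x%:C : C).
Proof. by move=> /andP[x0 x1]; rewrite /disc/= normc_real_ge0. Qed.

Lemma bloch_radial_derivative (x : R) : 0 <= x < 1 ->
  normc (derive1 f x%:C) <= N * (1 - x) `^ (- alpha).
Proof.
move=> x01; have := bloch_derivative_le (real_disc x01).
case/andP: x01 => x0 x1; rewrite normc_real_ge0// => H.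
have d0 : 0 < 1 - x by rewrite subr_gt0.
rewrite powRN ler_pdivlMr ?powR_gt0//; apply: le_trans H.
apply: ler_wpM2l; first exact: normc_ge0.
apply: ge0_ler_powR; rewrite ?nnegrE; try nra.
by case/andP: halpha => /ltW.
Qed.

(** Cauchy's mean value theorem against [v x = (1 - x)^beta]: its derivative
    [- beta (1 - x)^(- alpha)] has exactly the growth that the Bloch norm allows to [f'], so the
    quotient of increments is at most [N / beta]. *)
Lemma bloch_radial_modulus (p : C -> R) (s t : R) :
  (forall w, `|p w| <= normc w) -> (forall w w', p (w - w') = p w - p w') ->
  (forall (k : R) w, p (k%:C * w) = k * p w) ->
  0 <= s -> s <= t -> t < 1 ->
  `|p (f t%:C) - p (f s%:C)| <= N / beta * ((1 - s) `^ beta - (1 - t) `^ beta).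
Proof.
move=> ple pB pZ s0; rewrite le_eqVlt => /predU1P[->|st] t1.
  by rewrite !subrr normr0 mulr0.
pose v (x : R) : R := (1 - x) `^ beta.
have vst : 0 < v s - v t.
  by rewrite subr_gt0; apply: gt0_ltr_powR; rewrite ?nnegrE//; lra.
(* The value for which [g] agrees at [s] and [t], so that its derivative vanishes in between. *)
pose lam : R := (p (f t%:C) - p (f s%:C)) / (v s - v t).
pose g (x : R) : R := p (f x%:C) + lam * v x.
have dv (x : R) : x < 1 -> is_derive x 1 v (- (beta * (1 - x) `^ (- alpha))).
  move=> x1; have x0 : 0 < 1 - x by rewrite subr_gt0.
  have d1 : is_derive x 1 (fun y : R => 1 - y) (-1).
    have D := @is_deriveB _ _ _ (cst (1 : R)) id x 1 _ _ (is_derive_cst (1 : R)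
      x 1) (is_derive_id x 1).
    by apply: (is_derive_eq D); rewrite sub0r.
  have d2 := @is_derive1_powR R beta (1 - x) x0.
  have D := @is_derive1_comp _ _ _ x _ _ d2 d1.
  apply: (is_derive_eq D); rewrite mulrN1; congr (- (_ * _ `^ _)); ring.
have dg (x : R) : 0 <= x < 1 ->
    is_derive x 1 g (p (derive1 f x%:C) - lam * (beta * (1 - x) `^ (- alpha))).
  move=> x01; have d1 := is_derive_radial ple pB pZ (hf (real_disc x01)).
  have x1 : x < 1 by case/andP: x01.
  have D := @is_deriveD _ _ _ _ _ _ _ _ _ d1 (@is_deriveZ _ _ _ _ lam _ _ _ (dv
    x x1)).
  by apply: (is_derive_eq D); rewrite /GRing.scale /= mulrN.
have i01 (x : R) : x \in `[s, t] -> 0 <= x < 1.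
  by rewrite in_itv/= => /andP[? ?]; apply/andP; split; lra.
have cg : {within `[s, t], continuous g}.
  apply: continuous_in_subspaceT => x /set_mem /= xst.
  apply/differentiable_continuous/derivable1_diffP.
  by case: (dg x (i01 _ xst)).
have [|||c cst] := @MVT R g (fun x => p (derive1 f x%:C) - lam * (beta * (1 -
  x) `^ (- alpha))) s t.
- exact: st.
- by move=> x xst; apply: dg; apply: i01; exact: subset_itv_oo_cc.
- exact: cg.
have c01 : 0 <= c < 1 by apply: i01; exact: subset_itv_oo_cc.
rewrite (_ : g t - g s = 0); last first.
  rewrite /g /lam (_ : _ - _ = (p (f t%:C) - p (f s%:C)) - lam * (v s - v t));
    last first.
    by rewrite /lam; ring.
  by rewrite /lam divfK ?subrr// gt_eqF.
move=> /esym/eqP; rewrite mulf_eq0 [t - s == 0]gt_eqF ?subr_gt0// orbF subr_eq0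
  => /eqP E.
have c0 : 0 < (1 - c) `^ (- alpha) by apply: powR_gt0; case/andP: c01 => *;
  rewrite subr_gt0.
have lamN : `|lam| <= N / beta.
  have := le_trans (ple _) (bloch_radial_derivative c01).
  rewrite E !normrM (gtr0_norm b0) (gtr0_norm c0) mulrA ler_pM2r//.
  by rewrite ler_pdivlMr.
have -> : p (f t%:C) - p (f s%:C) = lam * (v s - v t).
  by rewrite /lam divfK// gt_eqF.
by rewrite normrM (gtr0_norm vst) ler_pM2r.
Qed.

Lemma bloch_radial_lipschitz (s t : R) : 0 <= s -> s <= t -> t < 1 ->
  normc (f t%:C - f s%:C) <=
  2 * N / beta * ((1 - s) `^ beta - (1 - t) `^ beta).
Proof.
move=> s0 st t1; apply: (le_trans (normc_Re_Im_le _)).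
have ReB (w w' : C) : complex.Re (w - w') = complex.Re w - complex.Re w'.
  by case: w => ? ?; case: w'.
have ImB (w w' : C) : complex.Im (w - w') = complex.Im w - complex.Im w'.
  by case: w => ? ?; case: w'.
have ReZ (k : R) (w : C) : complex.Re (k%:C * w) = k * complex.Re w.
  by case: w => ? ? /=; rewrite mul0r subr0.
have ImZ (k : R) (w : C) : complex.Im (k%:C * w) = k * complex.Im w.
  by case: w => ? ? /=; rewrite mul0r addr0.
rewrite ReB ImB (_ : 2 * N / beta * _ = N / beta * ((1 - s) `^ beta - (1 - t)
  `^ beta) + N / beta * ((1 - s) `^ beta - (1 - t) `^ beta)); last ring.
apply: lerD; apply: bloch_radial_modulus => //.
  exact: normc_Re_le.
exact: normc_Im_le.
Qed.

Lemma bloch_radial_bound (t : R) : 0 <= t < 1 ->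
  normc (f t%:C) <= (1 + 2 / beta) * N.
Proof.
move=> /andP[t0 t1]; have N0 := bloch_bound_ge0.
have -> : f t%:C = f 0 + (f t%:C - f (0 : R)%:C) by rewrite addrC subrK.
apply: (le_trans (normcD_le _ _)); rewrite mulrDl mul1r; apply: lerD.
  exact: bloch_norm0_le.
apply: (le_trans (bloch_radial_lipschitz (lexx _) t0 t1)).
have h : (1 - 0) `^ beta - (1 - t) `^ beta <= 1.
  by rewrite subr0 powR1 gerBl powR_ge0.
rewrite (_ : 2 / beta * N = 2 * N / beta * 1); last by rewrite mulr1 mulrAC.
by apply: ler_wpM2l => //; rewrite !mulr_ge0// invr_ge0 ltW.
Qed.

Lemma bmeasurable_radial : bmeasurable (fun t : R => f t%:C).
Proof.
have c (p : C -> R) : (forall w, `|p w| <= normc w) -> (forall w w',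
  p (w - w') = p w - p w') ->
  (forall (k : R) w, p (k%:C * w) = k * p w) ->
  measurable_fun (`[0%R, 1%R[%classic : set (measurableTypeR R)) (fun t : R =>
    p (f t%:C)).
  move=> ple pB pZ; apply: subspace_continuous_measurable_fun;
    first exact: measurable_itv.
  apply: continuous_in_subspaceT => x /set_mem /=; rewrite in_itv/= => x01.
  apply/differentiable_continuous/derivable1_diffP.
  by case: (is_derive_radial ple pB pZ (hf (real_disc x01))).
split; last first.
  exists ((1 + 2 / beta) * N) => t /=; rewrite in_itv/=.
  exact: bloch_radial_bound.
split; apply: c.
- exact: normc_Re_le.
- by move=> [? ?] [? ?].
- by move=> k [? ?] /=; rewrite mul0r subr0.
- exact: normc_Im_le.
- by move=> [? ?] [? ?].
- by move=> k [? ?] /=; rewrite mul0r addr0.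
Qed.

(** A fraction [w / (x + y)] in [[0, 1]] is at most its power [beta <= 1]; the fractions for [x] and
    [y] add up to 1. *)
Lemma powR_subadditive (x y : R) : 0 <= x -> 0 <= y ->
  (x + y) `^ beta <= x `^ beta + y `^ beta.
Proof.
have b1 : beta <= 1 by case/andP: halpha => *; lra.
move=> x0 y0; have := addr_ge0 x0 y0; rewrite le_eqVlt => /predU1P[<-|s0].
  by rewrite powR0 ?gt_eqF// addr_ge0 ?powR_ge0.
have H (w : R) : 0 <= w -> w <= x + y -> w / (x + y) * (x + y) `^ beta <= w `^
  beta.
  move=> w0 ws; have q : w / (x + y) <= (w / (x + y)) `^ beta.
    move: w0; rewrite le_eqVlt => /predU1P[<-|w0];
      first by rewrite mul0r powR0 ?gt_eqF.
    by apply: ger1_powR => //; rewrite divr_gt0//= ler_pdivrMr ?mul1r.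
  rewrite -{2}[w](@divfK _ (x + y)) ?gt_eqF// powRM ?divr_ge0// ?(ltW s0)//.
  by apply: ler_wpM2r => //; exact: powR_ge0.
apply: le_trans (lerD (H x x0 _) (H y y0 _)); rewrite ?lerDl ?lerDr//.
by rewrite -mulrDl -mulrDl mulfV ?gt_eqF// mul1r.
Qed.

(** Uniformity in [t] up to the endpoint 1 comes from [1 - r t = (1 - t) + t (1 - r)] and
    subadditivity; it allows the dilation to be removed under the integral. *)
Lemma bloch_radial_dilation (r t : R) : 0 <= r < 1 -> 0 <= t < 1 ->
  normc (f t%:C - f (r * t)%:C) <= 2 * N / beta * (1 - r) `^ beta.
Proof.
move=> /andP[r0 r1] /andP[t0 t1]; have N0 := bloch_bound_ge0.
apply: (le_trans (bloch_radial_lipschitz _ _ t1)).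
- exact: mulr_ge0.
- by rewrite ler_piMl// ltW.
apply: ler_wpM2l; first by rewrite !mulr_ge0// invr_ge0 ltW.
rewrite lerBlDl (_ : 1 - r * t = (1 - t) + t * (1 - r)); last ring.
apply: (@le_trans _ _ ((1 - t) `^ beta + (t * (1 - r)) `^ beta)).
  by apply: powR_subadditive; [lra|rewrite mulr_ge0// subr_ge0 ltW].
rewrite lerD2l; apply: ge0_ler_powR; rewrite ?nnegrE ?(ltW b0)//.
- by rewrite mulr_ge0// subr_ge0 ltW.
- by rewrite subr_ge0 ltW.
- by rewrite ler_piMl ?(ltW t1)// subr_ge0 ltW.
Qed.

End BlochRadial.

(** * Abel summation *)

Section AbelSummation.
Context (R : realType).
Local Notation C := R[i].

Lemma cvgC_norm_le (u : nat -> C) (l c : C) (b : R) (N : nat) :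
  u @ \oo --> l -> (forall n, (N <= n)%N -> normc (u n - c) <= b) ->
  normc (l - c) <= b.
Proof.
move=> /cvgC_normcP ul uc; apply/ler_addgt0Pl => e e0.
have [n _ Hn] := ul e e0.
have := Hn (maxn n N) (leq_maxl _ _); rewrite /= => h1.
have h2 := uc (maxn n N) (leq_maxr _ _).
have -> : l - c = - (u (maxn n N) - l) + (u (maxn n N) - c) by ring.
by apply: (le_trans (normcD_le _ _)); rewrite normcN lerD// ltW.
Qed.

Lemma cvgC_unique (u : nat -> C) (l l' : C) :
  u @ \oo --> l -> (forall e : R, 0 < e -> exists N : nat,
    forall n, (N <= n)%N -> normc (u n - l') <= e) -> l = l'.
Proof.
move=> ul ul'; apply/eqP; rewrite -subr_eq0 -[_ == 0]negbK -normc_gt0 -leNgt.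
apply/ler_addgt0Pl => e e0; rewrite addr0.
by have [N HN] := ul' e e0; exact: cvgC_norm_le ul HN.
Qed.

Lemma cvgC_bounded (u : nat -> C) (l : C) : u @ \oo --> l ->
  exists2 B : R, 0 <= B & forall n, normc (u n) <= B.
Proof.
move=> /cvgC_normcP ul; have [N _ HN] := ul 1 ltr01.
pose B := normc l + 1 + \sum_(i < N) normc (u i).
have s0 : 0 <= \sum_(i < N) normc (u i) by apply: sumr_ge0 => i _;
  exact: normc_ge0.
exists B; first by rewrite /B !addr_ge0 ?normc_ge0.
move=> n; have [Nn|nN] := leqP N n.
  have := HN n Nn; rewrite /= => /ltW h.
  have -> : u n = l + (u n - l) by rewrite addrC subrK.
  apply: (le_trans (normcD_le _ _)); rewrite /B.
  by rewrite -addrA lerD2l (le_trans h)// lerDl.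
rewrite /B (bigD1 (Ordinal nN))//= addrCA lerDl !addr_ge0 ?normc_ge0//.
by apply: sumr_ge0 => i _; exact: normc_ge0.
Qed.

(** Summation by parts, centred at the prospective limit [b]. The index [k.+1] appears because
    [series c k] stops before the term [c k]. *)
Lemma abel_identity (c : nat -> C) (b x : C) n :
  \sum_(0 <= k < n) c k * x ^+ k = b + (series c n - b) * x ^+ n +
    (1 - x) * \sum_(0 <= k < n) (series c k.+1 - b) * x ^+ k.
Proof.
elim: n => [|n IH].
  by rewrite /series /= !big_geq// mulr0 addr0 expr0 mulr1 sub0r subrr.
rewrite !big_nat_recr//= IH.
have -> : series c n.+1 = series c n + c n by rewrite /series /= big_nat_recr.
by rewrite exprS; ring.
Qed.

(** Abel's theorem for radial limits. The three thirds of [e] pay for the boundary term of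
    [abel_identity], for the indices from [K] on, and for the first [K] indices. *)
Lemma abel_limit (c : nat -> C) (b : C) (G : R -> C) :
  series c @ \oo --> b ->
  (forall r : R, 0 <= r < 1 -> series (fun k => c k * r%:C ^+ k) @ \oo --> G r)
    ->
  forall e : R, 0 < e -> exists2 d : R, 0 < d &
    forall r : R, 0 <= r < 1 -> 1 - r < d -> normc (G r - b) <= e.
Proof.
move=> cb HG e e0.
have [T T0 HT] : exists2 T : R, 0 <= T & forall n, normc (series c n - b) <= T.
  have [B B0 HB] := cvgC_bounded cb.
  exists (B + normc b); first by rewrite addr_ge0// normc_ge0.
  by move=> n; apply: (le_trans (normcD_le _ _)); rewrite normcN lerD.
have e3 : 0 < e / 3 by rewrite divr_gt0.
move/cvgC_normcP: (cb) => /(_ _ e3)[K _ HK].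
have {}HK n : (K <= n)%N -> normc (series c n - b) <= e / 3.
  by move=> /HK /ltW.
have TK : 0 < T * K%:R + 1 by rewrite ltr_wpDl// mulr_ge0.
exists (e / 3 / (T * K%:R + 1)); first exact: divr_gt0.
move=> r /andP[r0 r1] rd.
have r1' : 0 <= 1 - r by rewrite subr_ge0 ltW.
(* Each index below [K] costs at most [(1 - r) T]; the later ones cost [e / 3 * (1 - r) r^k], which
   telescopes. *)
have tail n : (1 - r) * \sum_(0 <= k < n) normc (series c k.+1 - b) * r ^+ k <=
    e / 3 * (1 - r ^+ n) + (1 - r) * (T * (minn n K)%:R).
  elim: n => [|n IH].
    by rewrite big_geq// min0n !mulr0 expr0 subrr mulr0 addr0.
  rewrite big_nat_recr//= mulrDr.
  have rn : 0 <= r ^+ n <= 1 by rewrite exprn_ge0//= exprn_ile1// ltW.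
  case/andP: rn => rn0 rn1.
  have [Kn|nK] := leqP K n.
    have h : (1 - r) * (normc (series c n.+1 - b) * r ^+ n) <= e / 3 * ((1 - r)
      * r ^+ n).
      rewrite mulrCA; apply: ler_wpM2r; first exact: mulr_ge0.
      by apply: HK; exact: leqW.
    move: IH; rewrite (minn_idPr Kn) (minn_idPr (leqW Kn)) exprS => IH.
    lra.
  have h : (1 - r) * (normc (series c n.+1 - b) * r ^+ n) <= (1 - r) * T.
    apply: ler_wpM2l => //; rewrite -[leRHS]mulr1.
    by apply: ler_pM => //; exact: normc_ge0.
  move: IH; rewrite (minn_idPl (ltnW nK)) (minn_idPl nK) exprS (_ : n.+1%:R =
    n%:R + 1 :> R) ?natr1// => IH.
  have h2 : r * r ^+ n <= r ^+ n by rewrite ler_piMl// ltW.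
  have h3 : e / 3 * (1 - r ^+ n) <= e / 3 * (1 - r * r ^+ n).
    by apply: ler_wpM2l; [exact: ltW|rewrite lerD2l lerN2].
  lra.
apply: (cvgC_norm_le (HG r _) (N := K)); first by rewrite r0.
move=> n Kn.
have -> : series (fun k => c k * r%:C ^+ k) n - b = (series c n - b) * r%:C ^+
  n +
    (1 - r%:C) * \sum_(0 <= k < n) (series c k.+1 - b) * r%:C ^+ k.
  by rewrite {1}/series /= (abel_identity c b); ring.
have rn : 0 <= r ^+ n <= 1 by rewrite exprn_ge0//= exprn_ile1// ltW.
case/andP: rn => rn0 rn1.
apply: (le_trans (normcD_le _ _)); rewrite (_ : e = e / 3 + (e / 3 + e / 3));
  last by field.
apply: lerD.
  rewrite normcM normcX normc_real_ge0// -[leRHS]mulr1.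
  by apply: ler_pM => //; [exact: normc_ge0|exact: HK].
rewrite normcM (_ : 1 - r%:C = (1 - r)%:C); last by rewrite rmorphB.
rewrite normc_real_ge0//.
apply: (@le_trans _ _ ((1 - r) * \sum_(0 <= k < n) normc (series c k.+1 - b) *
  r ^+ k)).
  apply: ler_wpM2l => //.
  elim: n {Kn rn0 rn1} => [|n IH]; first by rewrite !big_geq// normcC0.
  rewrite !big_nat_recr//=; apply: (le_trans (normcD_le _ _)).
  by apply: lerD => //; rewrite normcM normcX normc_real_ge0.
apply: (le_trans (tail n)); apply: lerD.
  by rewrite ger_pMr// gerBl.
have : (1 - r) * (T * K%:R + 1) <= e / 3 by rewrite -ler_pdivlMr// ltW.
rewrite (minn_idPr Kn); nra.
Qed.

(** Convergence at the intermediate radius [s = (1 + r) / 2] bounds the terms [a k * s^k], each a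
    difference of two partial sums (whence [B + B]), and the ratio is [q = r / s]. *)
Lemma power_series_geometric (a : nat -> C) (f : C -> C) (r : R) :
  power_series_on_disc a f -> 0 <= r < 1 -> exists B q : R,
    [/\ 0 <= B, 0 <= q < 1 & forall k, normc (a k) * r ^+ k <= B * q ^+ k].
Proof.
move=> af /andP[r0 r1]; pose s : R := (1 + r) / 2.
have s01 : 0 < s < 1 by apply/andP; split; rewrite /s; lra.
case/andP: s01 => s0 s1.
have Ds : disc (s%:C : C) by rewrite /disc/= normc_real_ge0// ltW.
have [B B0 HB] := cvgC_bounded (af _ Ds).
exists (B + B), (r / s); split; first exact: addr_ge0.
  by rewrite divr_ge0 ?(ltW s0)//= ltr_pdivrMr// mul1r /s; lra.
move=> k; rewrite exprMn exprVn mulrCA [leRHS]mulrC mulrC.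
rewrite [leLHS]mulrC; apply: ler_wpM2l; first exact: exprn_ge0.
rewrite ler_pdivlMr ?exprn_gt0//.
have -> : normc (a k) * s ^+ k = normc (a k * s%:C ^+ k).
  by rewrite normcM normcX normc_real_ge0// ltW.
have -> : a k * s%:C ^+ k = series (fun k => a k * s%:C ^+ k) k.+1 -
    series (fun k => a k * s%:C ^+ k) k.
  by rewrite /series /= big_nat_recr//= addrAC subrr add0r.
by apply: (le_trans (normcD_le _ _)); rewrite normcN lerD.
Qed.

Lemma geometric_sum_le (q : R) N m : 0 <= q < 1 -> (N <= m)%N ->
  \sum_(N <= k < m) q ^+ k <= q ^+ N / (1 - q).
Proof.
move=> /andP[q0 q1] Nm; have q1' : 0 < 1 - q by rewrite subr_gt0.
rewrite ler_pdivlMr//.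
suff -> : (\sum_(N <= k < m) q ^+ k) * (1 - q) = q ^+ N - q ^+ m.
  by rewrite gerBl exprn_ge0.
elim: m Nm => [|m IH].
  by rewrite leqn0 => /eqP ->; rewrite big_geq// mul0r subrr.
rewrite leq_eqVlt => /predU1P[<-|]; first by rewrite big_geq// mul0r subrr.
by rewrite ltnS => Nm; rewrite big_nat_recr//= mulrDl IH// exprS; ring.
Qed.

Lemma power_series_tail (a : nat -> C) (f : C -> C) (r B q x : R) N :
  power_series_on_disc a f -> 0 <= B -> 0 <= q < 1 ->
  (forall k, normc (a k) * r ^+ k <= B * q ^+ k) -> 0 <= x -> x <= r -> r < 1 ->
  normc (f x%:C - \sum_(0 <= k < N) a k * x%:C ^+ k) <= B * (q ^+ N / (1 - q)).
Proof.
move=> af B0 q01 aB x0 xr r1.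
have Dx : disc (x%:C : C) by rewrite /disc/= normc_real_ge0// (le_lt_trans xr).
apply: (cvgC_norm_le (af _ Dx) (N := N)) => n Nn.
rewrite /series /= (big_cat_nat (leq0n N) Nn)//= addrAC subrr add0r.
apply: (@le_trans _ _ (\sum_(N <= k < n) B * q ^+ k)); last first.
  by rewrite -mulr_sumr; apply: ler_wpM2l => //; exact: geometric_sum_le.
elim/big_ind2: _ => [|u v y z hu hv|k _]; first by rewrite normcC0.
  by apply: (le_trans (normcD_le _ _)); exact: lerD.
rewrite normcM normcX normc_real_ge0//; apply: le_trans (aB k).
apply: ler_wpM2l; first exact: normc_ge0.
by rewrite lerXn2r ?nnegrE// (le_trans x0).
Qed.

Lemma geometric_small (q B e : R) : 0 <= q < 1 -> 0 <= B -> 0 < e ->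
  exists N : nat, forall n, (N <= n)%N -> B * q ^+ n <= e.
Proof.
move=> /andP[q0 q1] B0 e0.
have h : (fun n => B * q ^+ n) @ \oo --> (0 : R).
  have -> : (0 : R) = B * 0 by rewrite mulr0.
  apply: cvgM; first exact: cvg_cst.
  by apply: cvg_expr; rewrite ger0_norm.
move/cvgrPdist_lt: h => /(_ e e0)[N _ HN]; exists N => n Nn.
have := HN n Nn; rewrite /= sub0r normrN ger0_norm; first exact: ltW.
by rewrite mulr_ge0// exprn_ge0.
Qed.

End AbelSummation.

(** * Integral representation *)

Section Representation.
Context (R : realType).
Variable mu : {finite_measure set (measurableTypeR R) -> \bar R}.
Local Notation C := R[i].
Local Notation I := (`[0%R, 1%R[%classic : set (measurableTypeR R)).

Lemma bmeasurableX n : bmeasurable (fun t : R => t%:C ^+ n : C).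
Proof.
elim: n => [|n IH]; first exact: bmeasurable_cst.
apply: (@eq_bmeasurable _ (fun t => t%:C * t%:C ^+ n)).
  by move=> t _; rewrite exprS.
by apply: bmeasurableM => //; exact: bmeasurable_id.
Qed.

Lemma moment_cint n : (moment mu n)%:C = cint mu (fun t => t%:C ^+ n).
Proof.
have E (t : R) : t%:C ^+ n = (t ^+ n)%:C :> C by rewrite rmorphXn.
apply/eqP; rewrite eq_complex /=; apply/andP; split; apply/eqP.
  by apply: eq_Rintegral => t _; rewrite E.
rewrite (@eq_Rintegral _ _ _ mu _ (fun=> 0)); last by move=> t _; rewrite E.
by rewrite /Rintegral integral0.
Qed.

Variables (alpha N : R) (f : C -> C).
Hypotheses (halpha : 0 < alpha < 1) (hf : holomorphic f).
Hypothesis fN : (bloch_norm alpha f <= N%:E)%E.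
Local Notation beta := (1 - alpha).

Let b0 : 0 < beta. Proof. by case/andP: halpha => *; rewrite subr_gt0. Qed.
Let B0 : R := (1 + 2 / beta) * N.
Let N0 : 0 <= N := bloch_bound_ge0 fN.
Let mf : bmeasurable (fun t : R => f t%:C) := bmeasurable_radial halpha hf fN.

Let dilI (r t : R) : 0 <= r < 1 -> I t -> 0 <= r * t < 1.
Proof.
move=> /andP[r0 r1] /unit_itv01/andP[t0 t1].
by rewrite mulr_ge0//= (le_lt_trans _ t1)// ler_piMl// ltW.
Qed.

Lemma bmeasurable_dilation (r : R) : 0 <= r < 1 ->
  bmeasurable (fun t : R => f (r * t)%:C).
Proof.
move=> r01; have [[mr mi] [M HM]] := mf.
have mI' : measurable I by exact: measurable_itv.
have sub : (fun t : measurableTypeR R => r * t : measurableTypeR R) @` I `<=` I.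
  by move=> _ [t It <-]; rewrite /= in_itv/= dilI.
have mm : measurable_fun I (fun t : measurableTypeR R => r * t :
  measurableTypeR R).
  exact: (@measurable_funM _ _ _ I (cst r) id).
split; first split.
- exact: (measurable_comp mI' sub mr mm).
- exact: (measurable_comp mI' sub mi mm).
- by exists M => t It; apply: HM; rewrite /= in_itv/= dilI.
Qed.

Variable a : nat -> C.
Hypothesis af : power_series_on_disc a f.

(** For [r < 1] the Taylor series of [f (r t)] converges uniformly on [0, 1[ at a geometric rate,
    which justifies exchanging sum and integral. *)
Lemma cint_dilation_series n (r : R) : 0 <= r < 1 ->
  series (fun k => (moment mu (n + k))%:C * a k * r%:C ^+ k) @ \oo -->
  cint mu (fun t => t%:C ^+ n * f (r * t)%:C).
Proof.
move=> r01; have [B [q [Bge0 q01 HB]]] := power_series_geometric af r01.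
case/andP: (r01) => r0 r1; case/andP: (q01) => q0 q1.
have q1' : 0 < 1 - q by rewrite subr_gt0.
apply/cvgC_normcP => e e0.
pose D : R := 2 * (B / (1 - q) * mass mu).
have D0 : 0 <= D by rewrite !mulr_ge0 ?mass_ge0// invr_ge0 ltW.
have [m0 Hm0] := geometric_small q01 D0 (divr_gt0 e0 (@ltr0Sn R 1)).
exists m0 => // m /= m0m.
pose P (t : R) : C := \sum_(0 <= k < m) a k * (r * t)%:C ^+ k.
have md := bmeasurable_dilation r01.
have mX := bmeasurableX n.
have mP : bmeasurable P.
  apply: bmeasurable_sum => k; apply: bmeasurableM;
    first exact: bmeasurable_cst.
  apply: (@eq_bmeasurable _ (fun t => r%:C ^+ k * t%:C ^+ k)).
    by move=> t _; rewrite rmorphM exprMn.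
  by apply: bmeasurableM; [exact: bmeasurable_cst|exact: bmeasurableX].
have sE : series (fun k => (moment mu (n + k))%:C * a k * r%:C ^+ k) m =
    cint mu (fun t => t%:C ^+ n * P t).
  rewrite /series /= (@eq_cint _ mu _ (fun t => \sum_(0 <= k < m) (a k * r%:C
    ^+ k) * t%:C ^+ (n + k))).
    rewrite cint_sum; last first.
      by move=> k; apply: bmeasurableM; [exact: bmeasurable_cst|exact:
        bmeasurableX].
    apply: eq_bigr => k _; rewrite cintZ; last exact: bmeasurableX.
    by rewrite -moment_cint; ring.
  move=> t _; rewrite /P mulr_sumr; apply: eq_bigr => k _.
  by rewrite rmorphM exprMn exprD; ring.
rewrite sE normc_sub -cintB; [|exact: bmeasurableM..].
apply: (@le_lt_trans _ _ (e / 2)); last by rewrite gtr_pMr// invf_lt1// ltr1n.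
apply: le_trans (Hm0 m m0m).
have -> : D * q ^+ m = 2 * (B * (q ^+ m / (1 - q)) * mass mu) by rewrite /D;
  ring.
apply: cint_bound.
  by apply: bmeasurableB; exact: bmeasurableM.
move=> t It; have /andP[t0 t1] := unit_itv01 It.
rewrite -mulrBr normcM normcX normc_real_ge0//.
rewrite -[leRHS]mul1r; apply: ler_pM; rewrite ?exprn_ge0 ?normc_ge0//.
  by rewrite exprn_ile1// ltW.
apply: (power_series_tail _ af Bge0 q01 HB _ _ r1).
  exact: mulr_ge0.
by rewrite ler_piMr// ltW.
Qed.

(** The integral of the dilation is compared with [b] by Abel's theorem and with the undilated
    integral by [bloch_radial_dilation]. *)
Lemma hankel_coefficient n (b : C) :
  series (fun k => (moment mu (n + k))%:C * a k) @ \oo --> b ->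
  b = cint mu (fun t => t%:C ^+ n * f t%:C).
Proof.
move=> cb; apply/eqP; rewrite -subr_eq0 -[_ == 0]negbK -normc_gt0 -leNgt.
apply/ler_addgt0Pl => e e0; rewrite addr0.
have e2 : 0 < e / 2 by rewrite divr_gt0.
have [d d0 Hd] := abel_limit cb (fun r r01 => @cint_dilation_series n r r01) e2.
pose D : R := 2 * (2 * N / beta * mass mu) + 1.
have D0 : 0 < D by rewrite ltr_wpDl// !mulr_ge0 ?mass_ge0// invr_ge0 ltW.
pose e' : R := e / 2 / D; have e'0 : 0 < e' by rewrite divr_gt0.
(* [w] is [1 - r]: the three bounds serve Abel's theorem, the condition [0 <= r], and
   [(1 - r)^beta <= e']. *)
pose w : R := Num.min (Num.min (d / 2) 1) (e' `^ beta^-1).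
have w0 : 0 < w by rewrite !lt_min ltr01 divr_gt0//= powR_gt0.
have [wd w1 we] : [/\ w <= d / 2, w <= 1 & w <= e' `^ beta^-1].
  by rewrite /w; split; rewrite !ge_min lexx ?orbT.
pose r : R := 1 - w; have r01 : 0 <= r < 1 by apply/andP; split; rewrite /r;
  lra.
have rw : 1 - r = w by rewrite /r; ring.
have H1 : normc (cint mu (fun t => t%:C ^+ n * f (r * t)%:C) - b) <= e / 2.
  by apply: Hd => //; rewrite rw; lra.
have wb : w `^ beta <= e'.
  apply: (@le_trans _ _ ((e' `^ beta^-1) `^ beta)).
    by apply: ge0_ler_powR; rewrite ?nnegrE ?powR_ge0 ?(ltW w0) ?(ltW b0).
  by rewrite -powRrM mulVf ?gt_eqF// powRr1// ltW.
have md := bmeasurable_dilation r01.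
have mX := bmeasurableX n.
have H2 : normc (cint mu (fun t => t%:C ^+ n * f t%:C) -
    cint mu (fun t => t%:C ^+ n * f (r * t)%:C)) <= e / 2.
  rewrite -cintB; [|exact: bmeasurableM..].
  apply: (@le_trans _ _ (2 * (2 * N / beta * e' * mass mu))).
    apply: cint_bound; first by apply: bmeasurableB; exact: bmeasurableM.
    move=> t It; have /andP[t0 t1] := unit_itv01 It.
    rewrite -mulrBr normcM normcX normc_real_ge0//.
    rewrite -[leRHS]mul1r; apply: ler_pM; rewrite ?exprn_ge0 ?normc_ge0//.
      by rewrite exprn_ile1// ltW.
    apply: (le_trans (bloch_radial_dilation halpha hf fN r01 (unit_itv01 It))).
    rewrite rw; apply: ler_wpM2l => //.
    by rewrite !mulr_ge0// invr_ge0 ltW.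
  have -> : 2 * (2 * N / beta * e' * mass mu) = (D - 1) * e' by rewrite /D;
    ring.
  have -> : e / 2 = D * e' by rewrite /e' [RHS]mulrC divfK// gt_eqF.
  by apply: ler_wpM2r; [exact: ltW|rewrite gerBl].
rewrite normc_sub.
have -> : cint mu (fun t => t%:C ^+ n * f t%:C) - b =
  (cint mu (fun t => t%:C ^+ n * f t%:C) - cint mu (fun t => t%:C ^+ n * f (r *
    t)%:C)) +
  (cint mu (fun t => t%:C ^+ n * f (r * t)%:C) - b) by ring.
by apply: (le_trans (normcD_le _ _)); lra.
Qed.

Lemma hker_geometric (z : C) (t : R) m : 1 - t%:C * z != 0 ->
  hker z t - \sum_(0 <= k < m) (t%:C * z) ^+ k = (t%:C * z) ^+ m * hker z t.
Proof.
move=> D; elim: m => [|m IH].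
  by rewrite big_geq// subr0 expr0 mul1r.
rewrite big_nat_recr//= opprD addrA IH exprS /hker; field.
by [].
Qed.

(** For fixed [z] in the disc the geometric series of the kernel converges uniformly in [t], so the
    coefficients just identified can be summed under the integral. *)
Lemma hankel_image_integral (g : C -> C) (b : nat -> C) :
  (forall n, series (fun k => (moment mu (n + k))%:C * a k) @ \oo --> b n) ->
  power_series_on_disc b g ->
  forall z, disc z -> g z = hankel_integral mu (fun t => f t%:C) z.
Proof.
move=> cb bg z Dz; apply: (cvgC_unique (bg z Dz)) => e e0.
have d0 : 0 < 1 - normc z by rewrite subr_gt0.
pose D : R := 2 * (B0 * (1 - normc z)^-1 * mass mu).
have B00 : 0 <= B0 by rewrite mulr_ge0// addr_ge0// mulr_ge0// invr_ge0 ltW.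
have i0 : 0 <= (1 - normc z)^-1 by rewrite invr_ge0 ltW.
have D0 : 0 <= D.
  by apply: mulr_ge0 => //; apply: mulr_ge0; [exact: mulr_ge0|exact: mass_ge0].
have z01 : 0 <= normc z < 1 by rewrite normc_ge0.
have [m0 Hm0] := geometric_small z01 D0 e0.
exists m0 => m m0m; apply: le_trans (Hm0 m m0m).
have mk := bmeasurable_hker Dz.
pose P (t : R) : C := \sum_(0 <= k < m) (t%:C * z) ^+ k.
have mP : bmeasurable P.
  apply: bmeasurable_sum => k; apply: (@eq_bmeasurable _ (fun t => t%:C ^+ k *
    z ^+ k)).
    by move=> t _; rewrite exprMn.
  by apply: bmeasurableM; [exact: bmeasurableX|exact: bmeasurable_cst].
have mXf k : bmeasurable (fun t => t%:C ^+ k * f t%:C).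
  by apply: bmeasurableM => //; exact: bmeasurableX.
have sE : series (fun k => b k * z ^+ k) m = cint mu (fun t => f t%:C * P t).
  rewrite /series /= (@eq_cint _ mu _ (fun t => \sum_(0 <= k < m) z ^+ k *
    (t%:C ^+ k * f t%:C))).
    rewrite cint_sum; last first.
      by move=> k; apply: bmeasurableM; [exact: bmeasurable_cst|exact: mXf].
    apply: eq_bigr => k _; rewrite cintZ; last exact: mXf.
    by rewrite (hankel_coefficient (cb k)) mulrC.
  by move=> t _; rewrite /P mulr_sumr; apply: eq_bigr => k _; rewrite exprMn;
    ring.
rewrite sE hankel_integralE// normc_sub -cintB; [|exact: bmeasurableM..].
have -> : D * normc z ^+ m = 2 * (B0 * (normc z ^+ m * (1 - normc z)^-1) * mass
  mu).
  by rewrite /D; ring.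
apply: cint_bound; first by apply: bmeasurableB; exact: bmeasurableM.
move=> t It; have /andP[t0 t1] := unit_itv01 It.
rewrite -mulrBr hker_geometric; last exact: hker_den_neq0.
rewrite normcM; apply: ler_pM; rewrite ?normc_ge0//.
  by apply: (bloch_radial_bound halpha hf fN); exact: unit_itv01.
rewrite normcM normcX; apply: ler_pM; rewrite ?normc_ge0 ?exprn_ge0
  ?normc_ge0//.
  rewrite lerXn2r ?nnegrE ?normc_ge0//.
  by rewrite normcM normc_real_ge0// ler_piMl ?normc_ge0// ltW.
exact: normc_hker_le.
Qed.

End Representation.

(** * Finite-rank approximation *)

Section FiniteRank.
Context (R : realType).
Local Notation C := R[i].

Lemma linear_of (U V : lmodType C) (F : U -> V) :
  (forall (c : C) u v, F (c *: u + v) = c *: F u + F v) ->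
  exists L : {linear U -> V}, forall u, L u = F u.
Proof.
move=> FL.
pose FI := GRing.isLinear.Build C U V *:%R F FL.
pose FF : {linear U -> V} := HB.pack F FI.
by exists FF.
Qed.

Lemma compact_square (L : R) : compact [set c : C | `|complex.Re c| <= L /\
  `|complex.Im c| <= L].
Proof.
pose box : set (R * R) := `[- L, L] `*` `[- L, L].
have cbox : compact box by apply: compact_setX; exact: segment_compact.
have cont : continuous (fun p : R * R => p.1%:C + 'i * p.2%:C : C).
  move=> p; apply/cvgC_normcP => e e0.
  have e2 : 0 < e / 2 by rewrite divr_gt0.
  have h1 : \forall x \near nbhs p, `|x.1 - p.1| < e / 2.
    have : (fun x : R * R => x.1) @ p --> p.1 by exact: cvg_fst.
    move=> /cvgrPdist_lt/(_ _ e2).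
    by apply: filterS => x; rewrite distrC.
  have h2 : \forall x \near nbhs p, `|x.2 - p.2| < e / 2.
    have : (fun x : R * R => x.2) @ p --> p.2 by exact: cvg_snd.
    move=> /cvgrPdist_lt/(_ _ e2).
    by apply: filterS => x; rewrite distrC.
  apply: filterS2 h1 h2 => x h1 h2.
  apply: (le_lt_trans (normc_Re_Im_le _)).
  by case: x p h1 h2 => [x1 x2] [p1 p2] /=; rewrite !(mul0r, mulr0, mul1r,
    subr0, add0r, addr0) /=; lra.
have -> : [set c : C | `|complex.Re c| <= L /\ `|complex.Im c| <= L] =
    (fun p : R * R => p.1%:C + 'i * p.2%:C : C) @` box.
  apply/seteqP; split=> [c [cr ci]|_ [[x y] [/= hx hy] <-]].
    exists (complex.Re c, complex.Im c); last by rewrite -complexE.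
    by rewrite /box /= !in_itv /= -!ler_norml.
  move: hx hy; rewrite !in_itv /= -!ler_norml => hx hy.
  by rewrite !(mul0r, mulr0, mul1r, subr0, add0r, addr0).
by apply: continuous_compact => //; exact: continuous_subspaceT.
Qed.

Lemma compact_bounded_span (V : normedModType C) (Q : nat -> V) (L : R) (n :
  nat) :
  compact [set v : V | exists2 c : nat -> C,
    (forall j, `|complex.Re (c j)| <= L /\ `|complex.Im (c j)| <= L) &
    v = \sum_(0 <= j < n) c j *: Q j].
Proof.
set S := fun n => [set v : V | exists2 c : nat -> C,
    (forall j, `|complex.Re (c j)| <= L /\ `|complex.Im (c j)| <= L) &
    v = \sum_(0 <= j < n) c j *: Q j].
rewrite -/(S n); elim: n => [|n IH].
  (* For [L < 0] no [c] is admissible, and the set is empty rather than the singleton 0. *)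
  have [L0|L0] := leP 0 L; last first.
    have -> : S 0%N = set0.
      apply/seteqP; split=> // v [c cL _]; have [h _] := cL 0%N.
      by have := le_lt_trans (le_trans (normr_ge0 _) h) L0; rewrite ltxx.
    exact: compact0.
  have -> : S 0%N = [set 0]; last exact: compact_set1.
  apply/seteqP; split=> [v [c _ ->]|v ->]; first by rewrite big_geq.
  by exists (fun=> 0); [move=> j; rewrite /= normr0|rewrite big_geq].
set B := [set c : C | `|complex.Re c| <= L /\ `|complex.Im c| <= L].
have -> : S n.+1 = (fun p : V * C => p.1 + p.2 *: Q n) @` (S n `*` B).
  apply/seteqP; split=> [v [c cL ->]|_ [[v d] [/= [c cL ->] dB] <-]].
    exists (\sum_(0 <= j < n) c j *: Q j, c n); last by rewrite big_nat_recr.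
    by split => /=; [exists c|exact: cL].
  exists (fun j => if j == n then d else c j); first by move=> j; case: ifP.
  rewrite big_nat_recr//= eqxx; congr (_ + _);
    apply: eq_big_nat => j /andP[_ jn].
  by rewrite ltn_eqF.
apply: continuous_compact; last by apply: compact_setX => //;
  exact: compact_square.
apply: continuous_subspaceT => p; apply: cvgD; first exact: cvg_fst.
by apply: cvgZ; [exact: cvg_snd|exact: cvg_cst].
Qed.

Lemma compact_op_finite_rank (U V : normedModType C) (K : {linear U -> V})
    (Q : nat -> V) (c : nat -> U -> C) (L : R) (n : nat) :
  (forall u, K u = \sum_(0 <= j < n) c j u *: Q j) ->
  (forall j u, `|u| <= 1 -> normc (c j u) <= L) -> compact_op K.
Proof.
move=> KE cL; have cS := @compact_bounded_span V Q L n.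
have hV : hausdorff_space V by exact: norm_hausdorff.
apply: (subclosed_compact _ cS); first exact: closed_closure.
rewrite closureE; apply: smallest_sub; first exact: compact_closed.
move=> _ [u u1 <-]; exists (fun j => c j u); last exact: KE.
move=> j.
have h := cL j u u1; split; first exact: le_trans (normc_Re_le _) h.
exact: le_trans (normc_Im_le _) h.
Qed.

End FiniteRank.

Section EssentialNorm.

(** * Vanishing of the essential norm for a general target norm *)

Context (R : realType).
Variable mu : {finite_measure set (measurableTypeR R) -> \bar R}.
Local Notation C := R[i].
Local Notation I := (`[0%R, 1%R[%classic : set (measurableTypeR R)).
Variables (alpha : R) (N : disc_norm R) (K1 : R).
Hypothesis halpha : 0 < alpha < 1.
(** All that is asked of the target norm. Bloch and BMOA satisfy it with different constants [K1],
    so both cases are treated at once. *)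
Hypothesis HN : forall (h : R -> C) (M : R), 0 < M -> bmeasurable h ->
  (forall t, I t -> normc (h t) <= M) ->
  (N (hankel_integral mu h) <= (K1 * M)%:E)%E.
Local Notation beta := (1 - alpha).

Let b0 : 0 < beta. Proof. by case/andP: halpha => *; rewrite subr_gt0. Qed.

Let K10 : 0 <= K1.
Proof.
have H : forall t, I t -> normc ((fun=> 0 : C) t) <= 1 by move=> t _;
  rewrite normcC0.
have := HN ltr01 (bmeasurable_cst 0) H; rewrite mulr1 -lee_fin => h.
exact: le_trans (Defs.dnorm_ge0 N _) h.
Qed.

Lemma fspace_pred_hankel (h : R -> C) (M : R) : 0 < M -> bmeasurable h ->
  (forall t, I t -> normc (h t) <= M) -> hankel_integral mu h \in fspace_pred N.
Proof.
move=> M0 mh hM; apply/asboolP; split.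
- exact: hankel_integral_off.
- exact: hankel_integral_holomorphic mh hM.
- by apply: le_lt_trans (HN M0 mh hM) _; exact: ltry.
Qed.

Lemma fspace_normr_le (M : disc_norm R) (f : fspace M) (k : R) :
  (M f <= k%:E)%E -> `|f| <= k%:C.
Proof. by move=> h; rewrite fspace_normE lecR -lee_fin fineK// fspace_fin. Qed.

Lemma fspace_norm_ge (M : disc_norm R) (f : fspace M) (k : R) :
  `|f| <= k%:C -> (M f <= k%:E)%E.
Proof. by rewrite fspace_normE lecR -lee_fin fineK// fspace_fin. Qed.

Lemma fspace_val_lin (M : disc_norm R) (c : C) (u v : fspace M) (z : C) :
  fspace_val (c *: u + v) z = c * fspace_val u z + fspace_val v z.
Proof. by rewrite fspace_valD. Qed.

Definition radial (f : bloch alpha) (t : R) : C := fspace_val f t%:C.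

Lemma radial_bmeasurable (f : bloch alpha) : bmeasurable (radial f).
Proof.
have [_ hf _] := fspaceP f.
apply: (@bmeasurable_radial _ alpha (fine (bloch_norm alpha f)) f halpha hf).
by rewrite fineK// (fspace_fin f).
Qed.

Lemma radial_bound (f : bloch alpha) (k : R) t : `|f| <= k%:C -> 0 <= t < 1 ->
  normc (radial f t) <= (1 + 2 / beta) * k.
Proof.
move=> fk t01; have [_ hf _] := fspaceP f.
exact: (bloch_radial_bound halpha hf (fspace_norm_ge fk) t01).
Qed.

Variable S : {linear bloch alpha -> fspace N}.
Hypothesis SE : forall f z, fspace_val (S f) z = hankel_integral mu (radial f)
  z.

Lemma bounded_op_hankel : bounded_op S.
Proof.
exists (K1 * (1 + 2 / beta)) => f.
(* [HN] takes a positive bound only, so the zero function is set apart. *)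
have [->|f0] := eqVneq f 0; first by rewrite linear0 !normr0 mulr0.
set k := fine (bloch_dnorm alpha f).
have kE : `|f| = k%:C by exact: fspace_normE.
have k0 : 0 < k by have : 0 < `|f| by [rewrite normr_gt0]; rewrite kE ltcR.
rewrite kE -rmorphM -mulrA; apply: fspace_normr_le.
have -> : fspace_val (S f) = hankel_integral mu (radial f).
  by apply/funext => z; exact: SE.
apply: HN.
- by rewrite mulr_gt0// ltr_wpDr// divr_ge0// ltW.
- exact: radial_bmeasurable.
- by move=> t It; apply: radial_bound; rewrite ?kE//; exact: unit_itv01.
Qed.

Section Partition.
Variable n : nat.
Hypothesis n0 : (0 < n)%N.

(* The nodes cut [0, 1[ so that [(1 - t) ^ beta], which controls the
   oscillation of a function of [B^alpha], drops by [1 / n] on each cell. *)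
Definition node (j : nat) : R := 1 - (1 - j%:R / n%:R) `^ beta^-1.

Definition cell (j : nat) (t : R) : C := (\1_(`[node j,
  node j.+1[%classic : set (measurableTypeR R)) t)%:C.

Let nR : 0 < n%:R :> R. Proof. by rewrite ltr0n. Qed.

Let frac (j : nat) : (j <= n)%N -> 0 <= 1 - j%:R / n%:R :> R.
Proof. by move=> jn; rewrite subr_ge0 ler_pdivrMr// mul1r ler_nat. Qed.

Lemma node0 : node 0 = 0.
Proof. by rewrite /node mul0r subr0 powR1 subrr. Qed.

Lemma noden : node n = 1.
Proof.
by rewrite /node mulfV ?gt_eqF// subrr powR0 ?subr0// invr_eq0 gt_eqF.
Qed.

Lemma node_le i j : (i <= j)%N -> (j <= n)%N -> node i <= node j.
Proof.
move=> ij jn; rewrite lerD2l lerN2; apply: ge0_ler_powR.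
- by rewrite invr_ge0 ltW.
- by rewrite nnegrE frac.
- by rewrite nnegrE frac// (leq_trans ij).
- by rewrite lerD2l lerN2 ler_pM2r ?invr_gt0// ler_nat.
Qed.

Lemma node_powR j : (j <= n)%N -> (1 - node j) `^ beta = 1 - j%:R / n%:R.
Proof.
move=> jn; rewrite /node opprB addrC subrK -powRrM mulVf ?gt_eqF//.
by rewrite powRr1// frac.
Qed.

Lemma node01 j : (j < n)%N -> 0 <= node j < 1.
Proof.
move=> jn; rewrite -{1}node0 node_le ?(ltnW jn)//=.
rewrite gtrBl powR_gt0// subr_gt0 ltr_pdivrMr// mul1r ltr_nat//.
Qed.

Lemma node_cell t : 0 <= t < 1 ->
  exists2 j, (j < n)%N & node j <= t < node j.+1.
Proof.
move=> /andP[t0 t1]; have ex : exists m, t < node m by exists n; rewrite noden.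
case: (ex_minnP ex) => -[|m] tm mmin; first by rewrite node0 ltNge t0 in tm.
exists m.
  by apply: mmin; rewrite noden.
by rewrite tm andbT leNgt; apply/negP => /mmin; rewrite ltnn.
Qed.

Lemma cell_sum (c : nat -> C) (t : R) (j : nat) : (j < n)%N ->
  node j <= t < node j.+1 -> \sum_(0 <= i < n) c i * cell i t = c j.
Proof.
move=> jn /andP[jt tj]; rewrite big_mkord (bigD1 (Ordinal jn))//=.
rewrite /cell indicE mem_set ?mulr1; last by rewrite /= in_itv/= jt.
rewrite big1 ?addr0// => i ij; rewrite indicE memNset ?mulr0// /= in_itv/= =>
  /andP[it ti].
have /orP[h|h] : (i < j)%N || (j < i)%N.
  by rewrite -neq_ltn; apply: contra_neq ij => h; exact: val_inj.
- by have := le_lt_trans (le_trans (node_le h (ltnW jn)) jt) ti; rewrite ltxx.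
- by have := le_lt_trans (le_trans (node_le h (ltnW (ltn_ord i))) it) tj;
    rewrite ltxx.
Qed.

Lemma bmeasurable_cell j : bmeasurable (cell j).
Proof.
split; first by apply: cmeasurable_real; exact: measurable_indic.
by exists 1 => t _; rewrite /cell normc_real ger0_norm// indicE.
Qed.

Lemma cell_le1 j t : I t -> normc (cell j t) <= 1.
Proof.
by move=> _; rewrite /cell normc_real ger0_norm// indicE; case: (_ \in _).
Qed.

Definition cell_image (j : nat) : fspace N :=
  Fspace (fspace_pred_hankel ltr01 (bmeasurable_cell j) (@cell_le1 j)).

Lemma radial_approx (f : bloch alpha) t : `|f| <= 1 -> 0 <= t < 1 ->
  normc (radial f t - \sum_(0 <= j < n) radial f (node j) * cell j t) <=
  2 / beta / n%:R.
Proof.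
move=> f1 t01; have [j jn jt] := node_cell t01.
have [_ hf _] := fspaceP f.
case/andP: (t01) => t0 t1; case/andP: (jt) => jt1 jt2.
rewrite (cell_sum _ jn jt).
have /andP[nj0 nj1] := node01 jn.
apply: (le_trans (bloch_radial_lipschitz halpha hf (fspace_norm_ge f1) nj0 jt1
  t1)).
rewrite mulr1; apply: ler_wpM2l; first by rewrite divr_ge0// ltW.
rewrite node_powR ?(ltnW jn)//.
have : (1 - node j.+1) `^ beta <= (1 - t) `^ beta.
  have := node_le jn (leqnn n); rewrite noden => h.
  by apply: ge0_ler_powR; rewrite ?nnegrE ?(ltW b0)//; lra.
rewrite node_powR// => h; rewrite -natr1 mulrDl mul1r in h; lra.
Qed.

(** [K f] is the Hankel integral of the step function with values [f (node j)], a combination of the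
    [n] fixed vectors [cell_image j]. Hence [S f - K f] is the Hankel integral of the approximation
    error, which [radial_approx] bounds. *)
Lemma finite_rank_approx : exists2 K : {linear bloch alpha -> fspace N},
  compact_op K & (opnorm (fun x => S x - K x)%R <= (K1 * (2 / beta /
    n%:R))%:E)%E.
Proof.
pose F (f : bloch alpha) : fspace N := \sum_(0 <= j < n) radial f (node j) *:
  cell_image j.
have FL (c : C) u v : F (c *: u + v) = c *: F u + F v.
  rewrite /F scaler_sumr -big_split/=; apply: eq_bigr => j _.
  rewrite [X in X *: _](_ : _ = c * radial u (node j) + radial v (node j)).
    by rewrite scalerDl scalerA.
  exact: fspace_val_lin.
have [K KF] := linear_of FL.
have valF f : fspace_val (F f) = fun z => \sum_(0 <= j < n) radial f (node j) *
  hankel_integral mu (cell j) z.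
  apply/funext => z; rewrite /F.
  elim/big_ind2: _ => // x1 x2 y1 y2 <- <-.
  by rewrite fspace_valD.
exists K.
  (* Coefficients from [n] on are set to 0: the compactness criterion wants a bound for every index,
     and [radial f (node j)] is controlled for [j < n] only. *)
  apply: (@compact_op_finite_rank _ _ _ K cell_image (fun j f => if (j < n)%N
    then radial f (node j) else 0) (1 + 2 / beta) n).
    move=> f; rewrite KF /F; apply: eq_big_nat => j /andP[_ ->//].
  move=> j f f1; case: ifPn => jn.
    by rewrite -[leRHS]mulr1; apply: radial_bound => //; exact: node01.
  by rewrite normcC0 addr_ge0// divr_ge0// ltW.
apply: ub_ereal_sup => _ [f /= f1 <-].
have mf := radial_bmeasurable f.
have ms : bmeasurable (fun t => \sum_(0 <= j < n) radial f (node j) * cell j t).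
  apply: bmeasurable_sum => j; apply: bmeasurableM;
    first exact: bmeasurable_cst.
  exact: bmeasurable_cell.
rewrite /= fineK; last exact: (fspace_fin (S f - K f)).
rewrite [X in (N X <= _)%E](_ : _ = hankel_integral mu
    (fun t => radial f t - \sum_(0 <= j < n) radial f (node j) * cell j t)).
  apply: HN.
  - by rewrite divr_gt0// divr_gt0.
  - exact: bmeasurableB.
  - by move=> t It; apply: radial_approx => //; exact: unit_itv01.
apply/funext => z; rewrite hankel_integralB// hankel_integral_sum; last first.
  exact: bmeasurable_cell.
have -> : \sum_(0 <= j < n) radial f (node j) * hankel_integral mu (cell j) z =
    fspace_val (F f) z by rewrite valF.
rewrite -SE -KF.
exact: (congr1 (fun g : C -> C => g z) (raddfB (\val : fspace N -> (C -> C)) (S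
  f) (K f))).
Qed.

End Partition.

Lemma essential_norm_hankel : essential_norm S = 0%E.
Proof.
apply/eqP; rewrite eq_le; apply/andP; split; last first.
  apply: le_ereal_inf_tmp => _ [K _ <-].
  apply: (@le_trans _ _ (complex.Re `|S 0 - K 0|)%:E).
    by have := normr_ge0 (S 0 - K 0); rewrite lee_fin lecE => /andP[].
  by apply: ereal_sup_ubound; exists 0 => //=; rewrite normr0 ler01.
apply/lee_addgt0Pr => e e0; rewrite add0e.
pose D : R := K1 * (2 / beta); have D0 : 0 <= D by rewrite mulr_ge0//
  divr_ge0// ltW.
pose n := (Num.truncn (D / e)).+1.
have [K cK SK] := @finite_rank_approx n isT.
apply: ge_ereal_inf; exists (opnorm (fun x => S x - K x)%R); first by exists K.
apply: (le_trans SK); rewrite lee_fin mulrA ler_pdivrMr ?ltr0n//.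
by rewrite -ler_pdivrMl// mulrC; exact: ltW (truncnS_gt _).
Qed.

End EssentialNorm.

(** * The Carleson condition from the Bloch norm of the image of 1 *)

Section CarlesonFromBloch.
Context (R : realType).
Variable mu : {finite_measure set (measurableTypeR R) -> \bar R}.
Local Notation C := R[i].
Local Notation I := (`[0%R, 1%R[%classic : set (measurableTypeR R)).

(** At a real point [r] the derivative is the integral of a nonnegative function, so its modulus
    loses nothing to cancellation. *)
Lemma hankel_one_derivative (M r : R) : 0 <= r < 1 ->
  (bloch_norm 1 (hankel_integral mu (fun=> 1%R)) <= M%:E)%E ->
  (\int[mu]_(t in I) (t * (1 - t * r)^-1 ^+ 2)%:E <= (M / (1 - r))%:E)%E.
Proof.
move=> r01 TM; case/andP: (r01) => r0 r1.
have Dr : disc (r%:C : C) by rewrite /disc/= normc_real_ge0.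
have d0 : 0 < 1 - r by rewrite subr_gt0.
have m1 : bmeasurable (fun=> 1 : C) by exact: bmeasurable_cst.
have b1 (t : R) : I t -> normc (1 : C) <= 1 by rewrite normc1.
have := bloch_derivative_le TM Dr.
have [_ ->] := hankel_integral_derivable mu m1 b1 Dr.
rewrite normc_real_ge0// powRr1; last by rewrite subr_ge0 exprn_ile1// ltW.
move=> H.
have H2 : normc (hankel_derivative mu (fun=> 1) r%:C) <= M / (1 - r).
  rewrite ler_pdivlMr//; apply: le_trans H; apply: ler_wpM2l;
    first exact: normc_ge0.
  by rewrite lerD2l lerN2 expr2 ler_piMr// ltW.
have E t : I t -> (1 : C) * (t%:C * hker r%:C t ^+ 2) = (t * (1 - t * r)^-1 ^+
  2)%:C.
  by move=> _; rewrite mul1r /hker !(rmorphM, rmorphXn, fmorphV, rmorphB,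
    rmorph1).
have mk := bmeasurableM m1 (bmeasurable_hker_deriv Dr).
have [ir _] := bmeasurable_integrable mu mk.
have E2 : {in I, EFin \o (fun t => complex.Re (1 * (t%:C * hker r%:C t ^+ 2)))
  =1
    (fun t => (t * (1 - t * r)^-1 ^+ 2)%:E)}.
  by move=> t /set_mem It; congr (_%:E); exact: (congr1 (@complex.Re R) (E t
    It)).
rewrite -(eq_integral _ _ E2).
have mI' : measurable I by exact: measurable_itv.
rewrite -(fineK (integrable_fin_num mI' ir)) lee_fin.
apply: le_trans H2; apply: le_trans (normc_Re_le _).
exact: ler_norm.
Qed.

(** Take [r = 1 - d]. For [d <= 1 / 2] and [t] in [[1 - d, 1[], one has [t >= 1 / 2] and
    [1 - t (1 - d) <= 2 d], so the integrand is at least [1 / (8 d^2)] and [mu E <= 8 M d]. For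
    larger [d] the total mass is at most [2 d] times itself. The summand 1 makes [A] positive. *)
Lemma carleson_of_bloch (M : R) :
  (bloch_norm 1 (hankel_integral mu (fun=> 1%R)) <= M%:E)%E ->
  exists2 A : R, 0 < A & carleson mu A.
Proof.
move=> TM.
have M0 : 0 <= M by exact: bloch_bound_ge0 TM.
exists (8 * M + 2 * mass mu + 1); first by rewrite ltr_wpDl// addr_ge0//
  mulr_ge0// mass_ge0.
move=> d /andP[d0 d1].
set E : set (measurableTypeR R) := `[(1 - d)%R, 1%R[%classic.
have mE : measurable E by exact: measurable_itv.
have mI' : measurable I by exact: measurable_itv.
have EI : E `<=` I.
  by move=> t; rewrite /E /= !in_itv/= => /andP[h ->]; rewrite andbT; lra.
have [d2|d2] := leP d (1 / 2); last first.
  apply: (@le_trans _ _ (mu I)); first by apply: le_measure; rewrite ?inE.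
  rewrite -massE lee_fin.
  have := mass_ge0 mu; move: (mass mu) => m m0; nra.
have r01 : 0 <= 1 - d < 1 by apply/andP; split; lra.
have H := hankel_one_derivative r01 TM.
rewrite (_ : 1 - (1 - d) = d) in H; last ring.
have dd : 0 < 8 * d ^+ 2 by rewrite mulr_gt0// exprn_gt0.
have pt t : E t -> (8 * d ^+ 2)^-1 <= t * (1 - t * (1 - d))^-1 ^+ 2.
  rewrite /E /= in_itv/= => /andP[h1 h2].
  have p0 : 0 < 1 - t * (1 - d) by nra.
  have p1 : 1 - t * (1 - d) <= 2 * d by nra.
  rewrite exprVn ler_pdivlMr ?exprn_gt0// ler_pdivrMl//.
  have : (1 - t * (1 - d)) ^+ 2 <= (2 * d) ^+ 2.
    by rewrite lerXn2r ?nnegrE// ?ltW// mulr_gt0.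
  have : 0 < d ^+ 2 by rewrite exprn_gt0.
  rewrite exprMn; move: (_ ^+ 2) ((1 - t * (1 - d)) ^+ 2) => x y x0 yx; nra.
have mg : measurable_fun I (fun t : R => (t * (1 - t * (1 - d))^-1 ^+ 2)%:E).
  apply/measurable_EFinP/measurable_funM => //; apply: measurable_funX.
  apply: measurable_funV_ge0.
    by apply: measurable_funB; [exact: measurable_cst|exact: measurable_funM].
  by move=> t /unit_itv01 /andP[h1 h2]; nra.
have : ((8 * d ^+ 2)^-1%:E * mu E <= (M / d)%:E)%E.
  apply: le_trans H; rewrite -(integral_cst mu mE).
  apply: (@le_trans _ _ (\int[mu]_(t in E) (t * (1 - t * (1 - d))^-1 ^+
    2)%:E)%E).
    apply: ge0_le_integral => //.
    - by move=> t _; rewrite /= lee_fin invr_ge0 ltW.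
    - exact: measurable_funS mg.
  apply: ge0_subset_integral => // t /unit_itv01/andP[t0 t1].
  by rewrite lee_fin mulr_ge0// exprn_ge0// invr_ge0; nra.
rewrite -(fineK (fin_num_measure mu _ mE)) -EFinM !lee_fin ler_pdivrMl// => h.
apply: (le_trans h); have := mass_ge0 mu; move: (mass mu) => m m0.
rewrite (_ : 8 * d ^+ 2 * (M / d) = 8 * M * d); last by field; rewrite gt_eqF.
by rewrite ler_pM2r//; lra.
Qed.

End CarlesonFromBloch.

(** * The test function 1 *)

Section ConstantOne.
Context (R : realType).
Local Notation C := R[i].

(** Cut off outside the disc because members of [fspace] vanish there. *)
Definition disc_one (z : C) : C := if normc z < 1 then 1 else 0.

Lemma disc_one_derivable z : disc z ->
  derivable disc_one z 1 /\ derive1 disc_one z = 0.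
Proof.
move=> Dz; have d0 : 0 < (1 - normc z) / 2 by rewrite divr_gt0// subr_gt0.
apply: (derivable_of_taylor d0 (lexx 0)) => u ud.
have Dzu : normc (z + u) < 1.
  by apply: (le_lt_trans (normcD_le _ _)); have : normc z < 1 := Dz; lra.
by rewrite /disc_one Dzu (_ : normc z < 1 = true)// subrr mulr0 subr0 normcC0
  mul0r.
Qed.

Lemma disc_one_fspace (alpha : R) : disc_one \in fspace_pred (bloch_dnorm
  alpha).
Proof.
apply/asboolP; split.
- by move=> z; rewrite /disc/= /disc_one => /negP/negbTE ->.
- by move=> z Dz; have [] := disc_one_derivable Dz.
apply: (@le_lt_trans _ _ ((normc (disc_one 0))%:E + 0%:E)%E); last exact: ltry.
apply: leeD => //; apply: ub_ereal_sup => _ [z Dz <-].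
by have [_ ->] := disc_one_derivable Dz; rewrite normcC0 mul0r.
Qed.

End ConstantOne.

Theorem corollary2p4 (R : realType)
    (mu : {finite_measure set (measurableTypeR R) -> \bar R}) (alpha : R)
    (halpha : 0 < alpha < 1) (T : {linear bloch alpha -> bloch (1 : R)})
    (hT : is_hankel_op mu T) (bT : bounded_op T) :
  essential_norm T = 0%E /\
  exists S : {linear bloch alpha -> bmoa R},
    [/\ is_hankel_op mu S, bounded_op S & essential_norm S = 0%E].
Proof.
have TE (f : bloch alpha) (z : R[i]) :
    fspace_val (T f) z = hankel_integral mu (radial f) z.
  have [Tf0 _ _] := fspaceP (T f); have [_ hf _] := fspaceP f.
  have [Dz|nDz] := pselect (disc z); last by rewrite Tf0// hankel_integral_off.
  have [a [b [af cb bg]]] := hT f.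
  have fN : (bloch_norm alpha f <= (fine (bloch_norm alpha f))%:E)%E.
    by rewrite fineK// (fspace_fin f).
  exact: (hankel_image_integral halpha hf fN af cb bg Dz).
have TEf f : fspace_val (T f) = hankel_integral mu (radial f).
  by apply/funext => z; exact: TE.
pose one : bloch alpha := Fspace (disc_one_fspace alpha).
have [A A0 hA] : exists2 A : R, 0 < A & carleson mu A.
  have E1 : fspace_val (T one) = hankel_integral mu (fun=> 1).
    rewrite TEf; apply/funext => z.
    have [Dz|nDz] := pselect (disc z); last by rewrite !hankel_integral_off.
    rewrite !hankel_integralE//; apply: eq_cint => t /unit_itv01/andP[t0 t1].
    by rewrite /radial /= /disc_one normc_real_ge0// t1.
  have T1fin : bloch_norm 1 (T one) \is a fin_num by exact: (fspace_fin (T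
    one)).
  by apply: (carleson_of_bloch (M := fine (bloch_norm 1 (T one))));
    rewrite -E1 (fineK T1fin).
split.
  apply: (@essential_norm_hankel R mu alpha _ (2 * mass mu + 192 * A) halpha _
    T TE).
  by move=> h M M0 mh hM; exact: hankel_integral_bloch.
have HN (h : R -> R[i]) (M : R) : 0 < M -> bmeasurable h ->
    (forall t, `[0%R, 1%R[%classic t -> normc (h t) <= M) ->
    (bmoa_dnorm R (hankel_integral mu h) <= ((2 * mass mu + 144 * A) * M)%:E)%E.
  by move=> M0 mh hM; exact: hankel_integral_bmoa.
(* The functions [T f] already lie in BMOA, so [S] is [T] with another target; adding 1 keeps the
   bound on [f] positive, as [HN] requires. *)
have SP (f : bloch alpha) : fspace_val (T f) \in fspace_pred (bmoa_dnorm R).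
  rewrite TEf; have fk : `|f| <= (fine (bloch_norm alpha f) + 1)%:C.
    by rewrite fspace_normE lecR lerDl.
  have k0 : 0 < fine (bloch_norm alpha f) + 1.
    by rewrite ltr_wpDl// fine_ge0// bloch_norm_ge0.
  have b0 : 0 < 1 + 2 / (1 - alpha).
    by case/andP: halpha => _ ?; rewrite ltr_wpDr// divr_ge0// subr_ge0 ltW.
  apply: (fspace_pred_hankel HN (mulr_gt0 b0 k0)).
    exact: radial_bmeasurable.
  by move=> t It; apply: radial_bound => //; exact: unit_itv01.
have [S SE] : exists S : {linear bloch alpha -> bmoa R},
    forall f, fspace_val (S f) = fspace_val (T f).
  have [c u v|S SF] := @linear_of R (bloch alpha) (bmoa R) (fun f => Fspace (SP
    f)).
    apply: val_inj; apply/funext => z.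
    transitivity (c * fspace_val (T u) z + fspace_val (T v) z).
      by rewrite /= linearP; exact: fspace_val_lin.
    exact: esym (fspace_val_lin c (Fspace (SP u)) (Fspace (SP v)) z).
  by exists S => f; rewrite SF.
have SE' f z : fspace_val (S f) z = hankel_integral mu (radial f) z.
  by rewrite SE TE.
exists S; split.
- by move=> f; have [a [b H]] := hT f; exists a, b; rewrite SE.
- exact: bounded_op_hankel halpha HN S SE'.
- exact: essential_norm_hankel halpha HN S SE'.
Qed.
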